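(* Let $\epsilon\in\{1,-1\}$, let $g\colon M^2\to\mathbb{Q}_\epsilon^3$ be an immersed surface that is flat in the induced metric, let $N$ be a unit normal vector field to $g$ in $\mathbb{Q}^3_\epsilon$, and let $g_s=C_\epsilon(s)\,g+S_\epsilon(s)\,N$ be the family of parallel surfaces to $g$. Let $V\subset M^2$ be an open subset and $I$ an open interval containing $0$ such that $V\times I\subset U$, where $U\subset M^2\times\mathbb{R}$ is the set defined in the context (so that $g_s$ is an immersion on $V$ for every $s\in I$). Let $B>0$ and define $$f\colon M^3:=V\times I\to\mathbb{Q}_\epsilon^3\times\mathbb{R},\qquad f(x,s)=g_s(x)+Bs\,\frac{\partial}{\partial t}.$$ Then $f$ is an immersion with unit normal vector field $\eta$ in $\mathbb{Q}_\epsilon^3\times\mathbb{R}$ satisfying $\langle\eta,\frac{\partial}{\partial t}\rangle=\frac1a$ with $a=\sqrt{1+B^2}$, so $\eta$ makes a constant angle with $\frac{\partial}{\partial t}$. The manifold $M^3$ with the metric induced by $f$ has constant sectional curvature $c=\frac{\epsilon}{a^2}=\frac{\epsilon}{1+B^2}$. These hypersurfaces form a family of nonrotational hypersurfaces (i.e. they are not rotation hypersurfaces in the sense of the context) of $\mathbb{S}^3\times\mathbb{R}$ (respectively, $\mathbb{H}^3\times\mathbb{R}$) with constant sectional curvature $c$, for any $c\in(0,1)$ if $\epsilon=1$ (respectively, any $c\in(-1,0)$ if $\epsilon=-1$).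
   Context: $\mathbb{Q}_1^3=\mathbb{S}^3$ is the unit sphere in Euclidean space $\mathbb{E}^4=\mathbb{R}^4$, and $\mathbb{Q}_{-1}^3=\mathbb{H}^3$ is the hyperbolic space $\{-x_1^2+x_2^2+x_3^2+x_4^2=-1,\ x_1>0\}$ in Lorentzian space $\mathbb{E}^4=\mathbb{L}^4$ with metric $-dx_1^2+dx_2^2+dx_3^2+dx_4^2$. $\mathbb{Q}_\epsilon^3\times\mathbb{R}\subset\mathbb{E}^4\times\mathbb{R}=\mathbb{E}^5$ has the product metric, with $x_5$ the coordinate on the factor $\mathbb{R}$, and $\frac{\partial}{\partial t}$ is the unit vector field tangent to that factor. The functions are $C_1(s)=\cos s$, $S_1(s)=\sin s$, $C_{-1}(s)=\cosh s$, $S_{-1}(s)=\sinh s$. Definition of $U$. For $\epsilon=1$, write the distinct principal curvatures of $g$ with respect to $N$ as $\lambda_i=\cot\theta_i$, $0<\theta_i<\pi$, $1\le i\le m$, with the $\theta_i$ increasing, and set $U=\{(x,s)\in M^2\times\mathbb{R}: s\in(\theta_m(x)-\pi,\theta_1(x))\}$. For $\epsilon=-1$, write the principal curvatures of $g$ with absolute value greater than $1$ as $\lambda_i=\coth\theta_i$, $\theta_i\ne0$, let $\theta_+$ be the least positive $\theta_i$ and $\theta_-$ the greatest negative $\theta_i$ (with $\theta_+=+\infty$, respectively $\theta_-=-\infty$, if there is none), and set $U=\{(x,s)\in M^2\times\mathbb{R}: s\in(\theta_-(x),\theta_+(x))\}$. Rotation hypersurface. Let $P^3$ be a three-dimensional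 subspace of $\mathbb{E}^5$ containing the $\frac{\partial}{\partial x_1}$ and $\frac{\partial}{\partial x_5}$ directions, so that $(\mathbb{Q}^3_\epsilon\times\mathbb{R})\cap P^3=\mathbb{Q}^1_\epsilon\times\mathbb{R}$, and let $P^2\subset P^3$ be a two-dimensional subspace also containing the $\frac{\partial}{\partial x_5}$ direction. Let $\mathcal{I}$ be the group of isometries of $\mathbb{E}^5$ fixing $P^2$ pointwise, and let $\alpha$ be a curve in $\mathbb{Q}^1_\epsilon\times\mathbb{R}\subset P^3$ lying in one of the two half-spaces of $P^3$ determined by $P^2$. The rotation hypersurface of $\mathbb{Q}^3_\epsilon\times\mathbb{R}$ with profile curve $\alpha$ and axis $P^2$ is the orbit of $\alpha$ under $\mathcal{I}$.
   Formalization: For ε=−1 the nonrotational claim additionally assumes that g is not totally umbilical on V (not made of pieces of horospheres): for a complete horosphere and I=ℝ, f is a rotation hypersurface with degenerate axis P², so the claim fails there. *)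

(* Defs.v *)
From HB Require Import structures.
From mathcomp Require Import all_boot all_order all_algebra.
From mathcomp Require Import all_classical all_reals all_analysis.

Set Implicit Arguments.
Unset Strict Implicit.
Unset Printing Implicit Defensive.

Import Order.TTheory GRing.Theory Num.Theory.
Import numFieldNormedType.Exports.
Local Open Scope classical_set_scope.
Local Open Scope ring_scope.

Section Smooth.
Context {R : realType} {V W : normedModType R}.
Implicit Types (D : set V) (f : V -> W).

(* On an open set D this is C^k: f is C^(k+1) iff it is differentiable and all
   its directional derivatives are C^k. *)
Fixpoint Ck (k : nat) D f : Prop :=
  match k with
  | 0 => forall x, D x -> {for x, continuous f}
  | k'.+1 => (forall x, D x -> differentiable f x) /\
             forall v, Ck k' D (fun x => 'D_v f x)
  end.

Definition smooth D f : Prop := forall k, Ck k D f.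

End Smooth.

(* A chart is stored as a pair of total functions; only their values on
   chart_dom and chart_im matter. *)
Record chart (R : realType) (X : Type) (n : nat) := Chart {
  chart_dom : set X;
  chart_map : X -> 'rV[R]_n;
  chart_inv : 'rV[R]_n -> X }.

Definition chart_im (R : realType) (X : Type) n (phi : chart R X n) :=
  chart_map phi @` chart_dom phi.

Section Manifold.
Context {R : realType} {X : topologicalType} {n : nat}.
Implicit Types (phi psi : chart R X n) (A : set (chart R X n)).

Definition is_chart phi : Prop :=
  [/\ open (chart_dom phi), open (chart_im phi),
      forall x, chart_dom phi x -> chart_inv phi (chart_map phi x) = x,
      forall x, chart_dom phi x -> {for x, continuous (chart_map phi)} &
      forall u, chart_im phi u -> {for u, continuous (chart_inv phi)}].

Definition smooth_atlas A : Prop :=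
  [/\ forall phi, A phi -> is_chart phi,
      forall x, exists2 phi, A phi & chart_dom phi x &
      forall phi psi, A phi -> A psi ->
        smooth (chart_map phi @` (chart_dom phi `&` chart_dom psi))
               (chart_map psi \o chart_inv phi)].

Definition smooth_manifold A : Prop :=
  [/\ hausdorff_space X, @second_countable X & smooth_atlas A].

(* The atlas induced on the open subset D. *)
Definition restrict_atlas A (D : set X) : set (chart R X n) :=
  [set Chart (chart_dom phi `&` D) (chart_map phi) (chart_inv phi) | phi in A].

(* The product atlas on M x I, for an atlas A of M and an interval I. *)
Definition cylinder_atlas A (I : set R) : set (chart R (X * R)%type n.+1) :=
  [set Chart (chart_dom phi `*` I)
         (fun p => castmx (erefl, addn1 n)
                     (row_mx (chart_map phi p.1) (p.2)%:M))
         (fun u => (chart_inv phi (\row_i u 0 (widen_ord (leqnSn n) i)),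
                    u 0 ord_max))
  | phi in A].

Section Maps.
Context {m : nat}.
Implicit Types F : X -> 'rV[R]_m.

Definition smooth_map A F : Prop :=
  forall phi, A phi -> smooth (chart_im phi) (F \o chart_inv phi).

Definition immersion A F : Prop :=
  smooth_map A F /\
  forall phi u, A phi -> chart_im phi u ->
    injective ('d (F \o chart_inv phi) u).

End Maps.
End Manifold.

Section Curvature.
Context {R : realType} {n : nat}.
Implicit Types (G : 'rV[R]_n -> 'M[R]_n) (u X Y : 'rV[R]_n) (i j k l : 'I_n).

Definition partial (W : normedModType R) (F : 'rV[R]_n -> W) i u : W :=
  'D_(delta_mx 0 i) F u.

(* Christoffel symbol Gamma^k_ij of the metric with coefficients G. *)
Definition christoffel G k i j u : R :=
  2^-1 * \sum_l invmx (G u) k l *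
    (partial (fun w => G w j l : R^o) i u
     + partial (fun w => G w i l : R^o) j u
     - partial (fun w => G w i j : R^o) l u).

(* The coefficient along d_l of
   R(d_i, d_j) d_k = nabla_i nabla_j d_k - nabla_j nabla_i d_k. *)
Definition riemann G i j k l u : R :=
  partial (christoffel G l j k : _ -> R^o) i u
  - partial (christoffel G l i k : _ -> R^o) j u
  + \sum_m (christoffel G m j k u * christoffel G l i m u
            - christoffel G m i k u * christoffel G l j m u).

Definition metric G u X Y : R := (X *m G u *m Y^T) 0 0.

(* <R(X, Y) Y, X> / (|X|^2 |Y|^2 - <X, Y>^2) *)
Definition sectional_curvature G u X Y : R :=
  (\sum_i \sum_j \sum_k \sum_l \sum_m
     X 0 i * Y 0 j * Y 0 k * X 0 m * riemann G i j k l u * G u l m) /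
  (metric G u X X * metric G u Y Y - metric G u X Y ^+ 2).

End Curvature.

(* The metric eps dx_1^2 + dx_2^2 + ... of E^d; x_1 has index 0. *)
Definition ip {R : realType} {d : nat} (eps : R) (u v : 'rV[R]_d) : R :=
  \sum_(i < d) (if i == 0%N :> nat then eps else 1) * (u 0 i * v 0 i).

Definition gram {R : realType} {n d : nat} (eps : R)
    (F : 'rV[R]_n -> 'rV[R]_d) (u : 'rV[R]_n) : 'M[R]_n :=
  \matrix_(i, j) ip eps (partial F i u) (partial F j u).

Definition constant_curvature {R : realType} {X : topologicalType} {n d : nat}
    (eps : R) (A : set (chart R X n)) (F : X -> 'rV[R]_d) (c : R) : Prop :=
  forall phi u (v w : 'rV[R]_n), A phi -> chart_im phi u ->
    row_free (col_mx v w) ->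
    sectional_curvature (gram eps (F \o chart_inv phi)) u v w = c.

Definition normal_along {R : realType} {X : topologicalType} {n d : nat}
    (eps : R) (A : set (chart R X n)) (F nu : X -> 'rV[R]_d) : Prop :=
  forall phi u (v : 'rV[R]_n), A phi -> chart_im phi u ->
    ip eps (nu (chart_inv phi u)) ('D_v (F \o chart_inv phi) u) = 0.

Section Ambient.
Context {R : realType}.
Variable eps : R.

Definition Q3 : set 'rV[R]_4 :=
  [set p | ip eps p p = eps /\ (eps = -1 -> 0 < p 0 0)].

(* E^5 = E^4 x R *)
Definition toE5 (p : 'rV[R]_4) (t : R) : 'rV[R]_5 :=
  row_mx p (t%:M : 'rV[R]_1).
Definition horizontal (q : 'rV[R]_5) : 'rV[R]_4 :=
  lsubmx (q : 'rV[R]_(4 + 1)).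
Definition Q3xR : set 'rV[R]_5 := [set q | Q3 (horizontal q)].

Definition e1 : 'rV[R]_5 := delta_mx 0 ord0.
Definition dt : 'rV[R]_5 := delta_mx 0 ord_max.

Definition Ceps (s : R) : R :=
  if eps == 1 then cos s else (expR s + expR (- s)) / 2.
Definition Seps (s : R) : R :=
  if eps == 1 then sin s else (expR s - expR (- s)) / 2.

(* cot for eps = 1, coth for eps = -1 *)
Definition cteps (s : R) : R := Ceps s / Seps s.

Section Surface.
Context {M : topologicalType}.
Variables (A : set (chart R M 2)) (g N : M -> 'rV[R]_4).

Record flat_surface : Prop := FlatSurface {
  flat_surface_manifold : smooth_manifold A;
  flat_surface_immersion : immersion A g;
  flat_surface_in_Q3 : forall x, Q3 (g x);
  flat_surface_flat : constant_curvature eps A g 0;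
  flat_surface_normal_smooth : smooth_map A N;
  flat_surface_normal_unit : forall x, ip eps (N x) (N x) = 1;
  flat_surface_normal_tangent_Q3 : forall x, ip eps (N x) (g x) = 0;
  flat_surface_normal : normal_along eps A g N }.

(* With h_ij = - <d_i N, d_j g>, the relation dN = - dg o S says that S has
   matrix h (gram g)^-1 acting on row vectors. *)
Definition shape_operator (phi : chart R M 2) (u : 'rV[R]_2) : 'M[R]_2 :=
  (\matrix_(i, j) - ip eps (partial (N \o chart_inv phi) i u)
                           (partial (g \o chart_inv phi) j u))
  *m invmx (gram eps (g \o chart_inv phi) u).

Definition principal_curvature (x : M) (lambda : R) : Prop :=
  exists phi, [/\ A phi, chart_dom phi x &
    eigenvalue (shape_operator phi (chart_map phi x)) lambda].

(* A totally umbilical flat surface of H^3 is an open part of a horosphere, and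
   its family of parallel surfaces is swept out by parabolic rotations, those
   with a degenerate axis. There are no such surfaces in S^3. *)
Definition totally_umbilical (V : set M) : Prop :=
  forall x lambda mu, V x ->
    principal_curvature x lambda -> principal_curvature x mu -> lambda = mu.

(* For eps = 1 the bounds for all angles theta in (0, pi) together mean
   theta_m - pi < s < theta_1. For eps = -1 they mean theta_- < s < theta_+,
   infinite values included. *)
Definition Uset : set (M * R) :=
  [set p | forall theta, principal_curvature p.1 (cteps theta) ->
    if eps == 1 then 0 < theta < pi -> theta - pi < p.2 < theta
    else theta != 0 -> (0 < theta -> p.2 < theta) /\
                       (theta < 0 -> theta < p.2)].

Definition parallel_surface (s : R) (x : M) : 'rV[R]_4 :=
  Ceps s *: g x + Seps s *: N x.

Definition hypersurface (B : R) (p : M * R) : 'rV[R]_5 :=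
  toE5 (parallel_surface p.2 p.1) 0 + (B * p.2) *: dt.

Definition admissible (V : set M) (I : set R) : Prop :=
  [/\ open V, open I, is_interval I, I 0 & V `*` I `<=` Uset].

End Surface.

(* The group of isometries of E^5 that fix P2 pointwise. *)
Definition fixing_isometry (P2 : {vspace 'rV[R]_5})
    (T : 'rV[R]_5 -> 'rV[R]_5) : Prop :=
  [/\ bijective T,
      forall p q, ip eps (T p - T q) (T p - T q) = ip eps (p - q) (p - q) &
      forall p, p \in P2 -> T p = p].

(* The curve need only be smooth, and it may meet the axis: this enlarges the
   class of rotation hypersurfaces. *)
Definition profile_curve (P3 P2 : {vspace 'rV[R]_5}) (J : set R)
    (alpha : R -> 'rV[R]_5) : Prop :=
  [/\ open J, is_interval J, smooth J (alpha : R^o -> _),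
      forall tau, J tau -> alpha tau \in P3 /\ Q3xR (alpha tau) &
      exists w, [/\ w \in P3, w \notin P2 & forall tau, J tau ->
        exists2 r, 0 <= r & alpha tau - r *: w \in P2]].

(* For eps = -1 some isometries exchange the two sheets of the hyperboloid;
   hence the intersection with Q3xR. *)
Definition rotation_hypersurface (S : set 'rV[R]_5) : Prop :=
  exists (P3 P2 : {vspace 'rV[R]_5}) (J : set R) (alpha : R -> 'rV[R]_5),
  [/\ [/\ \dim P3 = 3%N, e1 \in P3 & dt \in P3],
      [/\ \dim P2 = 2%N, (P2 <= P3)%VS & dt \in P2],
      profile_curve P3 P2 J alpha &
      S = [set q | Q3xR q /\ exists T tau,
             [/\ fixing_isometry P2 T, J tau & q = T (alpha tau)]]].

(* S is not even a part of a rotation hypersurface. *)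
Definition nonrotational (S : set 'rV[R]_5) : Prop :=
  forall S', rotation_hypersurface S' -> ~ S `<=` S'.

End Ambient.

(* Main.v *)
From HB Require Import structures.
Require Import Defs.
From mathcomp Require Import all_boot all_order all_algebra.
From mathcomp Require Import all_classical all_reals all_analysis.
From mathcomp Require Import ring lra zify.

Import Order.TTheory GRing.Theory Num.Theory.
Import numFieldNormedType.Exports.
Local Open Scope classical_set_scope.
Local Open Scope ring_scope.

Set Implicit Arguments.
Unset Strict Implicit.
Unset Printing Implicit Defensive.

(** The metric induced by f is that of the parallel surface g_s plus
    (1 + B^2) ds^2, and f has codimension two in E^5, with orthonormal normals
    g_s and eta = (d/dt - B N_s) / a, where N_s = d g_s / ds. By the Gauss
    equation, the numerator of the sectional curvature is eps times the squared
    area of the horizontal part plus (B / a)^2 times the determinant of the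
    second fundamental form of g_s. Flatness of g means that its Weingarten map has
    determinant -eps; this property passes to g_s, and the two terms combine
    to eps / a^2.

    If the image of f lay in a rotation hypersurface, the axis would contain
    d/dt and a horizontal vector p <> 0, and the isometries preserve x_5 and
    <., p>. So the pairs (B s, <g_s, p>) would lie on a smooth plane curve,
    whose image has empty interior; hence <g_s, p> would be stationary on the
    surface for every s, p would be a combination of g and N, and g would be
    umbilical. With determinant -eps this leaves only the horospheres of H^3. *)

(** * Smooth maps *)

(** The curvature computation is needed twice: for [g] in E^4 with normals [g] and [N], where
    vanishing curvature is read backwards as a condition on the Weingarten map, and for f in E^5.
    Both have codimension two, so one statement in arbitrary dimension n serves both. For eps = -1
    the ambient form is indefinite and the induced metrics are not definite for free. The position
    vector helps: it is normal and has square eps, so its orthogonal complement is positive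
    definite. The set U is used through the injectivity of C dg + S dN. On the rotational side an
    isometry is known only to preserve distances and to fix the axis, and the profile curve is
    merely smooth. Orbits are therefore replaced by two functions that are constant on them. That a
    curve cannot fill an open set of the plane is shown by counting on short pieces, and Baire's
    theorem assembles the pieces. Stationarity at s = 0 and at one s with S(s) <> 0 separates <dg,
    p> = 0 from <dN, p> = 0. *)

Section NearEq.
Context {R : realType} {V W : normedModType R}.

Lemma near_eq_differentiable (f g : V -> W) (x : V) :
  (\near x, f x = g x) -> differentiable f x -> differentiable g x.
Proof.
move=> fg df.
have dg : g \o shift x = cst (g x) + 'd f x +o_ 0 id.
  apply/eqaddoP => e e0.
  have /eqaddoP/(_ e e0) := diff_locally df.
  have fg0 : \forall h \near 0, f (h + x) = g (h + x).
    have := fg; rewrite (near_shift 0 x) /=.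
    by apply: filterS => h; rewrite /= subr0.
  apply: filterS2 fg0 => h /= e1.
  by rewrite !fctE /= e1 (nbhs_singleton fg).
have cd := diff_continuous df.
by apply/diff_locallyP; rewrite (diff_unique cd dg).
Qed.

Lemma open_eq_near (D : set V) (f g : V -> W) x :
  open D -> D x -> (forall y, D y -> f y = g y) -> \near x, f x = g x.
Proof. by move=> oD Dx fg; apply: filterS fg (open_nbhs_nbhs (conj oD Dx)). Qed.

(** [Ck] speaks of total functions, while the sum, product and chain rules identify derivatives only
    at points of [D]. This lemma carries those identities through every induction on [k] below;
    openness of [D] turns equality on [D] into equality near each point. *)
Lemma Ck_eq k (D : set V) (f g : V -> W) : open D ->
  (forall x, D x -> f x = g x) -> Ck k D f -> Ck k D g.
Proof.
move=> oD; elim: k f g => [|k IH] f g fg /=.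
  move=> cf x Dx; change (g @ x --> g x); rewrite -(fg _ Dx); apply: cvg_trans (cf x Dx).
  by apply: near_eq_cvg; exact: open_eq_near fg.
move=> [df dDf]; split=> [x Dx|v].
  by apply: near_eq_differentiable (df _ Dx); exact: open_eq_near fg.
apply: IH (dDf v) => x Dx.
by apply: near_eq_derive; exact: open_eq_near fg.
Qed.

Lemma CkW k (D : set V) (f : V -> W) : Ck k.+1 D f -> Ck k D f.
Proof.
elim: k f => [|k IH] f; first by case=> df _ x /df /differentiable_continuous.
by case=> df dDf; split=> // v; apply/IH/dDf.
Qed.

Lemma sub_Ck k (D D' : set V) (f : V -> W) : D' `<=` D -> Ck k D f -> Ck k D' f.
Proof.
move=> sD; elim: k f => [|k IH] f; first by move=> h x /sD; exact: h.
by case=> df dDf; split=> [x /sD|v]; [exact: df|exact/IH/dDf].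
Qed.

Lemma Ck_cst k (D : set V) (c : W) : Ck k D (fun=> c).
Proof.
elim: k c => [|k IH] c; first by move=> x _; exact: cst_continuous.
split=> [x _|v]; first exact: differentiable_cst.
have -> : (fun x : V => 'D_v (fun=> c) x) = (fun=> 0 : W).
  by apply: funext => x; exact: derive_cst.
exact: IH.
Qed.

Lemma CkD k (D : set V) (f g : V -> W) : open D ->
  Ck k D f -> Ck k D g -> Ck k D (fun x => f x + g x).
Proof.
move=> oD; elim: k f g => [|k IH] f g.
  by move=> cf cg x Dx; apply: cvgD; [exact: cf|exact: cg].
move=> [df dDf] [dg dDg]; split=> [x Dx|v].
  by apply: differentiableD; [exact: df|exact: dg].
apply: Ck_eq oD _ (IH _ _ (dDf v) (dDg v)) => x Dx /=.
by rewrite deriveD //; apply: diff_derivable; [exact: df|exact: dg].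
Qed.

Lemma Ck_sum k (D : set V) n (f : 'I_n -> V -> W) : open D ->
  (forall i, Ck k D (f i)) -> Ck k D (fun x => \sum_i f i x).
Proof.
move=> oD; elim: n f => [|n IH] f Hf.
  by under eq_fun do rewrite big_ord0; exact: Ck_cst.
under eq_fun do rewrite big_ord_recl.
apply: CkD => //; exact: IH.
Qed.

End NearEq.

Section LinComp.
Context {R : realType} {V W W' : normedModType R}.

Lemma derive_postlin (L : {linear W -> W'}) (f : V -> W) x v :
  continuous L -> differentiable f x -> 'D_v (L \o f) x = L ('D_v f x).
Proof.
move=> cL df.
have dL : differentiable L (f x) by apply: linear_differentiable.
by rewrite !deriveE //; [rewrite diff_comp //= diff_lin|exact: differentiable_comp].
Qed.

Lemma Ck_postlin k (D : set V) (L : {linear W -> W'}) (f : V -> W) : open D ->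
  continuous L -> Ck k D f -> Ck k D (L \o f).
Proof.
move=> oD cL; elim: k f => [|k IH] f.
  by move=> cf x Dx; apply: continuous_comp; [exact: cf|exact: cL].
move=> [df dDf]; split=> [x Dx|v].
  by apply: differentiable_comp; [exact: df|apply: linear_differentiable].
apply: Ck_eq oD _ (IH _ (dDf v)) => x Dx /=.
by rewrite derive_postlin //; exact: df.
Qed.

Lemma derive_prelin (L : {linear V -> W}) (f : W -> W') x v :
  continuous L -> differentiable f (L x) -> 'D_v (f \o L) x = 'D_(L v) f (L x).
Proof.
move=> cL df.
have dL : differentiable L x by apply: linear_differentiable.
by rewrite !deriveE //; [rewrite diff_comp //= diff_lin|exact: differentiable_comp].
Qed.

Lemma Ck_prelin k (D : set V) (D' : set W) (L : {linear V -> W}) (f : W -> W') :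
  open D -> continuous L -> (forall x, D x -> D' (L x)) ->
  Ck k D' f -> Ck k D (f \o L).
Proof.
move=> oD cL sD; elim: k f => [|k IH] f.
  by move=> cf x Dx; apply: continuous_comp; [exact: cL|exact/cf/sD].
move=> [df dDf]; split=> [x Dx|v].
  by apply: differentiable_comp; [apply: linear_differentiable|exact/df/sD].
apply: Ck_eq oD _ (IH _ (dDf (L v))) => x Dx /=.
by rewrite derive_prelin //; exact/df/sD.
Qed.

Lemma Ck_linear k (D : set V) (L : {linear V -> W}) : continuous L -> Ck k D L.
Proof.
move=> cL; case: k => [|k]; first by move=> x _; exact: cL.
split=> [x _|v]; first exact: linear_differentiable.
have -> : (fun x => 'D_v L x) = fun=> L v.
  by apply: funext => x; rewrite deriveE ?diff_lin //; exact: linear_differentiable.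
exact: Ck_cst.
Qed.

End LinComp.

Section Scalar.
Context {R : realType} {V : normedModType R}.

Lemma CkM k (D : set V) (f g : V -> R^o) : open D ->
  Ck k D f -> Ck k D g -> Ck k D (fun x => f x * g x : R^o).
Proof.
move=> oD; elim: k f g => [|k IH] f g.
  by move=> cf cg x Dx; apply: cvgM; [exact: cf|exact: cg].
move=> Hf Hg; have [df dDf] := Hf; have [dg dDg] := Hg; split=> [x Dx|v].
  by apply: differentiableM; [exact: df|exact: dg].
have /CkW cf := Hf; have /CkW cg := Hg.
apply: Ck_eq oD _ (CkD oD (IH _ _ cf (dDg v)) (IH _ _ cg (dDf v))) => x Dx /=.
by rewrite deriveM //; apply: diff_derivable; [exact: df|exact: dg].
Qed.

End Scalar.

Section Line.
Context {R : realType} {V W : normedModType R}.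

Lemma is_derive_line (f : V -> W) (y u : V) (t : R) :
  derivable f (y + t *: u) u ->
  is_derive t (1 : R) (fun t : R => f (y + t *: u)) ('D_u f (y + t *: u)).
Proof.
move=> df.
have e : (fun h : R => h^-1 *: (f (y + (h *: (1 : R^o) + t) *: u) - f (y + t *: u)))
       = (fun h : R => h^-1 *: (f (h *: u + (y + t *: u)) - f (y + t *: u))).
  apply: funext => h; congr (_ *: (f _ - _)).
  by rewrite scalerDl [h *: _]mulr1 addrCA.
by split; rewrite /derivable /derive e.
Qed.

End Line.

(** * Symmetry of second derivatives *)

Section Schwarz.
Context {R : realType} {V : normedModType R}.
Implicit Types (f : V -> R^o) (x u v : V).

(** The second difference is phi(h) - phi(0) for phi(t) = f(x + h v + t u) - f(x + t u). The mean
    value theorem makes it h times a difference of two values of ['D_u f] at points close to [x],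
    and the first-order expansion of ['D_u f] at [x] evaluates that difference. *)
Lemma second_difference (D : set V) f x u v (e : R) : open D -> D x ->
  (forall y, D y -> differentiable f y) ->
  differentiable ('D_u f : V -> R^o) x -> 0 < e ->
  exists2 r : R, 0 < r & forall h, 0 < h < r ->
    `|f (x + h *: u + h *: v) - f (x + h *: u) - f (x + h *: v) + f x
      - h ^+ 2 * 'D_v ('D_u f : V -> R^o) x| <= e * h ^+ 2 * (2 * (`|u| + `|v|)).
Proof.
move=> oD Dx df dg e0; set g := 'D_u f : V -> R^o.
have /nbhs_ballP[r1 /= r10 Dr1] := open_nbhs_nbhs (conj oD Dx).
have /eqaddoP/(_ e e0)/nbhs_ballP[r2 /= r20 Hr2] := diff_locally dg.
have Hg k : `|k| < r2 -> `|g (x + k) - (g x + 'd g x k)| <= e * `|k|.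
  move=> kr; have := Hr2 k; rewrite -ball_normE /= sub0r normrN => /(_ kr).
  by rewrite [x + k]addrC.
have n0 : 0 < `|u| + `|v| + 1 by rewrite ltr_wpDl ?addr_ge0.
(* The summand 1 keeps the denominator positive when u = v = 0. *)
pose r := Num.min r1 r2 / (`|u| + `|v| + 1).
have r0 : 0 < r by rewrite divr_gt0 // lt_min r10.
exists r => // h /andP[h0 hr].
have hm : h * (`|u| + `|v|) < Num.min r1 r2.
  apply: (@le_lt_trans _ _ (h * (`|u| + `|v| + 1))).
    by rewrite ler_wpM2l ?lerDl // ltW.
  by rewrite -ltr_pdivlMr.
have small t s : 0 <= t <= h -> 0 <= s <= h ->
    `|t *: u + s *: v| <= h * (`|u| + `|v|).
  move=> /andP[t0 th] /andP[s0 sh]; apply: (le_trans (ler_normD _ _)).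
  by rewrite !normrZ !ger0_norm // mulrDr lerD // ler_wpM2r.
have inD t s : 0 <= t <= h -> 0 <= s <= h -> D (x + (t *: u + s *: v)).
  move=> th sh; apply: Dr1; rewrite -ball_normE /= opprD addrA subrr sub0r normrN.
  by apply: (le_lt_trans (small _ _ th sh)); apply: (lt_le_trans hm); rewrite ge_min lexx.
have in2 t s : 0 <= t <= h -> 0 <= s <= h -> `|t *: u + s *: v| < r2.
  move=> th sh; apply: (le_lt_trans (small _ _ th sh)).
  by apply: (lt_le_trans hm); rewrite ge_min lexx orbT.
have hh : 0 <= h <= h by rewrite lexx ltW.
have zh : 0 <= (0 : R) <= h by rewrite lexx ltW.
pose phi (t : R) : R^o := f ((x + h *: v) + t *: u) - f (x + t *: u).
have d1 t : 0 <= t <= h -> derivable f ((x + h *: v) + t *: u) u.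
  by move=> th; apply/diff_derivable/df; rewrite -addrA [h *: v + _]addrC; exact: inD.
have d2 t : 0 <= t <= h -> derivable f (x + t *: u) u.
  by move=> th; apply/diff_derivable/df; have := inD t 0 th zh; rewrite scale0r addr0.
have dphi t : 0 <= t <= h ->
    is_derive t (1 : R) phi (g (x + (t *: u + h *: v)) - g (x + (t *: u + 0 *: v))).
  move=> th; rewrite scale0r addr0 [t *: u + _]addrC addrA.
  by apply: is_deriveB; apply: is_derive_line; [exact: d1|exact: d2].
have [||t ht eq] := @MVT _ phi (fun t => g (x + (t *: u + h *: v)) - g (x + (t *: u + 0 *: v))) 0 h h0.
- by move=> t; rewrite in_itv /= => /andP[a b]; apply: dphi; rewrite !ltW.
- apply: derivable_within_continuous => t; rewrite in_itv /= => th.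
  by have [] := dphi t th.
have {}ht : 0 <= t <= h by move: ht; rewrite in_itv /= => /andP[a b]; rewrite !ltW.
have -> : f (x + h *: u + h *: v) - f (x + h *: u) - f (x + h *: v) + f x
    = phi h - phi 0.
  rewrite /phi scale0r !addr0 [x + h *: v + _]addrAC; ring.
rewrite eq subr0.
have Hd : 'D_v g x = 'd g x v by rewrite deriveE.
have := Hg _ (in2 t h ht hh); have := Hg _ (in2 t 0 ht zh).
set A := g _; set B := g (x + (t *: u + h *: v)).
have -> : 'd g x (t *: u + h *: v) = 'd g x (t *: u + 0 *: v) + h * 'D_v g x.
  by rewrite Hd !linearD !linearZ /= [0 *: _]scale0r addr0.
set C := 'd g x _; set G := g x.
have := small t 0 ht zh; have := small t h ht hh.
set n1 := `|t *: u + h *: v|; set n2 := `|t *: u + 0 *: v|.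
set N := `|u| + `|v| => n1N n2N HA HB.
have -> : (B - A) * h - h ^+ 2 * 'D_v g x =
  h * ((B - (G + (C + h * 'D_v g x))) - (A - (G + C))) by ring.
rewrite normrM (gtr0_norm h0) [e * _]mulrC expr2 -!mulrA; apply: ler_wpM2l; first exact: ltW.
apply: (le_trans (ler_normB _ _)).
have Hn1 := le_trans HB (ler_wpM2l (ltW e0) n1N).
have Hn2 := le_trans HA (ler_wpM2l (ltW e0) n2N).
apply: (le_trans (lerD Hn1 Hn2)).
by rewrite le_eqVlt; apply/orP; left; apply/eqP; ring.
Qed.

(* The second difference is symmetric in [u] and [v]. *)
Lemma derive_comm (D : set V) f x u v : open D -> D x -> Ck 2 D f ->
  'D_v ('D_u f : V -> R^o) x = 'D_u ('D_v f : V -> R^o) x.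
Proof.
move=> oD Dx [df dDf].
apply/eqP; rewrite -subr_eq0 -normr_le0; apply/ler_addgt0Pl => e e0; rewrite addr0.
(* Each of the two expansions contributes an error with factor 2 (|u| + |v|); the summand 1 again
   covers u = v = 0. *)
pose N := 4 * (`|u| + `|v|) + 1.
have N0 : 0 < N by rewrite ltr_wpDl // mulr_ge0 // addr_ge0.
have eN0 : 0 < e / N by rewrite divr_gt0.
have [r1 r10 H1] := second_difference v oD Dx df (proj1 (dDf u) x Dx) eN0.
have [r2 r20 H2] := second_difference u oD Dx df (proj1 (dDf v) x Dx) eN0.
pose h := Num.min r1 r2 / 2.
have h0 : 0 < h by rewrite divr_gt0 // lt_min r10.
have hm : h < Num.min r1 r2 by rewrite ltr_pdivrMr // ltr_pMr ?ltr1n // lt_min r10.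
have /H1 : 0 < h < r1 by rewrite h0 (lt_le_trans hm) // ge_min lexx.
have /H2 : 0 < h < r2 by rewrite h0 (lt_le_trans hm) // ge_min lexx orbT.
rewrite [x + h *: v + _]addrAC [`|v| + _]addrC.
set a := f _; set b := f _; set c := f _; set d := f _.
set P := 'D_u _ _; set Q := 'D_v _ _ => K1 K2.
have h2 : 0 < h ^+ 2 by rewrite exprn_gt0.
rewrite -(ler_pM2l h2) -{1}(gtr0_norm h2) -normrM.
have -> : h ^+ 2 * (Q - P) = (a - b - c + d - h ^+ 2 * P) - (a - c - b + d - h ^+ 2 * Q).
  by ring.
apply: (le_trans (ler_normB _ _)); apply: (le_trans (lerD K1 K2)).
have -> : e / N * h ^+ 2 * (2 * (`|u| + `|v|)) + e / N * h ^+ 2 * (2 * (`|u| + `|v|))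
  = h ^+ 2 * (e * ((4 * (`|u| + `|v|)) / N)) by ring.
apply: ler_wpM2l; first exact: (ltW h2).
apply: ler_piMr; first exact: (ltW e0).
by rewrite ler_pdivrMr // mul1r /N lerDl.
Qed.

End Schwarz.

Section Coordinates.
Context {R : realType} {V : normedModType R} {d : nat}.
Implicit Types (f g : V -> 'rV[R]_d) (x v : V) (j : 'I_d).

Lemma differentiable_row_coord f x j :
  differentiable f x -> differentiable (fun y => f y 0 j : R^o) x.
Proof.
move=> df; apply: (@differentiable_comp _ _ _ _ f (fun w : 'rV[R]_d => w 0 j : R^o)) => //.
exact: differentiable_coord.
Qed.

Lemma derive_row_coord f x v j : derivable f x v ->
  'D_v (fun y => f y 0 j : R^o) x = ('D_v f x) 0 j.
Proof. by move=> df; rewrite derive_mx // mxE. Qed.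

Lemma Ck_row_coord k (D : set V) f j : open D ->
  Ck k D f -> Ck k D (fun y => f y 0 j : R^o).
Proof.
move=> oD; elim: k f => [|k IH] f.
  move=> cf x Dx; apply: (@continuous_comp _ _ _ f (fun w : 'rV[R]_d => w 0 j)).
    exact: cf.
  exact: coord_continuous.
move=> [df dDf]; split=> [x Dx|v]; first exact/differentiable_row_coord/df.
apply: Ck_eq oD _ (IH _ (dDf v)) => x Dx /=.
by rewrite derive_row_coord //; exact/diff_derivable/df.
Qed.

Lemma derive_Zl (W : normedModType R) (h : V -> R^o) (w : W) x v :
  differentiable h x -> 'D_v (fun y => h y *: w) x = 'D_v h x *: w.
Proof.
move=> dh; have dhw : differentiable (fun y => h y *: w) x by exact: differentiableZl.
by rewrite !deriveE // diffZl.
Qed.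

Lemma CkZl k (D : set V) (W : normedModType R) (h : V -> R^o) (w : W) : open D ->
  Ck k D h -> Ck k D (fun y => h y *: w).
Proof.
move=> oD; elim: k h => [|k IH] h.
  by move=> ch x Dx; apply: cvgZr_tmp; exact: ch.
move=> [dh dDh]; split=> [x Dx|v]; first exact/differentiableZl/dh.
apply: Ck_eq oD _ (IH _ (dDh v)) => x Dx /=.
by rewrite derive_Zl //; exact: dh.
Qed.

Lemma Ck_row k (D : set V) f : open D ->
  (forall j, Ck k D (fun y => f y 0 j : R^o)) -> Ck k D f.
Proof.
move=> oD cf.
have -> : f = fun y => \sum_j f y 0 j *: (delta_mx 0 j : 'rV[R]_d).
  by apply: funext => y; rewrite {1}[f y]row_sum_delta.
by apply: Ck_sum => // j; apply: CkZl.
Qed.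

Lemma CkZ k (D : set V) (h : V -> R^o) f : open D ->
  Ck k D h -> Ck k D f -> Ck k D (fun y => h y *: f y).
Proof.
move=> oD ch cf; apply: Ck_row => // j.
under eq_fun do rewrite mxE.
by apply: CkM => //; exact: Ck_row_coord.
Qed.

Lemma differentiable_scale (h : V -> R^o) f x :
  differentiable h x -> differentiable f x -> differentiable (fun y => h y *: f y) x.
Proof.
move=> dh df.
have -> : (fun y => h y *: f y)
    = \sum_j (fun y => (h y * f y 0 j) *: (delta_mx 0 j : 'rV[R]_d)).
  apply: funext => y; rewrite fct_sumE [in LHS](row_sum_delta (f y)) scaler_sumr.
  by apply: eq_bigr => j _; rewrite scalerA.
apply: differentiable_sum => j; apply: differentiableZl.
by apply: differentiableM => //; exact: differentiable_row_coord.
Qed.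

Lemma derive_scale (h : V -> R^o) f x v :
  differentiable h x -> differentiable f x ->
  'D_v (fun y => h y *: f y) x = 'D_v h x *: f x + h x *: 'D_v f x.
Proof.
move=> dh df; apply/rowP => j; rewrite -derive_row_coord; last first.
  exact/diff_derivable/differentiable_scale.
under eq_fun do rewrite mxE.
rewrite deriveM; [|exact: diff_derivable|exact/diff_derivable/differentiable_row_coord].
rewrite !mxE derive_row_coord; last exact: diff_derivable.
by rewrite addrC [f x 0 j *: _]mulrC.
Qed.

End Coordinates.

Section Oscillator.
Context {R : realType} {V : normedModType R}.
Variables (c s : R -> R^o) (kappa : R) (l : {linear V -> R^o}).
Hypothesis cl : continuous l.
Hypothesis dc : forall t : R, is_derive t 1 c (kappa * s t).
Hypothesis ds : forall t : R, is_derive t 1 s (c t).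

Lemma derive_comp_lin (h : R -> R^o) (dh : R) x v :
  is_derive (l x) 1 h dh -> differentiable (h \o l) x /\ 'D_v (h \o l) x = dh * l v.
Proof.
move=> hd; have [/derivable1_diffP dd _] := hd.
have dl : differentiable l x by apply: linear_differentiable.
have dhl : differentiable (h \o l) x by exact: differentiable_comp.
split=> //; rewrite deriveE // diff_comp //= diff_lin //.
rewrite -[in LHS](mulr1 (l v)) linearZ /= -deriveE // derive_val mulrC.
by [].
Qed.

(** The derivative of each function is a multiple of the other, so the induction must carry both.
    With kappa = -eps this covers cos, sin and cosh, sinh at once. *)
Lemma Ck_oscillator k (D : set V) : open D -> Ck k D (c \o l) /\ Ck k D (s \o l).
Proof.
move=> oD; have dcx x v := derive_comp_lin v (dc (l x)).
have dsx x v := derive_comp_lin v (ds (l x)).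
elim: k => [|k [IHc IHs]].
  split=> x _; apply: differentiable_continuous.
    by case: (dcx x 0).
  by case: (dsx x 0).
split; split=> [x _|v].
- by case: (dcx x 0).
- apply: (Ck_eq oD) (CkM oD (Ck_cst k D (kappa * l v : R^o)) IHs) => x _ /=.
  by rewrite (dcx x v).2 mulrAC.
- by case: (dsx x 0).
- apply: (Ck_eq oD) (CkM oD (Ck_cst k D (l v : R^o)) IHc) => x _ /=.
  by rewrite (dsx x v).2 mulrC.
Qed.

End Oscillator.

(** * The bilinear form of E^d *)

Section InnerProduct.
Context {R : realType} {d : nat} (eps : R).
Implicit Types (u v w : 'rV[R]_d).
Local Notation "<< u , v >>" := (ip eps u v).

Lemma ipC u v : <<u, v>> = <<v, u>>.
Proof. by apply: eq_bigr => i _; rewrite [u 0 i * _]mulrC. Qed.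

Lemma ipDl u v w : <<u + v, w>> = <<u, w>> + <<v, w>>.
Proof. by rewrite -big_split; apply: eq_bigr => i _; rewrite /= mxE mulrDl mulrDr. Qed.

Lemma ipDr u v w : <<w, u + v>> = <<w, u>> + <<w, v>>.
Proof. by rewrite ipC ipDl !(ipC w). Qed.

Lemma ipZl a u v : <<a *: u, v>> = a * <<u, v>>.
Proof. by rewrite /ip mulr_sumr; apply: eq_bigr => i _; rewrite mxE; ring. Qed.

Lemma ipZr a u v : <<u, a *: v>> = a * <<u, v>>.
Proof. by rewrite ipC ipZl ipC. Qed.

Lemma ipNl u v : <<- u, v>> = - <<u, v>>.
Proof. by rewrite -scaleN1r ipZl mulN1r. Qed.

Lemma ipNr u v : <<u, - v>> = - <<u, v>>.
Proof. by rewrite ipC ipNl ipC. Qed.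

Lemma ip0l u : <<0, u>> = 0.
Proof. by rewrite -(scale0r 0) ipZl mul0r. Qed.

Lemma ip0r u : <<u, 0>> = 0.
Proof. by rewrite ipC ip0l. Qed.

Lemma ip_suml n (F : 'I_n -> 'rV[R]_d) v : <<\sum_i F i, v>> = \sum_i <<F i, v>>.
Proof.
elim: n F => [|n IH] F; first by rewrite !big_ord0 ip0l.
by rewrite !big_ord_recl ipDl IH.
Qed.

Lemma ip_sumr n (F : 'I_n -> 'rV[R]_d) v : <<v, \sum_i F i>> = \sum_i <<v, F i>>.
Proof. by rewrite ipC ip_suml; apply: eq_bigr => i _; rewrite ipC. Qed.

Definition ipE := (ipDl, ipDr, ipZl, ipZr, ipNl, ipNr, ip0l, ip0r).

Context {V : normedModType R}.
Implicit Types (f g : V -> 'rV[R]_d).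

Lemma differentiable_ip f g x : differentiable f x -> differentiable g x ->
  differentiable (fun y => <<f y, g y>> : R^o) x.
Proof.
move=> df dg.
have -> : (fun y => <<f y, g y>> : R^o) = \sum_(i < d) (fun y : V =>
    (if i == 0%N :> nat then eps else 1) *: (f y 0 i * g y 0 i : R^o)).
  by apply: funext => y; rewrite fct_sumE.
apply: differentiable_sum => i; apply: differentiableZ.
by apply: differentiableM; exact: differentiable_row_coord.
Qed.

Lemma derive_ip f g x (v : V) : differentiable f x -> differentiable g x ->
  'D_v (fun y => <<f y, g y>> : R^o) x = <<'D_v f x, g x>> + <<f x, 'D_v g x>>.
Proof.
move=> df dg.
have -> : (fun y => <<f y, g y>> : R^o) = \sum_(i < d) (fun y : V =>
    (if i == 0%N :> nat then eps else 1) *: (f y 0 i * g y 0 i : R^o)).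
  by apply: funext => y; rewrite fct_sumE.
have dc i : differentiable (fun y : V => f y 0 i * g y 0 i : R^o) x.
  by apply: differentiableM; exact: differentiable_row_coord.
rewrite derive_sum => [|i]; last exact/diff_derivable/differentiableZ.
rewrite -big_split; apply: eq_bigr => i _ /=.
rewrite deriveZ; last exact: diff_derivable.
rewrite deriveM; try exact/diff_derivable/differentiable_row_coord.
rewrite !derive_row_coord; try exact/diff_derivable.
by rewrite /GRing.scale /=; ring.
Qed.

Lemma Ck_ip k (D : set V) f g : open D -> Ck k D f -> Ck k D g ->
  Ck k D (fun y => <<f y, g y>> : R^o).
Proof.
move=> oD cf cg; apply: Ck_sum => // i.
apply: CkM => //; first exact: Ck_cst.
by apply: CkM => //; exact: Ck_row_coord.
Qed.

End InnerProduct.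

Section Partial.
Context {R : realType} {n : nat} {W : normedModType R}.

Lemma derive_partial (F : 'rV[R]_n -> W) u v : differentiable F u ->
  'D_v F u = \sum_i v 0 i *: partial F i u.
Proof.
move=> dF; rewrite deriveE // {1}[v]row_sum_delta linear_sum.
by apply: eq_bigr => i _; rewrite linearZ /partial deriveE.
Qed.

End Partial.

Lemma derive_comm_row {R : realType} {V : normedModType R} {d : nat} (D : set V)
    (f : V -> 'rV[R]_d) x u v : open D -> D x -> Ck 2 D f ->
  'D_v ('D_u f) x = 'D_u ('D_v f) x.
Proof.
move=> oD Dx cf; apply/rowP => j.
have H (a b : V) : ('D_a ('D_b f) x) 0 j
    = 'D_a ('D_b (fun y => f y 0 j : R^o) : V -> R^o) x.
  rewrite -derive_row_coord; last exact/diff_derivable/(cf.2 b).1.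
  apply: near_eq_derive; apply: (open_eq_near oD Dx) => y Dy.
  by rewrite derive_row_coord //; exact/diff_derivable/cf.1.
refine (etrans (H v u) (etrans _ (esym (H u v)))).
have cj := Ck_row_coord j oD cf.
exact: (derive_comm u v oD Dx cj).
Qed.

(** * The quadratic form *)

Section Signature.
Context {R : realType} (eps : R) (heps : eps = 1 \/ eps = -1).

Lemma eps_sqr : eps * eps = 1.
Proof. by case: heps => ->; ring. Qed.

Lemma eps_neq0 : eps != 0.
Proof. by case: heps => ->; rewrite ?oppr_eq0 oner_eq0. Qed.

Lemma ip_recl d (u v : 'rV[R]_d.+1) : ip eps u v =
  eps * (u 0 0 * v 0 0) + \sum_(i < d) u 0 (lift ord0 i) * v 0 (lift ord0 i).
Proof.
rewrite /ip big_ord_recl /=; congr (_ + _).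
by apply: eq_bigr => i _; rewrite mul1r.
Qed.

(* For eps = -1 this is the reversed Cauchy-Schwarz inequality, from
   nu_0^2 <w, w> = sum_i (nu_0 w_i - w_0 nu_i)^2 + w_0^2. *)
Lemma lorentz_identity d (nu w : 'rV[R]_d.+1) : eps = -1 ->
  ip eps nu nu = eps -> ip eps w nu = 0 ->
  nu 0 0 ^+ 2 * ip eps w w = \sum_(i < d)
    (nu 0 0 * w 0 (lift ord0 i) - w 0 0 * nu 0 (lift ord0 i)) ^+ 2 + w 0 0 ^+ 2.
Proof.
move=> e; rewrite !ip_recl e.
set N := \sum_(i < d) _ => hN; set P := \sum_(i < d) _ => hP.
set Q := \sum_(i < d) _.
have -> : \sum_(i < d)
    (nu 0 0 * w 0 (lift ord0 i) - w 0 0 * nu 0 (lift ord0 i)) ^+ 2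
  = nu 0 0 ^+ 2 * Q - 2 * nu 0 0 * w 0 0 * P + w 0 0 ^+ 2 * N.
  rewrite !mulr_sumr -sumrB -big_split; apply: eq_bigr => i _ /=; ring.
have -> : P = w 0 0 * nu 0 0 by lra.
have -> : N = nu 0 0 ^+ 2 - 1 by lra.
ring.
Qed.

(** For eps = -1, [lorentz_identity] writes nu_0^2 <w, w> as a sum of squares, and <nu, nu> = -1
    gives nu_0^2 >= 1: the complement of a timelike vector is spacelike. *)
Lemma ip_ge0 d (nu w : 'rV[R]_d.+1) :
  ip eps nu nu = eps -> ip eps w nu = 0 -> 0 <= ip eps w w.
Proof.
case: heps => e hn hw.
  by rewrite /ip e sumr_ge0 // => i _; case: ifP => _; rewrite mul1r -expr2 sqr_ge0.
have eqn := lorentz_identity e hn hw.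
move: (hn); rewrite ip_recl e => {}hn.
have n1 : 1 <= nu 0 0 ^+ 2.
  rewrite -subr_ge0 (_ : _ - 1 = \sum_(i < d) nu 0 (lift ord0 i) * nu 0 (lift ord0 i)).
    by apply: sumr_ge0 => i _; rewrite -expr2 sqr_ge0.
  rewrite expr2; lra.
have n0 : 0 < nu 0 0 ^+ 2 by apply: lt_le_trans n1.
rewrite -e; suff : 0 <= nu 0 0 ^+ 2 * ip eps w w by rewrite pmulr_rge0.
rewrite eqn addr_ge0 ?sqr_ge0 // sumr_ge0 // => i _.
exact: sqr_ge0.
Qed.

Lemma ip_eq0 d (nu w : 'rV[R]_d.+1) :
  ip eps nu nu = eps -> ip eps w nu = 0 -> ip eps w w = 0 -> w = 0.
Proof.
case: heps => e hn hw w0.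
  apply/rowP => i; move/eqP: w0; rewrite /ip e psumr_eq0 => [|j _]; last first.
    by case: ifP => _; rewrite mul1r -expr2 sqr_ge0.
  move=> /allP/(_ i (mem_index_enum _)) /=.
  by case: ifP => _; rewrite mul1r -expr2 sqrf_eq0 => /eqP ->; rewrite mxE.
have := lorentz_identity e hn hw; rewrite w0 mulr0 => /esym/eqP.
rewrite paddr_eq0 ?sqr_ge0 //; last by apply: sumr_ge0 => i _; exact: sqr_ge0.
rewrite sqrf_eq0 => /andP[+ /eqP w00]; rewrite w00.
rewrite psumr_eq0 => [/allP H|i _]; last exact: sqr_ge0.
have n0 : nu 0 0 != 0.
  apply/eqP => n0; move: hn; rewrite ip_recl e n0 => hn.
  suff : 0 <= \sum_(i < d) nu 0 (lift ord0 i) * nu 0 (lift ord0 i) by lra.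
  by apply: sumr_ge0 => i _; rewrite -expr2 sqr_ge0.
apply/rowP => i; rewrite mxE; have [j ->|->//] := unliftP ord0 i.
have := H j (mem_index_enum _); rewrite /= mul0r subr0 sqrf_eq0 mulf_eq0 (negPf n0).
by move/eqP.
Qed.

Lemma ip_gt0 d (nu w : 'rV[R]_d.+1) :
  ip eps nu nu = eps -> ip eps w nu = 0 -> w != 0 -> 0 < ip eps w w.
Proof.
move=> hn hw w0; rewrite lt_neqAle (ip_ge0 hn hw) andbT eq_sym.
by apply: contra_neq w0; exact: ip_eq0 hn hw.
Qed.

(** * Frames made of two normals and a tangent basis *)

Section Frame.
Variables (n : nat) (nu1 nu2 : 'rV[R]_n.+2) (F : 'I_n -> 'rV[R]_n.+2).
Hypothesis n11 : ip eps nu1 nu1 = eps.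
Hypothesis n22 : ip eps nu2 nu2 = 1.
Hypothesis n12 : ip eps nu1 nu2 = 0.
Hypothesis F1 : forall i, ip eps (F i) nu1 = 0.
Hypothesis F2 : forall i, ip eps (F i) nu2 = 0.
Hypothesis freeF : forall c : 'rV[R]_n, \sum_i c 0 i *: F i = 0 -> c = 0.

(** The vectors [nu1], [nu2], [F i] form a basis: pairing a vanishing combination with the two
    normals kills their coefficients, and [freeF] kills the others. A vector orthogonal to a basis
    vanishes because the form is nondegenerate. *)
Lemma frame_perp (w : 'rV[R]_n.+2) : ip eps w nu1 = 0 -> ip eps w nu2 = 0 ->
  (forall i, ip eps w (F i) = 0) -> w = 0.
Proof.
move=> w1 w2 wF.
pose T : 'M[R]_(n, n.+2) := \matrix_i F i.
pose M : 'M[R]_(n.+2) := col_mx (col_mx nu1 nu2) T.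
have Mu : M \in unitmx.
  rewrite -row_free_unit.
  suff : row_free (col_mx (col_mx nu1 nu2) T) by [].
  apply: inj_row_free => v; rewrite -[v]hsubmxK -[lsubmx v]hsubmxK.
  set a := lsubmx (lsubmx v); set b := rsubmx (lsubmx v); set c := rsubmx v.
  rewrite !mul_row_col [a]mx11_scalar [b]mx11_scalar !mul_scalar_mx.
  have -> : c *m T = \sum_i c 0 i *: F i.
    rewrite mulmx_sum_row; apply: eq_bigr => i _; congr (_ *: _).
    by apply/rowP => j; rewrite !mxE.
  move=> e; have e1 := congr1 (ip eps nu1) e; have e2 := congr1 (ip eps nu2) e.
  have s1 : ip eps nu1 (\sum_i c 0 i *: F i) = 0.
    by rewrite ip_sumr big1 // => i _; rewrite ipZr ipC F1 mulr0.
  have s2 : ip eps nu2 (\sum_i c 0 i *: F i) = 0.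
    by rewrite ip_sumr big1 // => i _; rewrite ipZr ipC F2 mulr0.
  move: e1 e2; rewrite !ipE s1 s2 n11 n22 [ip eps nu2 nu1]ipC n12.
  rewrite !mulr0 !addr0 add0r mulr1 => /eqP.
  rewrite mulf_eq0 (negPf eps_neq0) orbF => /eqP a0 b0.
  move: e; rewrite a0 b0 !scale0r !add0r => /freeF ->.
  by rewrite !raddf0 !row_mx0.
(* The covector of [w], which turns the form into the ordinary matrix product. *)
pose x : 'rV[R]_n.+2 := \row_j ((if j == 0%N :> nat then eps else 1) * w 0 j).
have ipx (v : 'rV[R]_n.+2) : (x *m v^T) 0 0 = ip eps w v.
  by rewrite mxE; apply: eq_bigr => j _; rewrite !mxE mulrA.
have x0 : x *m (col_mx (col_mx nu1 nu2) T)^T = 0.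
  have xr (v : 'rV[R]_n.+2) : ip eps w v = 0 -> x *m v^T = 0.
    by rewrite -ipx => e; rewrite [x *m _]mx11_scalar e raddf0.
  rewrite !tr_col_mx !mul_mx_row xr // xr //.
  suff -> : x *m T^T = 0 by rewrite !row_mx0.
  apply/rowP => i; rewrite [RHS]mxE -(wF i) -ipx !mxE; apply: eq_bigr => j _.
  by rewrite !mxE.
have {}x0 : x = 0.
  by rewrite -[x](mulmxK (_ : M^T \in unitmx)) ?unitmx_tr // [_ *m _^T]x0 mul0mx.
apply/rowP => j; have /rowP/(_ j) := x0; rewrite !mxE; case: ifP => _.
  by move/eqP; rewrite mulf_eq0 (negPf eps_neq0) => /eqP.
by rewrite mul1r.
Qed.

Lemma frame_expansion (w : 'rV[R]_n.+2) : (forall i, ip eps w (F i) = 0) ->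
  w = (eps * ip eps w nu1) *: nu1 + ip eps w nu2 *: nu2.
Proof.
move=> wF; apply/eqP; rewrite -subr_eq0; apply/eqP; apply: frame_perp.
- by rewrite !ipE n11 [ip eps nu2 nu1]ipC n12; ring: eps_sqr.
- by rewrite !ipE n22 n12; ring.
- by move=> i; rewrite !ipE wF [ip eps nu1 _]ipC F1 [ip eps nu2 _]ipC F2; ring.
Qed.

Lemma frame_ip (w w' : 'rV[R]_n.+2) : (forall i, ip eps w (F i) = 0) ->
  ip eps w w' = eps * ip eps w nu1 * ip eps w' nu1 + ip eps w nu2 * ip eps w' nu2.
Proof.
by move=> /frame_expansion e; rewrite {1}e !ipE ![ip eps _ w']ipC.
Qed.

End Frame.
End Signature.

(** * The Gauss equation *)

Section DerivableMatrix.
Context {R : realType} {V : normedModType R}.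
Implicit Types (x v : V).

Lemma derivable_bigsum (I : Type) (r : seq I) (f : I -> V -> R^o) x v :
  (forall i, derivable (f i) x v) -> derivable (fun y => \sum_(i <- r) f i y : R^o) x v.
Proof.
move=> df; elim: r => [|i r IH].
  by under eq_fun do rewrite big_nil; exact: derivable_cst.
under eq_fun do rewrite big_cons.
by apply: (@derivableD _ _ _ (f i)); [exact: df|exact: IH].
Qed.

Lemma derivable_bigprod (I : Type) (r : seq I) (f : I -> V -> R^o) x v :
  (forall i, derivable (f i) x v) -> derivable (fun y => \prod_(i <- r) f i y : R^o) x v.
Proof.
move=> df; elim: r => [|i r IH].
  by under eq_fun do rewrite big_nil; exact: derivable_cst.
under eq_fun do rewrite big_cons.
by apply: (@derivableM _ _ (f i)); [exact: df|exact: IH].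
Qed.

Lemma derivable_det n (M : V -> 'M[R]_n) x v :
  (forall i j, derivable (fun y => M y i j : R^o) x v) ->
  derivable (fun y => \det (M y) : R^o) x v.
Proof.
move=> dM; apply: derivable_bigsum => s.
apply: derivableM; first exact: derivable_cst.
exact: derivable_bigprod.
Qed.

Lemma derivable_invmx n (D : set V) (M : V -> 'M[R]_n) x v i j : open D -> D x ->
  (forall y, D y -> M y \in unitmx) ->
  (forall i j, derivable (fun y => M y i j : R^o) x v) ->
  derivable (fun y => invmx (M y) i j : R^o) x v.
Proof.
move=> oD Dx uM dM.
have d : derivable (fun y => (\det (M y))^-1 * \adj (M y) i j : R^o) x v.
  apply: derivableM.
    apply: derivableV; last exact: derivable_det.
    by have := uM _ Dx; rewrite unitmxE unitfE.
  under eq_fun do rewrite mxE.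
  apply: derivableM; first exact: derivable_cst.
  apply: derivable_det => k l; under eq_fun do rewrite !mxE.
  exact: dM.
(* On a singular matrix [invmx] returns the matrix itself, so Cramer's formula is available only
   where [M] is invertible, that is on [D]. *)
apply: near_eq_derivable d; apply: (open_eq_near oD Dx) => y Dy.
by rewrite /invmx (uM y Dy) [RHS]mxE.
Qed.

End DerivableMatrix.

(* [P] is the coordinate frame of the tangent spaces and [F2] its derivatives;
   only their symmetries are used. *)
Section Gauss.
Context {R : realType} (eps : R) {n d : nat}.
Variables (D : set 'rV[R]_n) (P : 'I_n -> 'rV[R]_n -> 'rV[R]_d).
Variables (F2 : 'I_n -> 'I_n -> 'rV[R]_n -> 'rV[R]_d) (G : 'rV[R]_n -> 'M[R]_n).
Local Notation "<< u , v >>" := (ip eps u v).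
Hypothesis oD : open D.
Hypothesis GE : forall u i j, G u i j = <<P i u, P j u>>.
Hypothesis uG : forall u, D u -> G u \in unitmx.
Hypothesis dP : forall i u, D u -> differentiable (P i) u.
Hypothesis dF2 : forall i j u, D u -> differentiable (F2 i j) u.
Hypothesis F2E : forall i j u, D u -> partial (P i) j u = F2 i j u.
Hypothesis F2C : forall i j u, D u -> F2 i j u = F2 j i u.
Hypothesis F3C : forall i j k u, D u -> partial (F2 j k) i u = partial (F2 i k) j u.

Lemma partial_gram i j k u : D u ->
  partial (fun w => G w j k : R^o) i u = <<F2 j i u, P k u>> + <<P j u, F2 k i u>>.
Proof.
move=> Du; have -> : (fun w => G w j k : R^o) = (fun w => <<P j w, P k w>>).
  by apply: funext => w; rewrite GE.
by rewrite -!F2E //; apply: derive_ip; exact: dP.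
Qed.

Lemma gram_sym u i j : G u i j = G u j i.
Proof. by rewrite !GE; exact: ipC. Qed.

(** Each of the three metric derivatives splits in two by the Leibniz rule. By the symmetry of [F2]
    four of the six terms cancel and the other two coincide, which absorbs the factor 1/2. *)
Lemma christoffelE k i j u : D u ->
  christoffel G k i j u = \sum_l invmx (G u) k l * <<F2 i j u, P l u>>.
Proof.
move=> Du; rewrite /christoffel mulr_sumr; apply: eq_bigr => l _.
rewrite !partial_gram // (F2C j i) // (F2C l i) // (F2C l j) //.
rewrite (ipC _ (P j u) (F2 i l u)).
move: (invmx _ k l) <<F2 i j u, P l u>> <<F2 i l u, P j u>> <<P i u, F2 j l u>> => a b c e.
by field.
Qed.

Lemma christoffel_lower i j m u : D u ->
  \sum_k christoffel G k i j u * G u k m = <<F2 i j u, P m u>>.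
Proof.
move=> Du; under eq_bigr do rewrite christoffelE // mulr_suml.
rewrite exchange_big /=.
have inv l : \sum_k G u m k * invmx (G u) k l = (m == l)%:R.
  by have /matrixP/(_ m l) := mulmxV (uG Du); rewrite !mxE.
rewrite (eq_bigr (fun l => (m == l)%:R * <<F2 i j u, P l u>>)).
  by rewrite (bigD1 m) //= eqxx mul1r big1 ?addr0 // => l /negPf; rewrite eq_sym => ->; rewrite mul0r.
move=> l _; rewrite -inv mulr_suml; apply: eq_bigr => k _.
by rewrite (gram_sym u k m); ring.
Qed.

Lemma derivable_christoffel k i j u v : D u ->
  derivable (christoffel G k i j : _ -> R^o) u v.
Proof.
move=> Du.
have dd : derivable (fun u => \sum_l invmx (G u) k l * <<F2 i j u, P l u>> : R^o) u v.
  apply: derivable_bigsum => l; apply: derivableM.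
    apply: (derivable_invmx (D := D) (M := G)) => // a b.
    under eq_fun do rewrite GE.
    by apply/diff_derivable/differentiable_ip; exact: dP.
  apply/diff_derivable/differentiable_ip; first exact: dF2.
  exact: dP.
apply: near_eq_derivable dd; apply: (open_eq_near oD Du) => y Dy.
by rewrite christoffelE.
Qed.

(** The vector-valued second fundamental form of the Gauss formula; the subtracted sum is the
    tangential part of [F2 i j], as [second_form_perp] confirms. *)
Definition second_form i j u := F2 i j u - \sum_k christoffel G k i j u *: P k u.

Lemma second_form_perp i j m u : D u -> <<second_form i j u, P m u>> = 0.
Proof.
move=> Du; rewrite ipDl ipNl ip_suml -christoffel_lower //; apply/eqP.
rewrite subr_eq0; apply/eqP; apply: eq_bigr => k _.
by rewrite ipZl GE.
Qed.

(** This is [christoffel_lower] differentiated in direction i. The derivative of the metric produces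
    the quadratic Christoffel terms of the curvature, and its remaining part subtracts from [F2 j k]
    the tangential component, leaving [second_form]. *)
Lemma derive_christoffel_lower i j k m u : D u ->
  \sum_l (partial (christoffel G l j k : _ -> R^o) i u
     + \sum_p christoffel G p j k u * christoffel G l i p u) * G u l m
  = <<partial (F2 j k) i u, P m u>> + <<second_form j k u, F2 m i u>>.
Proof.
move=> Du.
have e : partial (fun w => <<F2 j k w, P m w>> : R^o) i u =
    partial (fun w => \sum_l christoffel G l j k w * G w l m : R^o) i u.
  apply: near_eq_derive; apply: (open_eq_near oD Du) => y Dy.
  by rewrite christoffel_lower.
have dG l : derivable (fun w => G w l m : R^o) u (delta_mx 0 i).
  under eq_fun do rewrite GE.
  by apply/diff_derivable/differentiable_ip; exact: dP.
have e2 : partial (fun w => \sum_l christoffel G l j k w * G w l m : R^o) i u =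
    \sum_l (christoffel G l j k u * (<<F2 l i u, P m u>> + <<P l u, F2 m i u>>)
      + partial (christoffel G l j k : _ -> R^o) i u * G u l m).
  have -> : (fun w => \sum_l christoffel G l j k w * G w l m : R^o)
     = \sum_(l < n) (fun w => christoffel G l j k w * G w l m : R^o).
    by apply: funext => w; rewrite fct_sumE.
  rewrite /partial derive_sum => [|l]; last first.
    by apply: derivableM => //; exact: derivable_christoffel.
  apply: eq_bigr => l _; rewrite deriveM //; last exact: derivable_christoffel.
  by rewrite -(partial_gram i l m Du) [_ * G u l m]mulrC.
move: e; rewrite e2 {e2}.
rewrite [LHS]derive_ip; [|exact: dF2|exact: dP].
rewrite big_split /=; under [X in _ = X + _]eq_bigr do rewrite mulrDr.
rewrite big_split /= => e.
have e3 : \sum_l (\sum_p christoffel G p j k u * christoffel G l i p u) * G u l m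
    = \sum_p christoffel G p j k u * <<F2 p i u, P m u>>.
  under eq_bigr do rewrite mulr_suml.
  rewrite exchange_big /=; apply: eq_bigr => p _.
  rewrite (F2C p i) // -christoffel_lower // mulr_sumr.
  by apply: eq_bigr => l _; rewrite mulrA.
under eq_bigr do rewrite mulrDl.
rewrite big_split /= e3.
rewrite ipDl ipNl ip_suml.
under [X in _ = _ + (_ - X)]eq_bigr do rewrite ipZl.
move: e; rewrite -/(partial (F2 j k) i u) -/(partial (P m) i u) F2E //.
set a := <<partial _ _ _, _>>; set b := <<F2 j k u, _>> => /esym e.
apply/eqP; rewrite eq_sym addrA subr_eq -e; apply/eqP; ring.
Qed.

(** The Gauss equation in a flat ambient space. [derive_christoffel_lower] is antisymmetrised in i
    and j; the third derivatives of the immersion are symmetric by [F3C] and drop out. *)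
Lemma riemann_lower i j k m u : D u ->
  \sum_l riemann G i j k l u * G u l m =
    <<second_form j k u, second_form i m u>> - <<second_form i k u, second_form j m u>>.
Proof.
move=> Du.
have H a b c e : <<second_form a b u, second_form c e u>> = <<second_form a b u, F2 e c u>>.
  rewrite {2}/second_form ipDr ipNr ip_sumr big1 ?subr0 ?(F2C c e) // => l _.
  by rewrite ipZr second_form_perp // mulr0.
refine (etrans _ (esym (congr2 (fun a b => a - b) (H j k i m) (H i k j m)))).
have e2 := derive_christoffel_lower i j k m Du.
have e1 := derive_christoffel_lower j i k m Du.
rewrite (F3C i j k Du) in e2.
have e : \sum_l riemann G i j k l u * G u l m =
    \sum_l (partial (christoffel G l j k : _ -> R^o) i u
     + \sum_p christoffel G p j k u * christoffel G l i p u) * G u l m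
    - \sum_l (partial (christoffel G l i k : _ -> R^o) j u
     + \sum_p christoffel G p i k u * christoffel G l j p u) * G u l m.
  rewrite -sumrB; apply: eq_bigr => l _.
  rewrite -[RHS]mulrBl; congr (_ * _); rewrite /riemann sumrB.
  by rewrite opprD [RHS]addrACA.
by rewrite e e2 e1 opprD addrACA subrr add0r.
Qed.

End Gauss.

Section QuadrilinearSums.
Context {R : comRingType} {n : nat} (b : 'I_n -> 'I_n -> R).
Implicit Types (x y : 'I_n -> R).

Definition bisum x y := \sum_i \sum_j x i * y j * b i j.

Lemma bisum_outer x y : \sum_i \sum_j \sum_k \sum_m
  x i * y j * y k * x m * (b j k * b i m) = bisum x x * bisum y y.
Proof.
rewrite big_distrlr; apply: eq_bigr => i _; apply: eq_bigr => j _ /=.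
rewrite big_distrlr exchange_big; apply: eq_bigr => k _; apply: eq_bigr => m _ /=.
ring.
Qed.

Lemma bisum_inner x y : \sum_i \sum_j \sum_k \sum_m
  x i * y j * y k * x m * (b i k * b j m) = bisum x y * bisum y x.
Proof.
rewrite big_distrlr; apply: eq_bigr => i _; apply: eq_bigr => j _ /=.
rewrite big_distrlr; apply: eq_bigr => k _; apply: eq_bigr => m _ /=.
ring.
Qed.

End QuadrilinearSums.

(** The Gram determinant equals <a, a> times the square of the component of b orthogonal to a,
    reached at t = - <a, b> / <a, a>. Positivity is asked only along this line because the form may
    be indefinite elsewhere. *)
Lemma ip_wedge_gt0 {R : realType} (eps : R) d (a b : 'rV[R]_d) :
  0 < ip eps a a -> (forall t, 0 < ip eps (t *: a + b) (t *: a + b)) ->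
  0 < ip eps a a * ip eps b b - ip eps a b ^+ 2.
Proof.
move=> a0 /(_ (- (ip eps a b / ip eps a a))).
rewrite !ipE [ip eps b a]ipC; move: (ip eps a a) (ip eps a b) (ip eps b b) a0 => x c y x0 h.
have -> : x * y - c ^+ 2 = x * (- (c / x) * (- (c / x) * x + c) + (- (c / x) * c + y)).
  by field; rewrite gt_eqF.
rewrite mulr_gt0 //; move: h; rewrite !mulrDr; lra.
Qed.

(** * Sectional curvature in codimension two *)

Section SectionalFrame.
Context {R : realType} (eps : R) (heps : eps = 1 \/ eps = -1) {n : nat}.
Variables (D : set 'rV[R]_n) (P : 'I_n -> 'rV[R]_n -> 'rV[R]_n.+2).
Variables (F2 : 'I_n -> 'I_n -> 'rV[R]_n -> 'rV[R]_n.+2) (G : 'rV[R]_n -> 'M[R]_n).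
Local Notation "<< u , v >>" := (ip eps u v).
Hypothesis oD : open D.
Hypothesis GE : forall u i j, G u i j = <<P i u, P j u>>.
Hypothesis uG : forall u, D u -> G u \in unitmx.
Hypothesis dP : forall i u, D u -> differentiable (P i) u.
Hypothesis dF2 : forall i j u, D u -> differentiable (F2 i j) u.
Hypothesis F2E : forall i j u, D u -> partial (P i) j u = F2 i j u.
Hypothesis F2C : forall i j u, D u -> F2 i j u = F2 j i u.
Hypothesis F3C : forall i j k u, D u -> partial (F2 j k) i u = partial (F2 i k) j u.
Variables (u : 'rV[R]_n) (nu1 nu2 : 'rV[R]_n.+2).
Hypothesis Du : D u.
Hypothesis n11 : <<nu1, nu1>> = eps.
Hypothesis n22 : <<nu2, nu2>> = 1.
Hypothesis n12 : <<nu1, nu2>> = 0.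
Hypothesis P1 : forall i, <<P i u, nu1>> = 0.
Hypothesis P2 : forall i, <<P i u, nu2>> = 0.
Hypothesis freeP : forall c : 'rV[R]_n, \sum_i c 0 i *: P i u = 0 -> c = 0.
Let b1 i j := <<F2 i j u, nu1>>.
Let b2 i j := <<F2 i j u, nu2>>.

Lemma second_form_normal i j (nu : 'rV[R]_n.+2) : (forall k, <<P k u, nu>> = 0) ->
  <<second_form P F2 G i j u, nu>> = <<F2 i j u, nu>>.
Proof.
move=> h; rewrite ipDl ipNl ip_suml big1 ?subr0 // => l _.
by rewrite ipZl h mulr0.
Qed.

(** The second form is normal, so [frame_ip] expands the product along [nu1] and [nu2], with weights
    eps and 1. *)
Lemma second_form_ip i j k m :
  <<second_form P F2 G i j u, second_form P F2 G k m u>>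
  = eps * (b1 i j * b1 k m) + b2 i j * b2 k m.
Proof.
have perp l : <<second_form P F2 G i j u, P l u>> = 0.
  exact: (second_form_perp GE uG dP F2E F2C).
have := frame_ip heps n11 n22 n12 P1 P2 freeP (second_form P F2 G k m u) perp.
move=> e; refine (etrans e _); rewrite /b1 /b2 -!(second_form_normal _ _ P1) -!(second_form_normal _ _ P2).
by rewrite mulrA.
Qed.

Lemma sectional_curvature_frame (X Y : 'rV[R]_n) :
  let B b x y := bisum b (fun i => x 0 i) (fun j => y 0 j) in
  sectional_curvature G u X Y =
    (eps * (B b1 X X * B b1 Y Y - B b1 X Y * B b1 Y X)
     + (B b2 X X * B b2 Y Y - B b2 X Y * B b2 Y X)) /
    (metric G u X X * metric G u Y Y - metric G u X Y ^+ 2).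
Proof.
move=> B; rewrite /sectional_curvature; congr (_ / _).
pose x i := X 0 i; pose y j := Y 0 j.
transitivity (\sum_i \sum_j \sum_k \sum_m x i * y j * y k * x m *
  (eps * (b1 j k * b1 i m) + b2 j k * b2 i m
   - (eps * (b1 i k * b1 j m) + b2 i k * b2 j m))).
  apply: eq_bigr => i _; apply: eq_bigr => j _; apply: eq_bigr => k _.
  rewrite exchange_big; apply: eq_bigr => m _ /=.
  have e := riemann_lower oD GE uG dP dF2 F2E F2C F3C i j k m Du.
  have {}e := etrans e (congr2 (fun a b => a - b) (second_form_ip j k i m)
    (second_form_ip i k j m)).
  by rewrite -e mulr_sumr; apply: eq_bigr => l _; rewrite mulrA.
transitivity (\sum_i \sum_j \sum_k \sum_m
  (eps * (x i * y j * y k * x m * (b1 j k * b1 i m))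
   + x i * y j * y k * x m * (b2 j k * b2 i m)
   - (eps * (x i * y j * y k * x m * (b1 i k * b1 j m))
     + x i * y j * y k * x m * (b2 i k * b2 j m)))).
  apply: eq_bigr => i _; apply: eq_bigr => j _.
  apply: eq_bigr => k _; apply: eq_bigr => m _.
  move: (b1 j k) (b1 i m) (b2 j k) (b2 i m) (b1 i k) (b1 j m) (b2 i k) (b2 j m).
  move: (x i) (y j) (y k) (x m) => *; ring.
have S4 (f g : 'I_n -> 'I_n -> 'I_n -> 'I_n -> R) :
    \sum_i \sum_j \sum_k \sum_m (f i j k m - g i j k m)
    = \sum_i \sum_j \sum_k \sum_m f i j k m - \sum_i \sum_j \sum_k \sum_m g i j k m.
  rewrite -sumrB; apply: eq_bigr => i _; rewrite -sumrB; apply: eq_bigr => j _.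
  by rewrite -sumrB; apply: eq_bigr => k _; rewrite -sumrB.
have P4 (f g : 'I_n -> 'I_n -> 'I_n -> 'I_n -> R) :
    \sum_i \sum_j \sum_k \sum_m (eps * f i j k m + g i j k m)
    = eps * (\sum_i \sum_j \sum_k \sum_m f i j k m) + \sum_i \sum_j \sum_k \sum_m g i j k m.
  rewrite mulr_sumr -big_split; apply: eq_bigr => i _ /=.
  rewrite mulr_sumr -big_split; apply: eq_bigr => j _ /=.
  rewrite mulr_sumr -big_split; apply: eq_bigr => k _ /=.
  by rewrite mulr_sumr -big_split.
rewrite (S4 (fun i j k m => _ + _) (fun i j k m => _ + _)) !P4.
rewrite (bisum_outer b1) (bisum_outer b2) (bisum_inner b1) (bisum_inner b2).
rewrite -/(B b1 X X) -/(B b1 Y Y) -/(B b2 X X) -/(B b2 Y Y).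
rewrite -/(B b1 X Y) -/(B b1 Y X) -/(B b2 X Y) -/(B b2 Y X).
move: (B b1 X X) (B b1 Y Y) (B b2 X X) (B b2 Y Y) (B b1 X Y) (B b1 Y X) (B b2 X Y) (B b2 Y X).
move=> *; ring.
Qed.

End SectionalFrame.

(** Both second forms enter quadratically, so the sign change between <d^2 F, nu> and <dF, dnu>
    supplied by [bisum_normal] does not affect the curvature. *)
Lemma curvature_quotient {R : fieldType} (e b1 b2 b3 b4 c1 c2 c3 c4 m1 m2 m3 : R)
    (b1' b2' b3' b4' c1' c2' c3' c4' m1' m2' m3' : R) :
  b1 = - b1' -> b2 = - b2' -> b3 = - b3' -> b4 = - b4' ->
  c1 = - c1' -> c2 = - c2' -> c3 = - c3' -> c4 = - c4' ->
  m1 = m1' -> m2 = m2' -> m3 = m3' ->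
  (e * (b1 * b2 - b3 * b4) + (c1 * c2 - c3 * c4)) / (m1 * m2 - m3 ^+ 2) =
  (e * (b1' * b2' - b3' * b4') + (c1' * c2' - c3' * c4')) / (m1' * m2' - m3' ^+ 2).
Proof. by do 11! move=> ->; rewrite !mulrNN. Qed.

Section Sectional.
Context {R : realType} (eps : R) (heps : eps = 1 \/ eps = -1) {n : nat}.
Variables (D : set 'rV[R]_n) (F nu1 nu2 : 'rV[R]_n -> 'rV[R]_n.+2).
Local Notation "<< u , v >>" := (ip eps u v).
Hypothesis oD : open D.
Hypothesis cF : Ck 3 D F.
Hypothesis d1 : forall u, D u -> differentiable nu1 u.
Hypothesis d2 : forall u, D u -> differentiable nu2 u.
Hypothesis n11 : forall u, D u -> <<nu1 u, nu1 u>> = eps.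
Hypothesis n22 : forall u, D u -> <<nu2 u, nu2 u>> = 1.
Hypothesis n12 : forall u, D u -> <<nu1 u, nu2 u>> = 0.
Hypothesis F1 : forall u X, D u -> <<'D_X F u, nu1 u>> = 0.
Hypothesis F2 : forall u X, D u -> <<'D_X F u, nu2 u>> = 0.
Hypothesis injF : forall u X, D u -> 'D_X F u = 0 -> X = 0.
Let G := gram eps F.

Let dF u : D u -> differentiable F u. Proof. by move=> Du; apply: cF.1. Qed.

Lemma metricE u X Y : D u -> metric G u X Y = <<'D_X F u, 'D_Y F u>>.
Proof.
move=> Du; rewrite !(derive_partial _ (dF Du)) ip_sumr /metric mxE.
apply: eq_bigr => j _; rewrite ipZr ip_suml !mxE mulrC; congr (_ * _).
by apply: eq_bigr => i _; rewrite ipZl mxE.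
Qed.

(** Tangent vectors are orthogonal to [nu1], which has square eps, so the Lorentzian case reduces to
    [ip_gt0]. *)
Lemma metric_gt0 u X : D u -> X != 0 -> 0 < <<'D_X F u, 'D_X F u>>.
Proof.
move=> Du X0; apply: (ip_gt0 heps (n11 Du) (F1 X Du)).
by apply: contra_neq X0; exact: injF.
Qed.

Lemma gram_unitmx u : D u -> G u \in unitmx.
Proof.
move=> Du; rewrite -row_free_unit; apply: inj_row_free => X XG.
apply/eqP/negPn/negP => X0; have := metric_gt0 Du X0.
by rewrite -metricE // /metric XG mul0mx mxE ltxx.
Qed.

Lemma metric_wedge_gt0 u X Y : D u -> row_free (col_mx X Y) ->
  0 < <<'D_X F u, 'D_X F u>> * <<'D_Y F u, 'D_Y F u>> - <<'D_X F u, 'D_Y F u>> ^+ 2.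
Proof.
move=> Du fXY.
have lin a b : a *: X + b *: Y = 0 -> a = 0 /\ b = 0.
  move=> ab0; have : row_mx a%:M b%:M *m col_mx X Y = 0 *m col_mx X Y.
    by rewrite mul_row_col !mul_scalar_mx mul0mx.
  move=> /(row_free_inj fXY) /eqP; rewrite row_mx_eq0 => /andP[/eqP/matrixP a0 /eqP/matrixP b0].
  by have := a0 0 0; have := b0 0 0; rewrite !mxE.
have X0 : X != 0.
  apply/eqP => X0; have /lin[/eqP] : 1 *: X + 0 *: Y = 0 by rewrite X0 scaler0 scale0r addr0.
  by rewrite oner_eq0.
apply: (ip_wedge_gt0 (metric_gt0 Du X0)) => t.
have Z0 : t *: X + Y != 0.
  apply/eqP => Z; have /lin[_ /eqP] : t *: X + 1 *: Y = 0 by rewrite scale1r.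
  by rewrite oner_eq0.
have -> : t *: 'D_X F u + 'D_Y F u = 'D_(t *: X + Y) F u.
  by rewrite !deriveE ?linearD ?linearZ //; exact: dF.
exact: metric_gt0.
Qed.

(** Weingarten's relation, obtained by differentiating <d_i F, nu> = 0 in direction j. *)
Lemma bisum_normal (nu : 'rV[R]_n -> 'rV[R]_n.+2) u (X Y : 'rV[R]_n) : D u ->
  differentiable nu u -> (forall w Z, D w -> <<'D_Z F w, nu w>> = 0) ->
  bisum (fun i j => <<partial (partial F i) j u, nu u>>)
     (fun i => X 0 i) (fun j => Y 0 j) = - <<'D_X F u, 'D_Y nu u>>.
Proof.
move=> Du dnu h.
have e i j : <<partial (partial F i) j u, nu u>> = - <<partial F i u, partial nu j u>>.
  have dp : differentiable (partial F i) u by exact: (cF.2 (delta_mx 0 i)).1.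
  apply/eqP; rewrite -subr_eq0 opprK; apply/eqP.
  refine (etrans (esym (derive_ip eps (delta_mx 0 j) dp dnu)) _).
  transitivity ('D_(delta_mx 0 j) (fun=> 0 : R^o) u); last exact: derive_cst.
  by apply: near_eq_derive; apply: (open_eq_near oD Du) => y Dy; exact: h.
rewrite /bisum (derive_partial X (dF Du)) (derive_partial Y dnu) ip_suml -sumrN.
apply: eq_bigr => i _; rewrite ip_sumr -sumrN; apply: eq_bigr => j _.
rewrite e ipZl ipZr; move: <<partial F i u, _>> (X 0 i) (Y 0 j) => *; ring.
Qed.

Let A1 X Y u := <<'D_X F u, 'D_Y nu1 u>>.
Let A2 X Y u := <<'D_X F u, 'D_Y nu2 u>>.

(** Only first derivatives of the normals remain. It is applied to the surface (n = 2, normals [g]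
    and [nu]) in [flat_frame] and to the hypersurface (n = 3) in [hypersurface_curvature]. *)
Lemma sectional_curvatureE u X Y : D u ->
  sectional_curvature G u X Y =
    (eps * (A1 X X u * A1 Y Y u - A1 X Y u * A1 Y X u)
     + (A2 X X u * A2 Y Y u - A2 X Y u * A2 Y X u)) /
    (<<'D_X F u, 'D_X F u>> * <<'D_Y F u, 'D_Y F u>> - <<'D_X F u, 'D_Y F u>> ^+ 2).
Proof.
move=> Du.
have [dF1 cF2] := cF.
have h := @sectional_curvature_frame R eps heps n D (partial F)
  (fun i j => partial (partial F i) j) G oD.
have {}h := h (fun u i j => mxE _ _ i j) gram_unitmx.
have {}h := h (fun i u Du => (cF2 (delta_mx 0 i)).1 u Du).
have {}h := h (fun i j u Du => ((cF2 (delta_mx 0 i)).2 (delta_mx 0 j)).1 u Du).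
have C2 i j w : D w -> partial (partial F i) j w = partial (partial F j) i w.
  by move=> Dw; apply: (derive_comm_row _ _ oD Dw (CkW cF)).
have {}h := h (fun i j u Du => erefl) C2.
(* The permutation of third derivatives is a product of exchanges: the inner two indices by [C2]
   under the outer derivative, the outer two by symmetry for the C^2 map [partial F k]. *)
have C3 i j k w : D w ->
    partial (partial (partial F j) k) i w = partial (partial (partial F i) k) j w.
  move=> Dw; have near2 a b c :
      partial (partial (partial F a) b) c w = partial (partial (partial F b) a) c w.
    by apply: near_eq_derive; apply: (open_eq_near oD Dw) => y Dy; exact: C2.
  refine (etrans (near2 j k i) (etrans _ (esym (near2 i k j)))).
  exact: (derive_comm_row _ _ oD Dw (cF2 (delta_mx 0 k))).
have {}h := h C3 u (nu1 u) (nu2 u) Du (n11 Du) (n22 Du) (n12 Du).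
have {}h := h (fun i => F1 _ Du) (fun i => F2 _ Du).
have fr (c : 'rV[R]_n) : \sum_i c 0 i *: partial F i u = 0 -> c = 0.
  by rewrite -(derive_partial c (dF Du)); exact: injF.
refine (etrans (h fr X Y) _).
have N1 Z W := bisum_normal Z W Du (d1 Du) F1.
have N2 Z W := bisum_normal Z W Du (d2 Du) F2.
exact: (curvature_quotient eps (N1 X X) (N1 Y Y) (N1 X Y) (N1 Y X)
  (N2 X X) (N2 Y Y) (N2 X Y) (N2 Y X) (metricE X X Du) (metricE Y Y Du) (metricE X Y Du)).
Qed.

End Sectional.

(** * Coordinates on the product *)

Section Trig.
Context {R : realType} (eps : R) (heps : eps = 1 \/ eps = -1).
Implicit Types s t : R.

Lemma N1_neq1 : (-1 == 1 :> R) = false.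
Proof. by apply/negbTE; rewrite lt_eqF //; lra. Qed.

Lemma CepsSeps s : Ceps eps s ^+ 2 + eps * Seps eps s ^+ 2 = 1.
Proof.
rewrite /Ceps /Seps; case: heps => ->; first by rewrite eqxx mul1r cos2Dsin2.
rewrite N1_neq1; have := expRxMexpNx_1 s; move: (expR s) (expR (- s)) => x y xy.
have -> : ((x + y) / 2) ^+ 2 + -1 * ((x - y) / 2) ^+ 2 = x * y by field.
by [].
Qed.

Lemma Ceps0 : Ceps eps 0 = 1.
Proof. by rewrite /Ceps cos0 oppr0 expR0; case: ifP => // _; field. Qed.

Lemma Seps0 : Seps eps 0 = 0.
Proof. by rewrite /Seps sin0 oppr0 expR0; case: ifP => // _; rewrite subrr mul0r. Qed.

Lemma is_derive_Ceps s : is_derive s (1 : R) (Ceps eps : R -> R^o) (- eps * Seps eps s).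
Proof.
rewrite /Ceps /Seps; case: heps => ->; last first.
  rewrite N1_neq1; apply: is_derive_eq; rewrite /GRing.scale /=; ring.
by rewrite eqxx; apply: is_derive_eq; rewrite /GRing.scale /=; ring.
Qed.

Lemma is_derive_Seps s : is_derive s (1 : R) (Seps eps : R -> R^o) (Ceps eps s).
Proof.
rewrite /Ceps /Seps; case: heps => ->; last first.
  rewrite N1_neq1; apply: is_derive_eq; rewrite /GRing.scale /=; ring.
by rewrite eqxx; apply: is_derive_eq; rewrite /GRing.scale /=; ring.
Qed.

End Trig.

Section LinearRow.
Context {R : realType} {m : nat} {W : normedModType R}.

Lemma linear_row_continuous (f : {linear 'rV[R]_m -> W}) : continuous f.
Proof.
have -> : (f : 'rV[R]_m -> W) = fun v => \sum_i v 0 i *: f (delta_mx 0 i).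
  apply: funext => v; rewrite {1}[v]row_sum_delta linear_sum.
  by apply: eq_bigr => i _; rewrite linearZ.
have : Ck 0 setT (fun v : 'rV[R]_m => \sum_i v 0 i *: f (delta_mx 0 i)).
  apply: Ck_sum => [|i]; first exact: openT.
  apply: CkZl => [|x _]; first exact: openT.
  exact: coord_continuous.
by move=> h x; exact: h.
Qed.

End LinearRow.

Section Product.
Context {R : realType} {n : nat}.

(** [base] and [height] are written as in the inverse charts of [cylinder_atlas], so that maps read
    in a product chart become compositions with linear maps. *)
Definition base (u : 'rV[R]_n.+1) : 'rV[R]_n := \row_i u 0 (widen_ord (leqnSn n) i).
Definition height (u : 'rV[R]_n.+1) : R^o := u 0 ord_max.

Fact base_is_linear : linear base.
Proof. by move=> a u v; apply/rowP => i; rewrite !mxE. Qed.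
HB.instance Definition _ := GRing.isLinear.Build R 'rV[R]_n.+1 'rV[R]_n _ base base_is_linear.

Fact height_is_linear : linear height.
Proof. by move=> a u v; rewrite /height !mxE. Qed.
HB.instance Definition _ := GRing.isLinear.Build R 'rV[R]_n.+1 R^o _ height height_is_linear.

Lemma base_height_eq0 u : base u = 0 -> height u = 0 -> u = 0.
Proof.
move=> /rowP b h; apply/rowP => i; rewrite mxE.
have [lt|] := ltnP i n.
  have := b (Ordinal lt); rewrite !mxE => <-; congr (u 0 _).
  exact: val_inj.
move=> ge; rewrite -[RHS]h /height; congr (u 0 _); apply: val_inj => /=.
by apply/eqP; rewrite eqn_leq ge -ltnS ltn_ord.
Qed.

End Product.

Section E5.
Context {R : realType} (eps : R).
Local Notation "<< u , v >>" := (ip eps u v).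

Lemma toE5El (p : 'rV[R]_4) (t : R) (i : 'I_4) : toE5 p t 0 (lshift 1 i : 'I_5) = p 0 i.
Proof. exact: row_mxEl. Qed.

Lemma toE5Er (p : 'rV[R]_4) (t : R) (i : 'I_1) : toE5 p t 0 (rshift 4 i : 'I_5) = t.
Proof. by refine (etrans (row_mxEr _ _ _ _) _); rewrite mxE ord1 eqxx mulr1n. Qed.

Lemma ip_toE5 (p q : 'rV[R]_4) (s t : R) : <<toE5 p s, toE5 q t>> = <<p, q>> + s * t.
Proof.
rewrite /ip (@big_split_ord _ _ _ 4 1) /= big_ord1; congr (_ + _).
  by apply: eq_bigr => i _; rewrite !toE5El.
by rewrite !toE5Er mul1r.
Qed.

Lemma toE5D (p q : 'rV[R]_4) (s t : R) : toE5 p s + toE5 q t = toE5 (p + q) (s + t).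
Proof. by rewrite /toE5 raddfD (add_row_mx p). Qed.

Lemma toE5Z (a : R) (p : 'rV[R]_4) (s : R) : a *: toE5 p s = toE5 (a *: p) (a * s).
Proof. by rewrite /toE5 (scale_row_mx a p) scale_scalar_mx. Qed.

Lemma toE5_inj (p q : 'rV[R]_4) (s t : R) : toE5 p s = toE5 q t -> p = q /\ s = t.
Proof.
move=> e; split; first by apply/rowP => i; rewrite -(toE5El p s) e toE5El.
by rewrite -(toE5Er p s ord0) e toE5Er.
Qed.

Lemma toE50 : toE5 (0 : 'rV[R]_4) 0 = 0.
Proof. by rewrite /toE5 raddf0 row_mx0. Qed.

Lemma dtE : dt = toE5 (0 : 'rV[R]_4) 1.
Proof.
apply/rowP => i; rewrite mxE eqxx /=; case: (@split_ordP 4 1 i) => j ->.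
  by rewrite toE5El mxE -val_eqE /= ltn_eqF.
by rewrite toE5Er [j]ord1 -val_eqE.
Qed.

Lemma horizontal_toE5 (p : 'rV[R]_4) t : horizontal (toE5 p t) = p.
Proof. exact: row_mxKl. Qed.

Definition embed (p : 'rV[R]_4) : 'rV[R]_5 := toE5 p 0.
Fact embed_is_linear : linear embed.
Proof. by move=> a p q; rewrite /embed toE5Z toE5D mulr0 addr0. Qed.
HB.instance Definition _ := GRing.isLinear.Build R 'rV[R]_4 'rV[R]_5 _ embed embed_is_linear.

Lemma toE5E (p : 'rV[R]_4) t : toE5 p t = embed p + t *: dt.
Proof. by rewrite dtE /embed toE5Z toE5D scaler0 addr0 mulr1 add0r. Qed.

Context {V : normedModType R}.

Lemma Ck_toE5 k (D : set V) (p : V -> 'rV[R]_4) (t : V -> R^o) : open D ->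
  Ck k D p -> Ck k D t -> Ck k D (fun y => toE5 (p y) (t y)).
Proof.
move=> oD cp ct; under eq_fun do rewrite toE5E.
apply: CkD => //; last exact: CkZl.
exact: (Ck_postlin (L := embed) oD (@linear_row_continuous _ _ _ _) cp).
Qed.

Lemma differentiable_toE5 (p : V -> 'rV[R]_4) (t : V -> R^o) x :
  differentiable p x -> differentiable t x ->
  differentiable (fun y => toE5 (p y) (t y)) x.
Proof.
move=> dp dtx; under eq_fun do rewrite toE5E.
apply: differentiableD; last exact: differentiableZl.
apply: (differentiable_comp (g := embed)) => //; apply: linear_differentiable.
exact: linear_row_continuous.
Qed.

Lemma derive_toE5 (p : V -> 'rV[R]_4) (t : V -> R^o) x v :
  differentiable p x -> differentiable t x ->
  'D_v (fun y => toE5 (p y) (t y)) x = toE5 ('D_v p x) ('D_v t x).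
Proof.
move=> dp dtx; under eq_fun do rewrite toE5E.
have d1 : differentiable (embed \o p) x.
  apply: differentiable_comp => //; apply: linear_differentiable.
  exact: linear_row_continuous.
have d2 : differentiable (fun y => t y *: (dt : 'rV[R]_5)) x by exact: differentiableZl.
rewrite (deriveD (f := embed \o p)); try exact: diff_derivable.
rewrite derive_postlin //; last exact: linear_row_continuous.
by rewrite toE5E derive_Zl.
Qed.

End E5.

(** * Flat surfaces and their parallel surfaces *)

Section PlaneAlgebra.
Context {R : realType} (eps : R) (heps : eps = 1 \/ eps = -1) {d : nat}.
Local Notation "<< u , v >>" := (ip eps u v).
Implicit Types (a b : 'rV[R]_d).

Lemma binet_cauchy a b (p1 p2 q1 q2 r1 r2 t1 t2 : R) :
  <<p1 *: a + p2 *: b, r1 *: a + r2 *: b>> * <<q1 *: a + q2 *: b, t1 *: a + t2 *: b>>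
  - <<p1 *: a + p2 *: b, t1 *: a + t2 *: b>> * <<q1 *: a + q2 *: b, r1 *: a + r2 *: b>>
  = (p1 * q2 - p2 * q1) * (r1 * t2 - r2 * t1) * (<<a, a>> * <<b, b>> - <<a, b>> ^+ 2).
Proof.
rewrite !ipE [<<b, a>>]ipC; move: <<a, a>> <<a, b>> <<b, b>> => *; ring.
Qed.

(* [a, b] is a basis of the tangent plane, [na, nb] are the derivatives of the
   normal. Flatness says that the Weingarten map has determinant -eps. *)
Lemma flat_plane a b na nb (al be ga de : R) :
  0 < <<a, a>> * <<b, b>> - <<a, b>> ^+ 2 ->
  na = al *: a + be *: b -> nb = ga *: a + de *: b ->
  eps * (<<a, a>> * <<b, b>> - <<a, b>> * <<b, a>>)
    + (<<a, na>> * <<b, nb>> - <<a, nb>> * <<b, na>>) = 0 ->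
  al * de - be * ga = - eps.
Proof.
move=> w0 -> ->; have := binet_cauchy a b 1 0 0 1 al be ga de.
rewrite !scale1r !scale0r addr0 add0r => ->; rewrite [<<b, a>>]ipC -expr2.
set W := _ - _; rewrite -/W in w0.
have -> : eps * W + (1 * 1 - 0 * 0) * (al * de - be * ga) * W
  = W * (eps + (al * de - be * ga)) by ring.
by move/eqP; rewrite mulf_eq0 gt_eqF //= addrC addr_eq0 => /eqP.
Qed.

(** Let W be the Weingarten matrix, with det W = -eps. Then [p] and [q] apply c + s W and -eps s + c
    W, and for 2 x 2 matrices det(-eps s + c W) = s^2 - eps c s tr W - eps c^2 = -eps det(c + s W).
    By [binet_cauchy] both sides carry the same remaining factors. *)
Lemma parallel_plane a b na nb (al be ga de c s x1 x2 y1 y2 : R) :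
  na = al *: a + be *: b -> nb = ga *: a + de *: b -> al * de - be * ga = - eps ->
  let p z1 z2 := c *: (z1 *: a + z2 *: b) + s *: (z1 *: na + z2 *: nb) in
  let q z1 z2 := (- eps * s) *: (z1 *: a + z2 *: b) + c *: (z1 *: na + z2 *: nb) in
  <<p x1 x2, q x1 x2>> * <<p y1 y2, q y1 y2>> - <<p x1 x2, q y1 y2>> * <<p y1 y2, q x1 x2>>
  = - eps * (<<p x1 x2, p x1 x2>> * <<p y1 y2, p y1 y2>> - <<p x1 x2, p y1 y2>> ^+ 2).
Proof.
move=> ena enb det p q.
have pE z1 z2 : p z1 z2 = (c * z1 + s * (z1 * al + z2 * ga)) *: a
                        + (c * z2 + s * (z1 * be + z2 * de)) *: b.
  rewrite /p ena enb; apply/rowP => i; rewrite !mxE; ring.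
have qE z1 z2 : q z1 z2 = (- eps * s * z1 + c * (z1 * al + z2 * ga)) *: a
                        + (- eps * s * z2 + c * (z1 * be + z2 * de)) *: b.
  rewrite /q ena enb; apply/rowP => i; rewrite !mxE; ring.
rewrite [X in _ = - eps * (_ - X)]expr2 [X in _ = - eps * (_ - _ * X)]ipC !pE !qE !binet_cauchy.
move: (_ - <<a, b>> ^+ 2) => W.
have e2 := eps_sqr heps.
have det' : al * de = be * ga - eps by rewrite -det; ring.
ring: e2 det'.
Qed.

(** Cramer's rule for the normal equations of the orthogonal projection onto the plane of a and
    b. *)
Lemma plane_projection a b (w : 'rV[R]_d) : 0 < <<a, a>> * <<b, b>> - <<a, b>> ^+ 2 ->
  exists al be, <<w - (al *: a + be *: b), a>> = 0 /\ <<w - (al *: a + be *: b), b>> = 0.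
Proof.
move=> W0.
exists ((<<w, a>> * <<b, b>> - <<w, b>> * <<a, b>>) / (<<a, a>> * <<b, b>> - <<a, b>> ^+ 2)).
exists ((<<w, b>> * <<a, a>> - <<w, a>> * <<a, b>>) / (<<a, a>> * <<b, b>> - <<a, b>> ^+ 2)).
rewrite !ipE [<<b, a>>]ipC; move: W0.
move: <<w, a>> <<w, b>> <<a, a>> <<b, b>> <<a, b>> => x y E G F W0.
by split; field; rewrite gt_eqF.
Qed.

Lemma ip_sub_combination a b (w z : 'rV[R]_d) (al be : R) :
  <<w, z>> = 0 -> <<a, z>> = 0 -> <<b, z>> = 0 -> <<w - (al *: a + be *: b), z>> = 0.
Proof. by move=> wz az bz; rewrite !ipE wz az bz; ring. Qed.

End PlaneAlgebra.

Section ConstantIp.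
Context {R : realType} (eps : R) {V : normedModType R} {d : nat}.

Lemma derive_ip_cst (D : set V) (f g : V -> 'rV[R]_d) (k : R) u (v : V) :
  open D -> D u -> (forall u, D u -> differentiable f u) ->
  (forall u, D u -> differentiable g u) -> (forall u, D u -> ip eps (f u) (g u) = k) ->
  ip eps ('D_v f u) (g u) + ip eps (f u) ('D_v g u) = 0.
Proof.
move=> oD Du df differentiable_surface h.
refine (etrans (esym (derive_ip eps v (df u Du) (differentiable_surface u Du))) _).
transitivity ('D_v (fun=> k : R^o) u); last exact: derive_cst.
by apply: near_eq_derive; apply: (open_eq_near oD Du).
Qed.

End ConstantIp.

Section LocalSurface.
Context {R : realType} (eps : R) (heps : eps = 1 \/ eps = -1).
Local Notation "<< u , v >>" := (ip eps u v).
Variables (D : set 'rV[R]_2) (g nu : 'rV[R]_2 -> 'rV[R]_4).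
Hypothesis oD : open D.
Hypothesis sg : smooth D g.
Hypothesis sn : smooth D nu.
Hypothesis gg : forall u, D u -> <<g u, g u>> = eps.
Hypothesis nn : forall u, D u -> <<nu u, nu u>> = 1.
Hypothesis ng : forall u, D u -> <<nu u, g u>> = 0.
Hypothesis nT : forall u v, D u -> <<nu u, 'D_v g u>> = 0.
Hypothesis injg : forall u v, D u -> 'D_v g u = 0 -> v = 0.

Lemma differentiable_surface u : D u -> differentiable g u.
Proof. exact: (sg 1).1. Qed.

Lemma differentiable_normal u : D u -> differentiable nu u.
Proof. exact: (sn 1).1. Qed.

Lemma derive_g_g u v : D u -> <<'D_v g u, g u>> = 0.
Proof.
move=> Du; have := derive_ip_cst v oD Du differentiable_surface differentiable_surface gg.
by rewrite [<<g u, _>>]ipC; lra.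
Qed.

Lemma derive_nu_nu u v : D u -> <<'D_v nu u, nu u>> = 0.
Proof.
move=> Du; have := derive_ip_cst v oD Du differentiable_normal differentiable_normal nn.
by rewrite [<<nu u, _>>]ipC; lra.
Qed.

Lemma derive_nu_g u v : D u -> <<'D_v nu u, g u>> = 0.
Proof.
by move=> Du; have := derive_ip_cst v oD Du differentiable_normal differentiable_surface ng; rewrite nT // addr0.
Qed.

Let a u := partial g 0 u.
Let b u := partial g 1 u.

Lemma derive2E (f : 'rV[R]_2 -> 'rV[R]_4) u v : differentiable f u ->
  'D_v f u = v 0 0 *: partial f 0 u + v 0 1 *: partial f 1 u.
Proof.
move=> df; rewrite derive_partial // big_ord_recl big_ord1.
by congr (_ + _ *: partial f _ u); [congr (v 0 _)|]; exact: val_inj.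
Qed.

Lemma wedge_frame_gt0 u : D u -> 0 < <<a u, a u>> * <<b u, b u>> - <<a u, b u>> ^+ 2.
Proof.
move=> Du; have gt0 v : v != 0 -> 0 < <<'D_v g u, 'D_v g u>>.
  move=> v0; apply: (ip_gt0 heps (gg Du) (derive_g_g v Du)).
  by apply: contra_neq v0; exact: injg.
apply: ip_wedge_gt0 => [|t].
  apply: gt0; apply/eqP => /rowP/(_ 0)/eqP.
  by rewrite !mxE oner_eq0.
have -> : t *: a u + b u = 'D_(\row_i (if i == 0 then t else 1)) g u.
  by rewrite (derive2E _ (differentiable_surface Du)) !mxE scale1r.
apply: gt0; apply/eqP => /rowP/(_ 1)/eqP.
by rewrite !mxE oner_eq0.
Qed.

(** After subtracting the projection, the residual is orthogonal to [g], [nu] and both partial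
    derivatives, hence zero by [frame_perp]. Applied to the derivatives of [nu], this provides the
    Weingarten matrix. *)
Lemma tangent_combination u w : D u -> <<w, g u>> = 0 -> <<w, nu u>> = 0 ->
  exists al be, w = al *: a u + be *: b u.
Proof.
move=> Du wg wn.
have [al [be [wa wb]]] := plane_projection w (wedge_frame_gt0 Du).
exists al, be; apply/eqP; rewrite -subr_eq0; apply/eqP.
have gn : <<g u, nu u>> = 0 by rewrite ipC ng.
have P1 i : <<partial g i u, g u>> = 0 by exact: derive_g_g.
have P2 i : <<partial g i u, nu u>> = 0 by rewrite ipC; exact: nT.
have fr (c : 'rV[R]_2) : \sum_i c 0 i *: partial g i u = 0 -> c = 0.
  by rewrite -(derive_partial c (differentiable_surface Du)); exact: injg.
apply: (frame_perp heps (gg Du) (nn Du) gn P1 P2 fr).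
- by apply: ip_sub_combination => //; exact: P1.
- by apply: ip_sub_combination => //; exact: P2.
move=> i; have [->|->] : i = 0 \/ i = 1.
  by case: i => -[|[|//]] ?; [left|right]; exact: val_inj.
- exact: wa.
- exact: wb.
Qed.

Hypothesis flat : forall u v w, D u -> row_free (col_mx v w) ->
  sectional_curvature (gram eps g) u v w = 0.

(** The Gauss equation with curvature zero on the coordinate frame. Relative to the normal [g] the
    second form is the metric itself up to sign, which explains the first bracket; the denominator
    is a positive Gram determinant and is cleared. *)
Lemma flat_frame u : D u ->
  eps * (<<a u, a u>> * <<b u, b u>> - <<a u, b u>> * <<b u, a u>>)
    + (<<a u, partial nu 0 u>> * <<b u, partial nu 1 u>>
       - <<a u, partial nu 1 u>> * <<b u, partial nu 0 u>>) = 0.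
Proof.
move=> Du; set X : 'rV[R]_2 := delta_mx 0 0; set Y : 'rV[R]_2 := delta_mx 0 1.
have free : row_free (col_mx X Y).
  apply: inj_row_free => v; rewrite -[v]hsubmxK mul_row_col.
  rewrite [lsubmx v]mx11_scalar [rsubmx v]mx11_scalar !mul_scalar_mx => /rowP e.
  have := e 0; have := e 1; rewrite !mxE /= !mulr0 !mulr1 addr0 add0r => -> ->.
  by rewrite !raddf0 row_mx0.
have gn w : D w -> <<g w, nu w>> = 0 by move=> Dw; rewrite ipC ng.
have T2 w v : D w -> <<'D_v g w, nu w>> = 0 by move=> Dw; rewrite ipC nT.
have T1 w v (Dw : D w) := derive_g_g v Dw.
have := @sectional_curvatureE R eps heps 2 D g g nu oD (sg 3) differentiable_surface differentiable_normal gg nn gn T1 T2 injg u X Y Du.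
rewrite (flat Du free) => /esym/eqP; rewrite mulf_eq0 invr_eq0.
have W0 := metric_wedge_gt0 heps (sg 3) gg T1 injg Du free.
by rewrite [X in _ || X]gt_eqF // orbF => /eqP.
Qed.

(** Along the surface, (c, s) = (C, S) gives dg_s and (c, s) = (-eps S, C) gives dN_s. *)
Definition parallel_derive (c s : R) u v := c *: 'D_v g u + s *: 'D_v nu u.

Lemma parallel_wedge u v w (c s : R) : D u ->
  <<parallel_derive c s u v, parallel_derive (- eps * s) c u v>> * <<parallel_derive c s u w, parallel_derive (- eps * s) c u w>>
  - <<parallel_derive c s u v, parallel_derive (- eps * s) c u w>> * <<parallel_derive c s u w, parallel_derive (- eps * s) c u v>>
  = - eps * (<<parallel_derive c s u v, parallel_derive c s u v>> * <<parallel_derive c s u w, parallel_derive c s u w>>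
             - <<parallel_derive c s u v, parallel_derive c s u w>> ^+ 2).
Proof.
move=> Du.
have [al [be ena]] := tangent_combination Du (derive_nu_g (delta_mx 0 0) Du) (derive_nu_nu (delta_mx 0 0) Du).
have [ga [de enb]] := tangent_combination Du (derive_nu_g (delta_mx 0 1) Du) (derive_nu_nu (delta_mx 0 1) Du).
have det := flat_plane (wedge_frame_gt0 Du) ena enb (flat_frame Du).
rewrite /parallel_derive !(derive2E _ (differentiable_surface Du)) !(derive2E _ (differentiable_normal Du)).
exact: (parallel_plane heps c s (v 0 0) (v 0 1) (w 0 0) (w 0 1) ena enb det).
Qed.

End LocalSurface.

(** Here p is the metric of g_s, q pairs dg_s with dN_s, x and y are the s-components, h and k come
    from the two normals, and m is the metric of f. Put P = pxx pyy - pxy^2 and Q = pxx y^2 + pyy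
    x^2 - 2 pxy x y. The numerator is eps (P + Q) - eps (B / a)^2 P = eps (P / a^2 + Q), and the
    denominator is P + a^2 Q. *)
Lemma hypersurface_quotient {R : realType} (eps a B x y pxx pyy pxy qxx qyy qxy qyx : R)
    (hxx hyy hxy hyx kxx kyy kxy kyx mxx myy mxy : R) :
  eps * eps = 1 -> a ^+ 2 = 1 + B ^+ 2 -> 0 < a ->
  qxx * qyy - qxy * qyx = - eps * (pxx * pyy - pxy ^+ 2) ->
  hxx = pxx + x * x -> hyy = pyy + y * y -> hxy = pxy + x * y -> hyx = pxy + x * y ->
  kxx = - (B / a) * qxx -> kyy = - (B / a) * qyy ->
  kxy = - (B / a) * qxy -> kyx = - (B / a) * qyx ->
  mxx = pxx + x * x + B ^+ 2 * (x * x) -> myy = pyy + y * y + B ^+ 2 * (y * y) ->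
  mxy = pxy + x * y + B ^+ 2 * (x * y) -> 0 < mxx * myy - mxy ^+ 2 ->
  (eps * (hxx * hyy - hxy * hyx) + (kxx * kyy - kxy * kyx)) / (mxx * myy - mxy ^+ 2)
  = eps / a ^+ 2.
Proof.
move=> e2 ea a0 q -> -> -> -> -> -> -> -> -> -> -> d0.
have -> : - (B / a) * qxx * (- (B / a) * qyy) - - (B / a) * qxy * (- (B / a) * qyx)
    = B ^+ 2 / a ^+ 2 * (qxx * qyy - qxy * qyx) by field; rewrite gt_eqF.
have a20 : a ^+ 2 != 0 by rewrite gt_eqF // exprn_gt0.
have eB : B ^+ 2 = a ^+ 2 - 1 by rewrite ea; ring.
move: d0 a20; rewrite q eB; move: (a ^+ 2) => a2 d0 a20.
by apply/eqP; rewrite eqr_div // ?lt0r_neq0 //; apply/eqP; field.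
Qed.

Section VectorAlgebra.
Context {R : realType} (eps : R) {d : nat}.
Local Notation "<< u , v >>" := (ip eps u v).
Implicit Types p q t w : 'rV[R]_d.

Lemma ip_combination0 p q t w (c s c' s' : R) : <<p, t>> = 0 -> <<p, w>> = 0 ->
  <<q, t>> = 0 -> <<q, w>> = 0 -> <<c *: p + s *: q, c' *: t + s' *: w>> = 0.
Proof. by move=> pt pw qt qw; rewrite !ipE pt pw qt qw; ring. Qed.

Lemma ip_spread p q t (x y : R) : <<t, t>> = 1 -> <<p, t>> = 0 -> <<q, t>> = 0 ->
  <<p + x *: t, q + y *: t>> = <<p, q>> + x * y.
Proof. by move=> tt pt qt; rewrite !ipE [<<t, q>>]ipC tt pt qt; ring. Qed.

Lemma ip_spread2 p q t w (x y : R) : <<p, w>> = 0 -> <<q, t>> = 0 -> <<w, t>> = 0 ->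
  <<p + x *: t, q - y *: w>> = <<p, q>>.
Proof.
by move=> pw qt wt; rewrite !ipE [<<t, q>>]ipC [<<t, w>>]ipC pw qt wt; ring.
Qed.

Lemma ip_spread0 p t w (x : R) : <<p, w>> = 0 -> <<t, w>> = 0 -> <<p + x *: t, w>> = 0.
Proof. by move=> pw tw; rewrite !ipE pw tw; ring. Qed.

Lemma ip_spread1 p t (x : R) : <<p, t>> = 0 -> <<t, t>> = 1 -> <<p + x *: t, t>> = x.
Proof. by move=> pt tt; rewrite !ipE pt tt; ring. Qed.

End VectorAlgebra.

(** * The hypersurface in a product chart *)

Section Hypersurface.
Context {R : realType} (eps : R) (heps : eps = 1 \/ eps = -1).
Local Notation "<< u , v >>" := (ip eps u v).
Variables (D : set 'rV[R]_2) (I : set R) (g nu : 'rV[R]_2 -> 'rV[R]_4) (B : R).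
Hypothesis oD : open D.
Hypothesis oI : open I.
Hypothesis sg : smooth D g.
Hypothesis sn : smooth D nu.
Hypothesis gg : forall u, D u -> <<g u, g u>> = eps.
Hypothesis nn : forall u, D u -> <<nu u, nu u>> = 1.
Hypothesis ng : forall u, D u -> <<nu u, g u>> = 0.
Hypothesis nT : forall u v, D u -> <<nu u, 'D_v g u>> = 0.
Hypothesis injg : forall u v, D u -> 'D_v g u = 0 -> v = 0.
Hypothesis injp : forall u v s, D u -> I s ->
  parallel_derive g nu (Ceps eps s) (Seps eps s) u v = 0 -> v = 0.
Hypothesis B0 : 0 < B.
Local Notation Ce := (Ceps eps).
Local Notation Se := (Seps eps).

Definition cylinder : set 'rV[R]_3 := [set u | D (base u) /\ I (height u)].

Lemma open_cylinder : open cylinder.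
Proof.
apply: openI.
  apply: (open_comp (f := base)) => // x _.
  exact: (@linear_row_continuous _ _ _ (base : {linear 'rV[R]_3 -> 'rV[R]_2})).
apply: (open_comp (f := height)) => // x _.
exact: (@linear_row_continuous _ _ _ (height : {linear 'rV[R]_3 -> R^o})).
Qed.

(** Variable coefficient functions let one derivative formula serve both g_s and N_s. *)
Definition spin (c s : R -> R^o) (u : 'rV[R]_3) : 'rV[R]_4 :=
  c (height u) *: g (base u) + s (height u) *: nu (base u).
(* g_s and its s-derivative in a product chart *)
Definition parallel_map := spin Ce Se.
Definition parallel_normal := spin (fun s => - eps * Se s) Ce.

Lemma differentiable_spin c s dc ds u : cylinder u ->
  is_derive (height u) (1 : R) c dc -> is_derive (height u) (1 : R) s ds ->
  differentiable (spin c s) u /\ forall V,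
  'D_V (spin c s) u = parallel_derive g nu (c (height u)) (s (height u)) (base u) (base V)
     + height V *: (dc *: g (base u) + ds *: nu (base u)).
Proof.
move=> [Du Iu] hc hs.
have chl := @linear_row_continuous _ _ _ (height : {linear 'rV[R]_3 -> R^o}).
have cb := @linear_row_continuous _ _ _ (base : {linear 'rV[R]_3 -> 'rV[R]_2}).
have db : differentiable (base : 'rV[R]_3 -> 'rV[R]_2) u.
  by apply: (linear_differentiable (f := base)); exact: cb.
have dgb : differentiable (g \o base) u.
  by apply: differentiable_comp => //; exact: (differentiable_surface sg).
have dnb : differentiable (nu \o base) u.
  by apply: differentiable_comp => //; exact: (differentiable_normal sn).
have dc1 V := derive_comp_lin (l := height) chl V hc.
have ds1 V := derive_comp_lin (l := height) chl V hs.
have d1 := differentiable_scale (dc1 0).1 dgb.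
have d2 := differentiable_scale (ds1 0).1 dnb.
split=> [|V]; first exact: differentiableD d1 d2.
refine (etrans (deriveD (v := V) (diff_derivable d1) (diff_derivable d2)) _).
refine (etrans (congr2 +%R (derive_scale V (dc1 0).1 dgb) (derive_scale V (ds1 0).1 dnb)) _).
rewrite (dc1 V).2 (ds1 V).2.
rewrite (derive_prelin (L := base) V cb (differentiable_surface sg Du)) (derive_prelin (L := base) V cb (differentiable_normal sn Du)).
rewrite /parallel_derive /comp [dc * _]mulrC [ds * _]mulrC -!scalerA scalerDr.
by rewrite [LHS]addrACA [LHS]addrC.
Qed.

Lemma derive_parallel_map u V : cylinder u -> differentiable parallel_map u /\
  'D_V parallel_map u = parallel_derive g nu (Ce (height u)) (Se (height u)) (base u) (base V) + height V *: parallel_normal u.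
Proof.
move=> cu.
have [d h] := differentiable_spin cu (is_derive_Ceps heps _) (is_derive_Seps heps _).
by split=> //; exact: h.
Qed.

Lemma derive_parallel_normal u V : cylinder u -> differentiable parallel_normal u /\
  'D_V parallel_normal u = parallel_derive g nu (- eps * Se (height u)) (Ce (height u)) (base u) (base V)
    - (eps * height V) *: parallel_map u.
Proof.
move=> cu.
have hs : is_derive (height u) (1 : R) (fun s => - eps * Se s : R^o) (- eps * Ce (height u)).
  have h := is_derive_Seps heps (height u).
  by apply: is_derive_eq; rewrite /GRing.scale /=.
have [d h] := differentiable_spin cu hs (is_derive_Ceps heps _).
split=> //; refine (etrans (h V) _); congr (_ + _).
rewrite /parallel_map /spin; move: (Ce _) (Se _) (g _) (nu _) (height V) => c s' x y h'.
by apply/rowP => i; rewrite !mxE; ring.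
Qed.

Lemma Ck_spin k c s : Ck k cylinder (c \o height) -> Ck k cylinder (s \o height) ->
  Ck k cylinder (spin c s).
Proof.
move=> cc cs; have cb := @linear_row_continuous _ _ _ (base : {linear 'rV[R]_3 -> 'rV[R]_2}).
have bD x : cylinder x -> D (base x) by case.
apply: CkD; first exact: open_cylinder.
- by apply: CkZ => //; [exact: open_cylinder|apply: (Ck_prelin (L := base) open_cylinder cb bD); exact: sg].
- by apply: CkZ => //; [exact: open_cylinder|apply: (Ck_prelin (L := base) open_cylinder cb bD); exact: sn].
Qed.

Lemma Ck_height k : Ck k cylinder (Ce \o height) /\ Ck k cylinder (Se \o height).
Proof.
apply: (Ck_oscillator (l := height) _ (is_derive_Ceps heps) (is_derive_Seps heps) k open_cylinder).
exact: linear_row_continuous.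
Qed.

Lemma Ck_parallel_map k : Ck k cylinder parallel_map.
Proof. by have [hc hs] := Ck_height k; exact: Ck_spin. Qed.

Lemma Ck_parallel_normal k : Ck k cylinder parallel_normal.
Proof.
have [hc hs] := Ck_height k; apply: Ck_spin => //.
apply: (CkM open_cylinder _ hs); exact: Ck_cst.
Qed.

Section Pointwise.
Variables (u : 'rV[R]_3) (cu : cylinder u).
Let Du : D (base u) := cu.1.
Let ip_spin (c s c' s' : R) :
  <<c *: g (base u) + s *: nu (base u), c' *: g (base u) + s' *: nu (base u)>>
  = eps * c * c' + s * s'.
Proof.
rewrite !ipE gg // nn // [<<g _, nu _>>]ipC ng //; ring.
Qed.

Lemma ip_map_map : <<parallel_map u, parallel_map u>> = eps.
Proof.
rewrite ip_spin; have := CepsSeps heps (height u); have := eps_sqr heps.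
move: (Ce _) (Se _) => c s e2 cs.
have -> : eps * c * c + s * s = eps * (c ^+ 2 + eps * s ^+ 2) by ring: e2.
by rewrite cs mulr1.
Qed.

Lemma ip_normal_normal : <<parallel_normal u, parallel_normal u>> = 1.
Proof.
rewrite ip_spin -[RHS](CepsSeps heps (height u)); have := eps_sqr heps.
by move: (Ce _) (Se _) => c s e2; ring: e2.
Qed.

Lemma ip_map_normal : <<parallel_map u, parallel_normal u>> = 0.
Proof.
rewrite ip_spin; have := eps_sqr heps.
by move: (Ce _) (Se _) => c s e2; ring: e2.
Qed.

Lemma ip_par_spin (c s c' s' : R) v :
  <<parallel_derive g nu c s (base u) v, c' *: g (base u) + s' *: nu (base u)>> = 0.
Proof.
apply: ip_combination0.
- exact: (derive_g_g oD sg gg).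
- by rewrite ipC; exact: nT.
- exact: (derive_nu_g oD sg sn ng nT).
- exact: (derive_nu_nu oD sn nn).
Qed.

End Pointwise.

Definition cylinder_map u := toE5 (parallel_map u) (B * height u).
Let a := Num.sqrt (1 + B ^+ 2).
Definition cylinder_normal u := toE5 (- (B / a) *: parallel_normal u) (1 / a).

Lemma slope_norm_sqr : a ^+ 2 = 1 + B ^+ 2.
Proof. by rewrite sqr_sqrtr // addr_ge0 // sqr_ge0. Qed.

Lemma slope_norm_gt0 : 0 < a.
Proof. by rewrite sqrtr_gt0 ltr_pwDl // sqr_ge0. Qed.

Lemma differentiable_height (k : R) u : differentiable (fun u : 'rV[R]_3 => k * height u : R^o) u.
Proof.
apply: differentiableM; first exact: differentiable_cst.
by apply: (linear_differentiable (f := height)); exact: linear_row_continuous.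
Qed.

Lemma derive_height (k : R) u V : 'D_V (fun u : 'rV[R]_3 => k * height u : R^o) u = k * height V.
Proof.
have dh : differentiable (height : 'rV[R]_3 -> R^o) u.
  by apply: (linear_differentiable (f := height)); exact: linear_row_continuous.
rewrite deriveE; last exact: differentiable_height.
refine (etrans (congr1 (fun f => f V) (diffZ k dh)) _).
rewrite /= (diff_lin _ (f := height)) //; exact: linear_row_continuous.
Qed.

Lemma derive_cylinder_map u V : cylinder u -> differentiable cylinder_map u /\
  'D_V cylinder_map u = toE5 ('D_V parallel_map u) (B * height V).
Proof.
move=> cu; have [dP _] := derive_parallel_map V cu; have dh := differentiable_height B u.
split; first exact: differentiable_toE5.
by rewrite (derive_toE5 _ dP dh) derive_height.
Qed.

Lemma derive_cylinder_normal u V : cylinder u -> differentiable cylinder_normal u /\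
  'D_V cylinder_normal u = toE5 (- (B / a) *: 'D_V parallel_normal u) 0.
Proof.
move=> cu; have [dT _] := derive_parallel_normal V cu.
have dk : differentiable (fun=> 1 / a : R^o) u by exact: differentiable_cst.
have dz : differentiable (fun u => - (B / a) *: parallel_normal u) u by exact: differentiableZ.
split; first exact: differentiable_toE5.
rewrite (derive_toE5 _ dz dk) derive_cst; congr (toE5 _ _).
by apply: deriveZ; exact: diff_derivable.
Qed.

Lemma derive_embedded_map u V : cylinder u -> differentiable (fun u => toE5 (parallel_map u) 0) u /\
  'D_V (fun u => toE5 (parallel_map u) 0) u = toE5 ('D_V parallel_map u) 0.
Proof.
move=> cu; have [dP _] := derive_parallel_map V cu.
have dk : differentiable (fun=> 0 : R^o) u by exact: differentiable_cst.
split; first exact: differentiable_toE5.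
by rewrite (derive_toE5 _ dP dk) derive_cst.
Qed.

Lemma Ck_cylinder_map k : Ck k cylinder cylinder_map.
Proof.
apply: Ck_toE5; [exact: open_cylinder|exact: Ck_parallel_map|].
apply: CkM; [exact: open_cylinder|exact: Ck_cst|].
apply: (@Ck_linear _ _ _ k cylinder height); exact: linear_row_continuous.
Qed.

Lemma Ck_cylinder_normal k : Ck k cylinder cylinder_normal.
Proof.
apply: Ck_toE5; [exact: open_cylinder| |exact: Ck_cst].
apply: (CkZ (h := fun=> - (B / a))); [exact: open_cylinder|exact: Ck_cst|exact: Ck_parallel_normal].
Qed.

(** The x_5-component B ds vanishes only for ds = 0, as B > 0; what is left is dg_s, which is
    injective by [injp]. *)
Lemma cylinder_map_immersed u V : cylinder u -> 'D_V cylinder_map u = 0 -> V = 0.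
Proof.
move=> cu; have [_ ->] := derive_cylinder_map V cu; have [_ ->] := derive_parallel_map V cu.
rewrite -toE50 => /toE5_inj[e /eqP]; rewrite mulf_eq0 gt_eqF //= => /eqP h0.
apply: base_height_eq0 => //; move: e; rewrite h0 scale0r addr0.
by case: cu => Du Iu; exact: injp.
Qed.

Lemma ip_derive_map u V W : cylinder u ->
  let p := parallel_derive g nu (Ce (height u)) (Se (height u)) (base u) in
  <<'D_V parallel_map u, 'D_W parallel_map u>> = <<p (base V), p (base W)>> + height V * height W.
Proof.
move=> cu p; rewrite (derive_parallel_map V cu).2 (derive_parallel_map W cu).2.
by apply: ip_spread; [exact: ip_normal_normal|exact: ip_par_spin|exact: ip_par_spin].
Qed.

Lemma ip_derive_map_normal u V W : cylinder u ->
  let p := parallel_derive g nu (Ce (height u)) (Se (height u)) (base u) in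
  let q := parallel_derive g nu (- eps * Se (height u)) (Ce (height u)) (base u) in
  <<'D_V parallel_map u, 'D_W parallel_normal u>> = <<p (base V), q (base W)>>.
Proof.
move=> cu p q; rewrite (derive_parallel_map V cu).2 (derive_parallel_normal W cu).2.
by apply: ip_spread2; [exact: ip_par_spin|exact: ip_par_spin|exact: ip_map_normal].
Qed.

Lemma ip_derive_map_self u V : cylinder u -> <<'D_V parallel_map u, parallel_map u>> = 0.
Proof.
move=> cu; rewrite (derive_parallel_map V cu).2.
by apply: ip_spread0; [exact: ip_par_spin|rewrite ipC; exact: ip_map_normal].
Qed.

Lemma ip_derive_map_axis u V : cylinder u -> <<'D_V parallel_map u, parallel_normal u>> = height V.
Proof.
move=> cu; rewrite (derive_parallel_map V cu).2.
by apply: ip_spread1; [exact: ip_par_spin|exact: ip_normal_normal].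
Qed.

Lemma cylinder_normal_tangent u V : cylinder u -> <<'D_V cylinder_map u, cylinder_normal u>> = 0.
Proof.
move=> cu; have [_ ->] := derive_cylinder_map V cu; rewrite /cylinder_normal ip_toE5 ipZr ip_derive_map_axis //.
by field; rewrite gt_eqF // slope_norm_gt0.
Qed.

Lemma cylinder_normal_unit u : cylinder u -> <<cylinder_normal u, cylinder_normal u>> = 1.
Proof.
move=> cu; rewrite /cylinder_normal ip_toE5 ipZl ipZr (ip_normal_normal cu).
have a0 := slope_norm_gt0; have -> : - (B / a) * (- (B / a) * 1) + 1 / a * (1 / a) = (1 + B ^+ 2) / a ^+ 2.
  by field; rewrite gt_eqF.
by rewrite -slope_norm_sqr divff // gt_eqF // exprn_gt0.
Qed.

Lemma cylinder_normal_map u : cylinder u -> <<cylinder_normal u, toE5 (parallel_map u) 0>> = 0.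
Proof. by move=> cu; rewrite /cylinder_normal ip_toE5 ipZl [<<parallel_normal u, _>>]ipC (ip_map_normal cu); ring. Qed.

Hypothesis flat : forall u v w, D u -> row_free (col_mx v w) ->
  sectional_curvature (gram eps g) u v w = 0.

Lemma hypersurface_curvature u V W : cylinder u -> row_free (col_mx V W) ->
  sectional_curvature (gram eps cylinder_map) u V W = eps / a ^+ 2.
Proof.
move=> cu free.
pose nu1 u := toE5 (parallel_map u) 0.
have d1 w : cylinder w -> differentiable nu1 w by move=> cw; case: (derive_embedded_map 0 cw).
have d2 w : cylinder w -> differentiable cylinder_normal w by move=> cw; case: (derive_cylinder_normal 0 cw).
have n11 w : cylinder w -> <<nu1 w, nu1 w>> = eps.
  by move=> cw; rewrite ip_toE5 (ip_map_map cw) mulr0 addr0.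
have n12 w : cylinder w -> <<nu1 w, cylinder_normal w>> = 0 by move=> cw; rewrite ipC cylinder_normal_map.
have F1 w Z : cylinder w -> <<'D_Z cylinder_map w, nu1 w>> = 0.
  by move=> cw; rewrite (derive_cylinder_map Z cw).2 ip_toE5 ip_derive_map_self // mulr0 addr0.
have F2 w Z (cw : cylinder w) := cylinder_normal_tangent Z cw.
refine (etrans (@sectional_curvatureE R eps heps 3 cylinder cylinder_map nu1 cylinder_normal open_cylinder (Ck_cylinder_map 3)
  d1 d2 n11 cylinder_normal_unit n12 F1 F2 cylinder_map_immersed u V W cu) _).
have W0 := metric_wedge_gt0 heps (Ck_cylinder_map 3) n11 F1 cylinder_map_immersed cu free.
(* The normal [nu1] sees the metric of the horizontal part, [cylinder_normal] sees - B / a times the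
   pairing of dg_s with dN_s, and the induced metric adds B^2 ds^2 to the horizontal one. *)
have E1 X Y : <<'D_X cylinder_map u, 'D_Y nu1 u>> = <<'D_X parallel_map u, 'D_Y parallel_map u>>.
  by rewrite (derive_cylinder_map X cu).2 (derive_embedded_map Y cu).2 ip_toE5 mulr0 addr0.
have E2 X Y : <<'D_X cylinder_map u, 'D_Y cylinder_normal u>> = - (B / a) * <<'D_X parallel_map u, 'D_Y parallel_normal u>>.
  by rewrite (derive_cylinder_map X cu).2 (derive_cylinder_normal Y cu).2 ip_toE5 mulr0 addr0 ipZr.
have E3 X Y : <<'D_X cylinder_map u, 'D_Y cylinder_map u>> = <<'D_X parallel_map u, 'D_Y parallel_map u>> + B ^+ 2 * (height X * height Y).
  by rewrite (derive_cylinder_map X cu).2 (derive_cylinder_map Y cu).2 ip_toE5; ring.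
have H1 X Y := etrans (E1 X Y) (ip_derive_map X Y cu).
have H2 X Y := etrans (E2 X Y) (congr1 ( *%R (- (B / a))) (ip_derive_map_normal X Y cu)).
have H3 X Y := etrans (E3 X Y) (congr1 (fun z => z + B ^+ 2 * (height X * height Y))
  (ip_derive_map X Y cu)).
have wedge := parallel_wedge heps oD sg sn gg nn ng nT injg flat (base V) (base W)
  (Ce (height u)) (Se (height u)) cu.1.
have H1s := etrans (E1 W V) (etrans (ipC eps _ _) (ip_derive_map V W cu)).
exact: (hypersurface_quotient (eps_sqr heps) slope_norm_sqr slope_norm_gt0 wedge (H1 V V) (H1 W W) (H1 V W) H1s
  (H2 V V) (H2 W W) (H2 V W) (H2 W V) (H3 V V) (H3 W W) (H3 V W) W0).
Qed.

End Hypersurface.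

(** * Charts *)

Section Weingarten.
Context {R : realType} (eps : R) (heps : eps = 1 \/ eps = -1).
Local Notation "<< u , v >>" := (ip eps u v).
Variables (D : set 'rV[R]_2) (g nu : 'rV[R]_2 -> 'rV[R]_4).
Hypothesis oD : open D.
Hypothesis sg : smooth D g.
Hypothesis sn : smooth D nu.
Hypothesis gg : forall u, D u -> <<g u, g u>> = eps.
Hypothesis nn : forall u, D u -> <<nu u, nu u>> = 1.
Hypothesis ng : forall u, D u -> <<nu u, g u>> = 0.
Hypothesis nT : forall u v, D u -> <<nu u, 'D_v g u>> = 0.
Hypothesis injg : forall u v, D u -> 'D_v g u = 0 -> v = 0.

(** Multiplying by the Gram matrix turns the eigenvalue equation into equality of the products of
    dN(v) and - lambda dg(v) with the tangent frame. Both vectors are orthogonal to [g] and [nu], so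
    [frame_perp] makes them equal. *)
Lemma weingarten_eigenP u (v : 'rV[R]_2) (lambda : R) : D u ->
  v *m ((\matrix_(i, j) - <<partial nu i u, partial g j u>>) *m invmx (gram eps g u))
    = lambda *: v <-> 'D_v nu u = - lambda *: 'D_v g u.
Proof.
move=> Du; set h := \matrix_(i, j) _; set G := gram eps g u.
have uG : G \in unitmx.
  exact: (gram_unitmx heps (sg 3) gg (fun u v Du => derive_g_g oD sg gg v Du) injg).
have -> : v *m (h *m invmx G) = lambda *: v <-> v *m h = lambda *: (v *m G).
  split=> [e|e]; last by rewrite mulmxA e -scalemxAl mulmxK.
  by rewrite -[v *m h](mulmxKV uG) -[v *m h *m _]mulmxA e -scalemxAl.
have hE j : (v *m h) 0 j = - <<'D_v nu u, partial g j u>>.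
  rewrite (derive_partial v (differentiable_normal sn Du)) ip_suml mxE -sumrN.
  by apply: eq_bigr => i _; rewrite mxE ipZl mulrN.
have GE j : (v *m G) 0 j = <<'D_v g u, partial g j u>>.
  rewrite (derive_partial v (differentiable_surface sg Du)) ip_suml mxE.
  by apply: eq_bigr => i _; rewrite mxE ipZl.
split=> [e|e]; last first.
  apply/rowP => j; rewrite [RHS]mxE hE GE e; apply: (canLR opprK).
  by rewrite ipZl mulNr.
have gn : <<g u, nu u>> = 0 by rewrite ipC ng.
have P1 i : <<partial g i u, g u>> = 0 by exact: (derive_g_g oD sg gg).
have P2 i : <<partial g i u, nu u>> = 0 by rewrite ipC; exact: nT.
have fr (c : 'rV[R]_2) : \sum_i c 0 i *: partial g i u = 0 -> c = 0.
  by rewrite -(derive_partial c (differentiable_surface sg Du)); exact: injg.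
apply/eqP; rewrite scaleNr -addr_eq0; apply/eqP.
apply: (frame_perp heps (gg Du) (nn Du) gn P1 P2 fr).
- apply: (ip_spread0 lambda (derive_nu_g oD sg sn ng nT v Du)).
  exact: (derive_g_g oD sg gg).
- apply: (ip_spread0 lambda (derive_nu_nu oD sn nn v Du)).
  by rewrite ipC; exact: nT.
- move=> j; have /rowP/(_ j) := e; rewrite [RHS]mxE hE GE => ej.
  by rewrite ipDl ipZl -ej addrN.
Qed.

End Weingarten.

Section Cot.
Context {R : realType}.

(** [Uset] constrains only angles in (0, pi), whereas the parameter s may be any real; theta is its
    representative modulo pi, namely acos of cos s times the sign of sin s. *)
Lemma cot_angle (s : R) : sin s != 0 ->
  exists theta, [/\ 0 < theta < pi, cos theta / sin theta = cos s / sin s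
    & sin (theta - s) = 0].
Proof.
move=> s0.
pose sg : R := if 0 < sin s then 1 else -1.
have sg2 : sg * sg = 1 by rewrite /sg; case: ifP => _; ring.
have sgs : `|sin s| = sg * sin s.
  rewrite /sg; have [h|h|h] := ltrgtP 0 (sin s).
  - by rewrite mul1r gtr0_norm.
  - by rewrite mulN1r ltr0_norm.
  - by rewrite -h eqxx in s0.
have c1 : -1 <= sg * cos s <= 1.
  have l1 := cos_geN1 s; have l2 := cos_le1 s.
  by rewrite /sg; case: ifP => _; apply/andP; split; lra.
pose th := acos (sg * cos s).
have cth : cos th = sg * cos s by rewrite acosK.
have sth : sin th = sg * sin s.
  rewrite sin_acos // -sgs exprMn expr2 sg2 mul1r -sin2cos2 sqrtr_sqr //.
have th0 : 0 < sin th by rewrite sth -sgs normr_gt0.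
exists th; split.
- have h0 := acos_ge0 c1; have hpi := acos_lepi c1.
  rewrite !lt_neqAle h0 hpi !andbT; apply/andP; split; apply/eqP => e.
    by move: th0; rewrite -e sin0 ltxx.
  by move: th0; rewrite e sinpi ltxx.
- rewrite cth sth -mulf_div divff ?mul1r //.
  by rewrite /sg; case: ifP => _; rewrite ?oppr_eq0 oner_eq0.
- rewrite sinB cth sth; ring.
Qed.

Lemma sinh_eq0 (s : R) : expR s - expR (- s) = 0 -> s = 0.
Proof. by move/eqP; rewrite subr_eq0 => /eqP/expR_inj; lra. Qed.

End Cot.

Section Charts.
Context {R : realType} {X : topologicalType} {n : nat}.

Lemma open_chart_restrict (phi : chart R X n) (V : set X) : is_chart phi -> open V ->
  open (chart_map phi @` (chart_dom phi `&` V)).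
Proof.
move=> [od oi K _ ci] oV.
have -> : chart_map phi @` (chart_dom phi `&` V)
    = chart_im phi `&` chart_inv phi @^-1` V.
  apply/seteqP; split=> [u [x [dx Vx] <-]|u [[x dx <-]]].
    by split; [exists x|rewrite /= K].
  by rewrite /= K // => Vx; exists x.
rewrite openE => u [iu Vu]; apply: filterI.
  exact: open_nbhs_nbhs.
apply: ci => //; exact: open_nbhs_nbhs.
Qed.

End Charts.

Lemma immersion_chart {R : realType} {X : topologicalType} {n m : nat}
    (A : set (chart R X n)) (F : X -> 'rV[R]_m) phi u v : immersion A F -> A phi ->
  chart_im phi u -> 'D_v (F \o chart_inv phi) u = 0 -> v = 0.
Proof.
move=> [sF iF] Aphi iu; rewrite deriveE; last exact: (sF phi Aphi 1%N).1.
by move=> e; apply: (iF phi u Aphi iu); rewrite e linear0.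
Qed.

Lemma diff_inj {R : realType} {V W : normedModType R} (f : V -> W) u :
  differentiable f u -> (forall v, 'D_v f u = 0 -> v = 0) -> injective ('d f u).
Proof.
move=> df h v w e; apply/eqP; rewrite -subr_eq0; apply/eqP; apply: h.
by rewrite deriveE // linearB e subrr.
Qed.

Section FlatSurface.
Context {R : realType} (eps : R) (heps : eps = 1 \/ eps = -1).
Context {M : topologicalType} (A : set (chart R M 2)) (g N : M -> 'rV[R]_4).
Variables (V : set M) (I : set R).
Local Notation "<< u , v >>" := (ip eps u v).
Hypothesis fs : flat_surface eps A g N.
Hypothesis ad : admissible eps A g N V I.

Section OneChart.
Variables (phi : chart R M 2) (Aphi : A phi).
Local Notation inv := (chart_inv phi).
Local Notation gc := (g \o inv).
Local Notation nc := (N \o inv).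
Local Notation D := (chart_map phi @` (chart_dom phi `&` V)).

Lemma chart_is_chart : is_chart phi.
Proof. by case: fs => -[_ _ [h _ _]] *; exact: h. Qed.

Lemma chart_open : open D.
Proof. by case: ad => oV *; exact: open_chart_restrict chart_is_chart oV. Qed.

Lemma chart_sub : D `<=` chart_im phi.
Proof. by move=> u [x [dx _] <-]; exists x. Qed.

Lemma chart_inv_in u : D u -> V (inv u).
Proof.
by have [_ _ K _ _] := chart_is_chart; move=> [x [dx Vx] <-]; rewrite K.
Qed.

Lemma chart_map_inv u : D u -> chart_dom phi (inv u) /\ chart_map phi (inv u) = u.
Proof.
by have [_ _ K _ _] := chart_is_chart; move=> [x [dx Vx] <-]; rewrite K.
Qed.

Lemma chart_smooth_g : smooth D gc.
Proof.
move=> k; apply: (sub_Ck chart_sub); exact: (flat_surface_immersion fs).1 phi Aphi k.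
Qed.

Lemma chart_smooth_n : smooth D nc.
Proof.
move=> k; apply: (sub_Ck chart_sub); exact: (flat_surface_normal_smooth fs) phi Aphi k.
Qed.

Lemma chart_gg u : D u -> <<gc u, gc u>> = eps.
Proof. by move=> _; case: (flat_surface_in_Q3 fs (inv u)). Qed.

Lemma chart_nn u : D u -> <<nc u, nc u>> = 1.
Proof. by move=> _; exact: (flat_surface_normal_unit fs). Qed.

Lemma chart_ng u : D u -> <<nc u, gc u>> = 0.
Proof. by move=> _; exact: (flat_surface_normal_tangent_Q3 fs). Qed.

Lemma chart_nT u v : D u -> <<nc u, 'D_v gc u>> = 0.
Proof. by move=> /chart_sub; exact: (flat_surface_normal fs). Qed.

Lemma chart_injg u v : D u -> 'D_v gc u = 0 -> v = 0.
Proof. by move=> /chart_sub; exact: (immersion_chart (flat_surface_immersion fs)). Qed.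

Lemma chart_flat u v w : D u -> row_free (col_mx v w) ->
  sectional_curvature (gram eps gc) u v w = 0.
Proof. by move=> /chart_sub iu; exact: (flat_surface_flat fs). Qed.

Lemma chart_eigenP u v (lambda : R) : D u ->
  v *m shape_operator eps g N phi u = lambda *: v <-> 'D_v nc u = - lambda *: 'D_v gc u.
Proof.
exact: (weingarten_eigenP heps chart_open chart_smooth_g chart_smooth_n chart_gg
  chart_nn chart_ng chart_nT chart_injg).
Qed.

(* If C dg + S dN were singular, C / S would be a principal curvature, which
   the definition of U excludes. *)
Lemma chart_injp u v s : D u -> I s ->
  parallel_derive gc nc (Ceps eps s) (Seps eps s) u v = 0 -> v = 0.
Proof.
move=> Du Is p0; apply/eqP/negPn/negP => v0.
have [Vu [du mu]] := (chart_inv_in Du, chart_map_inv Du).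
have Us : Uset eps A g N (inv u, s) by case: ad => _ _ _ _; apply.
(* If S = 0 then C^2 = 1 and the kernel condition already reads dg(v) = 0; otherwise division by S
   is possible. *)
have [S0|S0] := eqVneq (Seps eps s) 0.
  have := CepsSeps heps s; rewrite S0 expr0n mulr0 addr0 => C2.
  have C0 : Ceps eps s != 0 by apply/eqP => C0; move: C2; rewrite C0 expr0n => /eqP; rewrite eq_sym oner_eq0.
  move: p0; rewrite /parallel_derive S0 scale0r addr0 => /eqP; rewrite scaler_eq0 (negPf C0) /=.
  by move=> /eqP/(chart_injg Du)/eqP; rewrite (negPf v0).
have pc : principal_curvature eps A g N (inv u) (cteps eps s).
  exists phi; split=> //; rewrite mu; apply/eigenvalueP; exists v => //.
  apply/(chart_eigenP v _ Du).
  have /eqP := p0; rewrite /parallel_derive addrC addr_eq0 => /eqP e.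
  have -> : 'D_v nc u = (Seps eps s)^-1 *: (Seps eps s *: 'D_v nc u).
    by rewrite scalerA mulVf // scale1r.
  by rewrite e -scaleNr scalerA /cteps mulrN mulrC.
case: heps => e; last first.
  have s0 : s != 0 by apply: contra_neq S0 => ->; exact: Seps0.
  have := Us s pc; rewrite e N1_neq1 /= => /(_ s0)[h1 h2].
  have [h|h|h] := ltrgtP s 0; last by rewrite h eqxx in s0.
    by have := h2 h; rewrite ltxx.
  by have := h1 h; rewrite ltxx.
have ss0 : sin s != 0 by move: S0; rewrite /Seps e eqxx.
have [th [thp cth sth]] := cot_angle ss0.
(* The angle [th] has the same cotangent as s, so [Uset] gives th - pi < s < th and sin(th - s) > 0,
   whereas this sine is zero. *)
have := Us th; rewrite /cteps /Ceps /Seps e eqxx cth /=.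
move: pc; rewrite /cteps /Ceps /Seps e eqxx => pc /(_ pc thp)/andP[h1 h2].
have : 0 < sin (th - s) by apply: sin_gt0_pi; apply/andP; split; lra.
by rewrite sth ltxx.
Qed.

End OneChart.

Lemma parallel_immersion s : I s ->
  immersion (restrict_atlas A V) (parallel_surface eps g N s).
Proof.
move=> Is.
have D1 phi u : A phi -> (chart_map phi @` (chart_dom phi `&` V)) u ->
    forall v, differentiable (parallel_surface eps g N s \o chart_inv phi) u /\
    'D_v (parallel_surface eps g N s \o chart_inv phi) u
      = parallel_derive (g \o chart_inv phi) (N \o chart_inv phi) (Ceps eps s) (Seps eps s) u v.
  move=> Aphi Du v; have dgu := differentiable_surface (chart_smooth_g Aphi) Du.
  have dnu' := differentiable_normal (chart_smooth_n Aphi) Du.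
  have d1 : differentiable (Ceps eps s \*: (g \o chart_inv phi)) u by exact: differentiableZ.
  have d2 : differentiable (Seps eps s \*: (N \o chart_inv phi)) u by exact: differentiableZ.
  split; first exact: differentiableD d1 d2.
  refine (etrans (deriveD (v := v) (diff_derivable d1) (diff_derivable d2)) _).
  by congr (_ + _); apply: deriveZ; exact: diff_derivable.
split=> [_ [phi Aphi <-] k|_ u [phi Aphi <-] Du].
  have oD := chart_open Aphi.
  apply: CkD => //.
    by apply: (CkZ (h := fun=> Ceps eps s)) => //; [exact: Ck_cst|exact: chart_smooth_g].
  by apply: (CkZ (h := fun=> Seps eps s)) => //; [exact: Ck_cst|exact: chart_smooth_n].
apply: diff_inj; first exact: (D1 phi u Aphi Du 0).1.
by move=> v; rewrite (D1 phi u Aphi Du v).2; exact: chart_injp.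
Qed.

Variables (B : R) (B0 : 0 < B).
Let f := hypersurface eps g N B.
Let A3 := cylinder_atlas (restrict_atlas A V) I.
Let a := Num.sqrt (1 + B ^+ 2).

Definition normal_field (p : M * R) : 'rV[R]_5 :=
  toE5 (- (B / a) *: ((- eps * Seps eps p.2) *: g p.1 + Ceps eps p.2 *: N p.1)) (1 / a).

Lemma hypersurface_chartE phi :
  f \o (fun u : 'rV[R]_3 => (chart_inv phi (\row_i u 0 (widen_ord (leqnSn 2) i)), u 0 ord_max))
  = cylinder_map eps (g \o chart_inv phi) (N \o chart_inv phi) B.
Proof. by apply: funext => u; rewrite /cylinder_map toE5E. Qed.

Lemma cylinder_chart_im phi u : A phi ->
  chart_im (Chart ((chart_dom phi `&` V) `*` I)
    (fun p => castmx (erefl, addn1 2) (row_mx (chart_map phi p.1) (p.2)%:M))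
    (fun u : 'rV[R]_3 => (chart_inv phi (\row_i u 0 (widen_ord (leqnSn 2) i)), u 0 ord_max))) u ->
  cylinder (chart_map phi @` (chart_dom phi `&` V)) I u.
Proof.
move=> Aphi [[x s] /= [[dx Vx] Is] <-].
have e1 : base (castmx (erefl, addn1 2) (row_mx (chart_map phi x) s%:M)) = chart_map phi x.
  apply/rowP => i; rewrite mxE castmxE /= cast_ord_id.
  have -> : cast_ord (esym (addn1 2)) (widen_ord (leqnSn 2) i) = lshift 1 i by exact: val_inj.
  exact: row_mxEl.
have e2 : height (castmx (erefl, addn1 2) (row_mx (chart_map phi x) s%:M)) = s.
  rewrite /height castmxE /= cast_ord_id.
  have -> : cast_ord (esym (addn1 2)) ord_max = rshift 2 ord0 by exact: val_inj.
  by rewrite row_mxEr mxE eqxx mulr1n.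
by split; rewrite ?e1 ?e2 //; exists x.
Qed.

Lemma hypersurface_immersion : immersion A3 f.
Proof.
have [_ oI _ _ _] := ad.
split=> [_ [_ [phi Aphi <-] <-] k|_ u [_ [phi Aphi <-] <-] iu].
  rewrite /= hypersurface_chartE.
  apply: (sub_Ck (fun u => @cylinder_chart_im phi u Aphi)).
  exact: (Ck_cylinder_map heps B (chart_open Aphi) oI (chart_smooth_g Aphi) (chart_smooth_n Aphi)).
have cu := cylinder_chart_im Aphi iu.
rewrite /= hypersurface_chartE.
have dF V := derive_cylinder_map heps B (chart_smooth_g Aphi) (chart_smooth_n Aphi) V cu.
apply: diff_inj; first exact: (dF 0).1.
move=> v; apply: (cylinder_map_immersed heps (chart_smooth_g Aphi) (chart_smooth_n Aphi) _ B0 cu).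
exact: (@chart_injp phi Aphi).
Qed.

Lemma hypersurface_Q3xR p : (V `*` I) p -> Q3xR eps (f p).
Proof.
move=> _; case: p => x s; rewrite /Q3xR /Q3 /= /f /hypersurface -toE5E horizontal_toE5.
have [gQ g0] := flat_surface_in_Q3 fs x.
have N1 := flat_surface_normal_unit fs x; have Ng := flat_surface_normal_tangent_Q3 fs x.
have e2 := eps_sqr heps; have CS := CepsSeps heps s.
split=> [|e].
  rewrite /parallel_surface !ipDl !ipDr !ipZl !ipZr gQ N1 Ng [<<g x, N x>>]ipC Ng.
  move: CS; move: (Ceps eps s) (Seps eps s) => c s' CS.
  transitivity (eps * (c ^+ 2 + eps * s' ^+ 2)); last by rewrite CS mulr1.
  ring: e2.
have {}g0 := g0 e; rewrite !mxE.
(* To stay on the sheet x_1 > 0: the identity gives |N_0| <= g_0, so in C g_0 + S N_0 = (e^s (g_0 +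
   N_0) + e^(-s) (g_0 - N_0)) / 2 both terms are nonnegative, and they vanish together only if g_0 =
   0. *)
have h := lorentz_identity e gQ Ng; rewrite N1 mulr1 in h.
have h0 : N x 0 0 ^+ 2 <= g x 0 0 ^+ 2.
  by rewrite h lerDr sumr_ge0 // => i _; exact: sqr_ge0.
have hN : `|N x 0 0| <= g x 0 0 by rewrite -(ger0_norm (ltW g0)) -ler_sqr ?nnegrE // !real_normK ?num_real.
move: hN; rewrite ler_norml => /andP[h1 h2].
rewrite /Ceps /Seps e N1_neq1; have := expR_gt0 s; have := expR_gt0 (- s).
move: (expR s) (expR (- s)) => z w w0 z0.
have -> : (z + w) / 2 * g x 0 0 + (z - w) / 2 * N x 0 0
   = (z * (g x 0 0 + N x 0 0) + w * (g x 0 0 - N x 0 0)) / 2 by field.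
have a1 : 0 <= z * (g x 0 0 + N x 0 0) by apply: mulr_ge0; [exact: ltW|lra].
have a2 : 0 <= w * (g x 0 0 - N x 0 0) by apply: mulr_ge0; [exact: ltW|lra].
rewrite divr_gt0 // lt_neqAle eq_sym addr_ge0 // andbT; apply/eqP => z00.
have /eqP : z * (g x 0 0 + N x 0 0) = 0 by lra.
have /eqP : w * (g x 0 0 - N x 0 0) = 0 by lra.
rewrite !mulf_eq0 (gt_eqF z0) (gt_eqF w0) /= => /eqP b1 /eqP b2; lra.
Qed.

Lemma normal_field_chartE phi :
  normal_field \o (fun u : 'rV[R]_3 =>
    (chart_inv phi (\row_i u 0 (widen_ord (leqnSn 2) i)), u 0 ord_max))
  = cylinder_normal eps (g \o chart_inv phi) (N \o chart_inv phi) B.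
Proof. by []. Qed.

Lemma normal_field_smooth : smooth_map A3 normal_field.
Proof.
have [_ oI _ _ _] := ad.
move=> _ [_ [phi Aphi <-] <-] k; rewrite /= normal_field_chartE.
apply: (sub_Ck (fun u => @cylinder_chart_im phi u Aphi)).
exact: (Ck_cylinder_normal heps B (chart_open Aphi) oI (chart_smooth_g Aphi) (chart_smooth_n Aphi)).
Qed.

Lemma normal_field_normal : normal_along eps A3 f normal_field.
Proof.
move=> _ u v [_ [phi Aphi <-] <-] iu; rewrite /= ipC.
have cu := cylinder_chart_im Aphi iu.
have := cylinder_normal_tangent heps B (chart_open Aphi) (chart_smooth_g Aphi) (chart_smooth_n Aphi)
  (@chart_gg phi) (@chart_nn phi) (@chart_ng phi) (@chart_nT phi Aphi) v cu.
by rewrite -hypersurface_chartE.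
Qed.

Lemma normal_field_unit p :
  [/\ ip eps (normal_field p) (normal_field p) = 1,
      ip eps (normal_field p) (toE5 (horizontal (f p)) 0) = 0 &
      ip eps (normal_field p) dt = 1 / a].
Proof.
case: p => x s; have gQ := (flat_surface_in_Q3 fs x).1.
have N1 := flat_surface_normal_unit fs x; have Ng := flat_surface_normal_tangent_Q3 fs x.
have e2 := eps_sqr heps; have CS := CepsSeps heps s; have a0 := slope_norm_gt0 B; have aE := slope_norm_sqr B.
split.
- rewrite ip_toE5 !(ipZl, ipZr, ipDl, ipDr) gQ N1 Ng [<<g x, N x>>]ipC Ng.
  move: CS a0 aE; rewrite -/a; move: (Ceps eps s) (Seps eps s) => c s' CS a0 aE.
  transitivity ((B ^+ 2 * (c ^+ 2 + eps * eps * eps * s' ^+ 2) + 1) / a ^+ 2).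
    by field; rewrite gt_eqF.
  by rewrite e2 mul1r CS mulr1 addrC -aE divff // gt_eqF // exprn_gt0.
- rewrite /f /hypersurface -toE5E horizontal_toE5 ip_toE5 /parallel_surface /=.
  rewrite !(ipZl, ipZr, ipDl, ipDr) gQ N1 Ng [<<g x, N x>>]ipC Ng.
  by move: (Ceps eps s) (Seps eps s) => c s'; ring: e2.
- by rewrite dtE ip_toE5 ip0r mulr1 add0r.
Qed.

Lemma hypersurface_constant_curvature : constant_curvature eps A3 f (eps / a ^+ 2).
Proof.
have [_ oI _ _ _] := ad.
move=> _ u v w [_ [phi Aphi <-] <-] iu free; have cu := cylinder_chart_im Aphi iu.
rewrite /= hypersurface_chartE.
exact: (hypersurface_curvature heps (chart_open Aphi) oI (chart_smooth_g Aphi)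
  (chart_smooth_n Aphi) (@chart_gg phi) (@chart_nn phi) (@chart_ng phi) (@chart_nT phi Aphi)
  (@chart_injg phi Aphi) (@chart_injp phi Aphi) B0 (@chart_flat phi Aphi) cu free).
Qed.

End FlatSurface.

(** * The image of a smooth curve has no interior *)

(** Completeness of the plane is what [Baire] asks for below. *)
HB.instance Definition _ (R : realType) m n := Complete.on 'M[R]_(m, n).

Lemma ord2P (k : 'I_2) : k = 0 \/ k = 1.
Proof. by case: k => -[|[|//]] ?; [left|right]; exact: val_inj. Qed.

Section CurveImage.
Context {R : realType}.
Implicit Types (gamma : R -> 'rV[R]_2) (p q L : R).

Definition lipschitz_on gamma p q L := forall s t k,
  p <= s <= q -> p <= t <= q -> `|gamma s 0 k - gamma t 0 k| <= L * `|s - t|.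

(* A k x k grid has more points than the O(k) pieces of the curve of diameter
   less than the mesh of the grid. *)
Lemma lipschitz_image_no_interior gamma p q L (U : set 'rV[R]_2) : p < q ->
  lipschitz_on gamma p q L -> open U -> U !=set0 ->
  ~ U `<=` gamma @` [set t | p <= t <= q].
Proof.
move=> pq lip oU [c Uc] sub.
have /nbhs_ballP[d /= d0 dU] := open_nbhs_nbhs (conj oU Uc).
have qp0 : 0 < q - p by rewrite subr_gt0.
pose K := (Num.truncn (`|L| * (q - p) / d)).+1.
have Kd : `|L| * (q - p) < K%:R * d.
  by rewrite -ltr_pdivrMr // truncnS_gt.
(* On a piece of parameter length (q - p) / n a coordinate varies by at most |L| (q - p) / n < K d /
   n = h, the mesh of the grid. There are n + 1 = K m + 1 pieces against m^2 = K m + 2 m grid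
   points. *)
pose m := K.+2; pose n := (K * m)%N; pose h := d / m%:R.
have m0 : 0 < m%:R :> R by rewrite ltr0n.
have n0 : 0 < n%:R :> R by rewrite ltr0n.
have h0 : 0 < h by rewrite divr_gt0.
pose z (ij : 'I_m * 'I_m) : 'rV[R]_2 :=
  \row_k (c 0 k + (if k == 0 then ij.1%:R else ij.2%:R) * h).
have zU ij : U (z ij).
  apply: dU; split=> // i k; rewrite ord1 mxE /ball /= opprD addrA subrr sub0r normrN.
  have hm (l : 'I_m) : `|l%:R * h| < d.
    have lh : 0 <= l%:R * h by apply: mulr_ge0; [exact: ler0n|exact: ltW].
    by rewrite ger0_norm // /h mulrA ltr_pdivrMr // mulrC ltr_pM2l // ltr_nat.
  by case: ifP => _; exact: hm.
have tau ij : {t | p <= t <= q /\ gamma t = z ij}.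
  by apply: cid; have [t] := sub _ (zU ij); exists t.
pose ta ij := sval (tau ij).
have taP ij : p <= ta ij <= q /\ gamma (ta ij) = z ij := svalP (tau ij).
pose w ij := (ta ij - p) * n%:R / (q - p).
have w0 ij : 0 <= w ij.
  have [/andP[a _] _] := taP ij.
  by rewrite divr_ge0 ?(ltW qp0) // mulr_ge0 ?ler0n // subr_ge0.
have wn ij : w ij <= n%:R.
  have [/andP[_ a] _] := taP ij.
  by rewrite ler_pdivrMr // mulrC ler_pM2l // lerD2r.
(* [w] rescales the parameter to [0, n]; the endpoint w = n accounts for the extra index. *)
pose piece ij : 'I_n.+1 := inord (Num.truncn (w ij)).
have pieceE ij : piece ij = Num.truncn (w ij) :> nat.
  by rewrite inordK // ltnS -(ler_nat R); apply: le_trans (wn ij); rewrite truncn_le.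
have inj : injective piece.
  move=> x y /(congr1 val) /=; rewrite !pieceE => e.
  have [tx zx] := taP x; have [ty zy] := taP y.
  have wxy : `|w x - w y| < 1.
    have /andP[a1 a2] := truncn_itv (w0 x); have /andP[b1 b2] := truncn_itv (w0 y).
    rewrite e in a1 a2; rewrite ltr_norml; move: a2 b2; rewrite -!natr1; lra.
  have txy : `|ta x - ta y| * n%:R < q - p.
    move: wxy; rewrite /w -mulrBl -mulrBl !normrM normfV (gtr0_norm qp0) (gtr0_norm n0).
    rewrite ltr_pdivrMr // mul1r; congr (`|_| * _ < _); ring.
  have close k : `|z x 0 k - z y 0 k| < h.
    rewrite -zx -zy; apply: (le_lt_trans (lip _ _ k tx ty)).
    apply: (@le_lt_trans _ _ (`|L| * `|ta x - ta y|)).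
      by rewrite ler_wpM2r // ler_norm.
    rewrite /h ltr_pdivlMr // -(ltr_pM2l (_ : 0 < K%:R)) ?ltr0n //.
    apply: (le_lt_trans _ Kd).
    have -> : K%:R * (`|L| * `|ta x - ta y| * m%:R) = `|L| * (`|ta x - ta y| * n%:R).
      by rewrite /n natrM; ring.
    by rewrite ler_wpM2l // ltW.
  have grid (i j : 'I_m) (a : R) : `|a + i%:R * h - (a + j%:R * h)| < h -> i = j.
    have -> : a + i%:R * h - (a + j%:R * h) = (i%:R - j%:R) * h by ring.
    rewrite normrM (gtr0_norm h0) gtr_pMl // ltr_norml => /andP[l1 l2].
    apply: val_inj => /=; have [ij|ij|//] := ltngtP i j.
      have {}ij : i%:R + 1 <= j%:R :> R by rewrite natr1 ler_nat.
      by exfalso; lra.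
    have {}ij : j%:R + 1 <= i%:R :> R by rewrite natr1 ler_nat.
    by exfalso; lra.
  have := close 0; have := close 1; rewrite !mxE /= => /grid e2 /grid e1.
  by rewrite [x]surjective_pairing [y]surjective_pairing e1 e2.
have := leq_card piece inj; rewrite card_prod !card_ord /n /m; lia.
Qed.

(** The derivative is continuous, hence bounded near t, and the mean value theorem applies to each
    coordinate. Rational endpoints leave only countably many segments for Baire's theorem. *)
Lemma Ck1_lipschitz (J : set R) gamma t : open J -> Ck 1 J (gamma : R^o -> _) -> J t ->
  exists p q : rat, [/\ (ratr p : R) < t < ratr q,
    forall s : R, ratr p <= s <= ratr q -> J s &
    exists L, lipschitz_on gamma (ratr p) (ratr q) L].
Proof.
move=> oJ cg Jt.
have ck k : Ck 1 J (fun s => gamma s 0 k : R^o) by exact: Ck_row_coord.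
pose g k (s : R^o) : R^o := gamma s 0 k.
pose L := 1 + `|'D_1 (g 0) t| + `|'D_1 (g 1) t|.
have nb k : \forall s \near t, `|'D_1 (g k) s| <= L.
  have c1 : {for t, continuous (fun s => 'D_1 (g k) s)} by exact: (ck k).2.
  have /cvgrPdist_lt/(_ 1 ltr01) := c1; apply: filterS => s; rewrite /= => h.
  have lk : `|'D_1 (g k) t| + 1 <= L.
    rewrite /L; have := normr_ge0 ('D_1 (g 0) t); have := normr_ge0 ('D_1 (g 1) t).
    by have [->|->] := ord2P k; lra.
  apply: le_trans lk; rewrite -lerBlDl; apply: le_trans (ltW h).
  by rewrite distrC lerB_dist.
have nJ : nbhs t J by exact: open_nbhs_nbhs.
have nA : \forall s \near t, J s /\ `|'D_1 (g 0) s| <= L /\ `|'D_1 (g 1) s| <= L.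
  by apply: filterS3 nJ (nb 0) (nb 1) => s.
have /nbhs_ballP[r /= r0 Hr] := nA.
have tr1 : t - r < t by rewrite ltrBlDr ltrDl.
have tr2 : t < t + r by rewrite ltrDl.
have [p /itvP hp] := rat_in_itvoo tr1; have [q /itvP hq] := rat_in_itvoo tr2.
have Hs (s : R) : ratr p <= s <= ratr q -> J s /\ forall k, `|'D_1 (g k) s| <= L.
  move=> /andP[ps sq]; have : ball t r s.
    rewrite /ball /= ltr_norml ltrBrDl ltrBlDr.
    have h1 : t - r < s by apply: lt_le_trans ps; rewrite hp.
    have h2 : s < t + r by apply: (le_lt_trans sq); rewrite hq.
    by apply/andP; split; lra.
  move=> /Hr[Js [B0 B1]]; split=> // k.
  by have [->|->] := ord2P k.
exists p, q; split; first by rewrite hp hq.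
  by move=> s /Hs[].
exists L; have lip s u k : s <= u -> ratr p <= s <= ratr q -> ratr p <= u <= ratr q ->
    `|g k u - g k s| <= L * `|u - s|.
  move=> su /andP[s1 s2] /andP[u1 u2].
  have inJ x : s <= x <= u -> J x /\ `|'D_1 (g k) x| <= L.
    move=> /andP[sx xu]; have [|Jx h] := Hs x; last by split.
    by rewrite (le_trans s1 sx) (le_trans xu u2).
  have dx x : s <= x <= u -> is_derive x (1 : R) (g k : R -> R) ('D_1 (g k) x).
    by move=> /inJ[Jx _]; apply: derivableP; apply/diff_derivable/(ck k).1.
  have [x|x|x xsu ->] := @MVT_segment _ (g k) (fun x => 'D_1 (g k) x) s u su.
  - by rewrite in_itv /= => /andP[a b]; apply: dx; rewrite !ltW.
  - apply: derivable_within_continuous => y; rewrite in_itv /= => hy.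
    by have [] := dx y hy.
  - rewrite normrM ler_wpM2r //; apply: (inJ x _).2.
    by move: xsu; rewrite in_itv.
move=> s u k hs hu; have [su|/ltW us] := leP s u; last exact: lip.
by rewrite distrC [`|s - u|]distrC; exact: lip.
Qed.

(** Segments with rational endpoints on which the curve is Lipschitz cover [J]. Their images are
    compact, hence closed, and have empty interior; the complements are open and dense, so by
    Baire's theorem some point of [U] avoids all of them. *)
Lemma curve_image_no_interior (J : set R) gamma (U : set 'rV[R]_2) : open J ->
  Ck 1 J (gamma : R^o -> _) -> open U -> U !=set0 -> ~ U `<=` gamma @` J.
Proof.
move=> oJ cg oU U0 sub.
pose good (pq : rat * rat) := [/\ ratr pq.1 < ratr pq.2 :> R,
   forall s : R, ratr pq.1 <= s <= ratr pq.2 -> J s &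
   exists L, lipschitz_on gamma (ratr pq.1) (ratr pq.2) L].
pose K (pq : rat * rat) : set 'rV[R]_2 :=
  [set x | good pq /\ (gamma @` [set t | ratr pq.1 <= t <= ratr pq.2]) x].
have cK pq : closed (K pq).
  have [gd|ngd] := pselect (good pq); last first.
    have -> : K pq = set0 by apply/seteqP; split=> // x [].
    exact: closed0.
  have -> : K pq = gamma @` `[ratr pq.1, ratr pq.2]%classic.
    apply/seteqP; split=> [x [_ [t h <-]]|x [t h <-]].
      by exists t => //=; rewrite in_itv.
    by split=> //; exists t => //; move: h; rewrite /= in_itv.
  apply: compact_closed; first exact: norm_hausdorff.
  apply: continuous_compact; last exact: segment_compact.
  apply: continuous_in_subspaceT => t; rewrite inE /= in_itv /= => ht.
  by have [_ sJ _] := gd; apply: differentiable_continuous; exact: (cg.1 _ (sJ _ ht)).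
have dK pq : dense (~` K pq).
  move=> O O0 oO; apply/set0P/negP => /eqP e.
  have sK : O `<=` K pq.
    move=> x Ox; apply: contrapT => nK.
    by have : (O `&` ~` K pq) x by []; rewrite e.
  have [x Ox] := O0; have [[lt _ [L lip]] _] := sK x Ox.
  apply: (lipschitz_image_no_interior lt lip oO O0) => y /sK[].
  by [].
pose Fk i := if unpickle i is Some pq then ~` K pq else setT.
have [] := @Baire R 'rV[R]_2 Fk _ U U0 oU.
  move=> i; rewrite /Fk; case: unpickle => [pq|]; last first.
    by split; [exact: openT|move=> O [x Ox] _; exists x].
  by split; [rewrite openC|exact: dK].
move=> x [/sub[t Jt tx] Fx].
have [p [q [/andP[pt tq] sJ lip]]] := Ck1_lipschitz oJ cg Jt.
have := Fx (pickle (p, q)) I; rewrite /Fk pickleK; apply.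
split; last by exists t => //=; rewrite !ltW.
by split=> //=; exact: lt_trans tq.
Qed.

End CurveImage.

(** * Rotation hypersurfaces *)

(** Polarisation: T preserves the squares of q - 0 and of q - p, and fixes 0 and p. Linearity of T
    is never invoked. *)
Lemma fixing_isometry_ip {R : realType} (eps : R) (P2 : {vspace 'rV[R]_5}) T q p :
  fixing_isometry eps P2 T -> p \in P2 -> ip eps (T q) p = ip eps q p.
Proof.
move=> [_ iso fix_] pP; have T0 : T 0 = 0 by apply: fix_; exact: mem0v.
have := iso q 0; rewrite T0 !subr0 => e1.
have := iso q p; rewrite (fix_ p pP) !(ipDl, ipDr, ipNl, ipNr) e1.
rewrite (ipC eps p) (ipC eps p q).
move: (ip eps q q) (ip eps p p) (ip eps (T q) p) (ip eps q p) => *; lra.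
Qed.

(** By dimension the axis contains a vector off the line of [dt]; subtracting its vertical part
    keeps it in [P2] and nonzero. *)
Lemma horizontal_axis {R : realType} (P2 : {vspace 'rV[R]_5}) : \dim P2 = 2%N -> dt \in P2 ->
  exists2 p : 'rV[R]_4, p != 0 & toE5 p 0 \in P2.
Proof.
move=> d2 dtP.
have [q qP qdt] : exists2 q, q \in P2 & q \notin <[dt : 'rV[R]_5]>%VS.
  apply/subvPn; apply/negP => /dimvS; rewrite d2 dim_vline; by case: (_ != 0).
have qE : q = toE5 (horizontal q) (q 0 ord_max).
  apply/rowP => i; case: (@split_ordP 4 1 i) => j ->.
    by rewrite toE5El mxE.
  by rewrite toE5Er ord1; congr (q 0 _); exact: val_inj.
exists (horizontal q).
  apply: contraNneq qdt => h0; rewrite qE h0.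
  by apply/vlineP; exists (q 0 ord_max); rewrite toE5E /embed toE50 add0r.
have -> : toE5 (horizontal q) 0 = q - q 0 ord_max *: dt.
  by rewrite {2}qE [in RHS]toE5E addrK.
by rewrite memvB // memvZ.
Qed.

Lemma positive_derivative_sign {R : realType} (f : R -> R^o) (m : R) :
  is_derive (0 : R) (1 : R) f m -> 0 < m -> exists2 r : R, 0 < r & forall h, 0 < h < r ->
    f (- h) < f 0 < f h.
Proof.
move=> [df <-] m0; move: df m0; rewrite /derivable /derive => df m0.
have /cvgrPdist_lt/(_ _ m0) := df.
move=> /nbhs_ballP[r /= r0 H]; exists r => // h /andP[h0 hr].
have sgn k : k != 0 -> `|k| < r -> 0 < k^-1 * (f k - f 0).
  move=> k0 kr; have := H k; rewrite /ball /= sub0r normrN => /(_ kr k0).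
  rewrite addr0 [k *: _]mulr1 /GRing.scale /= ltr_norml => /andP[_].
  set l := lim _; set z := k^-1 * _; lra.
have h1 := sgn h; have h2 := sgn (- h).
rewrite normrN oppr_eq0 invrN mulNr in h2.
have hn : h != 0 by rewrite gt_eqF.
have ha : `|h| < r by rewrite gtr0_norm.
have {}h1 := h1 hn ha; have {}h2 := h2 hn ha.
have hi : 0 < h^-1 by rewrite invr_gt0.
move: h1; rewrite pmulr_rgt0 // subr_gt0 => ->.
by move: h2; rewrite oppr_gt0 pmulr_rlt0 // subr_lt0 => ->.
Qed.

(** * Height functions over a fixed direction *)

Section Rectangle.
Context {R : realType} (eps : R) (heps : eps = 1 \/ eps = -1).
Variables (D : set 'rV[R]_2) (g nu : 'rV[R]_2 -> 'rV[R]_4) (I : set R) (B : R).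
Hypothesis oD : open D.
Hypothesis oI : open I.
Hypothesis sg : smooth D g.
Hypothesis sn : smooth D nu.
Hypothesis B0 : 0 < B.
Variable (p : 'rV[R]_4) (Z : set 'rV[R]_2).
Local Notation "<< u , v >>" := (ip eps u v).
(** In the application [Z] is the plane curve traced by the products of the profile curve with [dt]
    and with the horizontal axis vector. *)
Hypothesis ZP : forall w s (z : 'rV[R]_2), D w -> I s -> z 0 0 = B * s ->
  z 0 1 = <<Ceps eps s *: g w + Seps eps s *: nu w, p>> -> Z z.
Hypothesis Z0 : forall U, open U -> U !=set0 -> ~ U `<=` Z.

Lemma continuous_Ceps s : {for s, continuous (Ceps eps : R -> R^o)}.
Proof.
by apply: differentiable_continuous; apply/derivable1_diffP; case: (is_derive_Ceps heps s).
Qed.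

Lemma continuous_Seps s : {for s, continuous (Seps eps : R -> R^o)}.
Proof.
by apply: differentiable_continuous; apply/derivable1_diffP; case: (is_derive_Seps heps s).
Qed.

(* If the derivative along the surface is nonzero at [s], then by the
   intermediate value theorem a common interval of values is taken for all s'
   near [s], and [Z] contains a rectangle. *)
Lemma height_stationary u v s : D u -> I s ->
  <<parallel_derive g nu (Ceps eps s) (Seps eps s) u v, p>> = 0.
Proof.
move=> Du Is.
suff npos w : ~ 0 < <<parallel_derive g nu (Ceps eps s) (Seps eps s) u w, p>>.
  have := npos v; have := npos (- v).
  have -> : parallel_derive g nu (Ceps eps s) (Seps eps s) u (- v)
      = - parallel_derive g nu (Ceps eps s) (Seps eps s) u v.
    have dN (f : 'rV[R]_2 -> 'rV[R]_4) : differentiable f u -> 'D_(- v) f u = - 'D_v f u.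
      by move=> df; rewrite !deriveE // linearN.
    by rewrite /parallel_derive (dN _ (differentiable_surface sg Du)) (dN _ (differentiable_normal sn Du)) !scalerN -opprD.
  rewrite ipNl oppr_gt0 => /negP h1 /negP h2; apply/eqP; rewrite eq_le.
  by rewrite !leNgt h1 h2.
move=> m0.
pose psi (t s : R) : R^o := <<Ceps eps s *: g (u + t *: w) + Seps eps s *: nu (u + t *: w), p>>.
pose h (y : 'rV[R]_2) : R^o := <<Ceps eps s *: g y + Seps eps s *: nu y, p>>.
have psiE t s' : psi t s' = Ceps eps s' * <<g (u + t *: w), p>> + Seps eps s' * <<nu (u + t *: w), p>>.
  by rewrite /psi ipDl !ipZl.
have dh y c c' : D y -> differentiable (fun y => <<c *: g y + c' *: nu y, p>> : R^o) y
    /\ 'D_w (fun y => <<c *: g y + c' *: nu y, p>> : R^o) y = <<parallel_derive g nu c c' y w, p>>.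
  move=> Dy; have dgy := differentiable_surface sg Dy; have dny := differentiable_normal sn Dy.
  have d1 : differentiable (c \*: g) y by exact: differentiableZ.
  have d2 : differentiable (c' \*: nu) y by exact: differentiableZ.
  have d12 : differentiable ((c \*: g) + (c' \*: nu)) y by exact: differentiableD.
  have dp : differentiable (cst p : 'rV[R]_2 -> 'rV[R]_4) y by exact: differentiable_cst.
  split; first exact: (differentiable_ip eps d12 dp).
  refine (etrans (derive_ip eps w d12 dp) _).
  rewrite derive_cst ip0r addr0; congr (<<_, _>>).
  refine (etrans (deriveD (v := w) (diff_derivable d1) (diff_derivable d2)) _).
  by congr (_ + _); apply: deriveZ; exact: diff_derivable.
have cline : continuous (fun t : R => u + t *: w).
  by move=> t; apply: cvgD; [exact: cvg_cst|exact: scalel_continuous].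
have nD : \forall t \near (0 : R), D (u + t *: w).
  apply: cline; rewrite scale0r addr0; exact: open_nbhs_nbhs.
have [r1 /= r10 Hr1] : exists2 r : R, 0 < r & forall t, `|t| < r -> D (u + t *: w).
  have /nbhs_ballP[r /= r0 H] := nD; exists r => // t tr.
  by apply: H; rewrite /ball /= sub0r normrN.
have dpsi : is_derive (0 : R) (1 : R) (psi ^~ s) <<parallel_derive g nu (Ceps eps s) (Seps eps s) u w, p>>.
  have D0 : D (u + 0 *: w) by rewrite scale0r addr0.
  have [dd e] := dh _ (Ceps eps s) (Seps eps s) D0.
  have := is_derive_line (diff_derivable (v := w) dd); rewrite e.
  by rewrite scale0r addr0.
have [r2 r20 Hr2] := positive_derivative_sign dpsi m0.
pose t := Num.min r1 r2 / 2.
have rm : 0 < Num.min r1 r2 by rewrite lt_min r10.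
have t0 : 0 < t by rewrite divr_gt0.
have tm : t < Num.min r1 r2 by rewrite ltr_pdivrMr // ltr_pMr // ltr1n.
have tr1 : t < r1 by apply: (lt_le_trans tm); rewrite ge_min lexx.
have tr2 : 0 < t < r2 by rewrite t0; apply: (lt_le_trans tm); rewrite ge_min lexx orbT.
have /andP[p1 p2] := Hr2 t tr2.
have inD x : - t <= x <= t -> D (u + x *: w).
  by move=> xt; apply: Hr1; apply: le_lt_trans tr1; rewrite ler_norml.
set y0 := psi 0 s in p1 p2.
(* Half of the smaller gap: if both end values move by less than e as s changes, they still enclose
   (y0 - e, y0 + e). *)
pose e := Num.min (y0 - psi (- t) s) (psi t s - y0) / 2.
have e0 : 0 < e by rewrite divr_gt0 // lt_min !subr_gt0 p1.
have ele : 2 * e <= y0 - psi (- t) s /\ 2 * e <= psi t s - y0.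
  by rewrite /e mulrC divfK // ?pnatr_eq0 //; split; rewrite ge_min lexx ?orbT.
have cs x : {for s, continuous (psi x : R -> R^o)}.
  have -> : psi x = fun s => Ceps eps s * <<g (u + x *: w), p>> + Seps eps s * <<nu (u + x *: w), p>>.
    by apply: funext => s'; rewrite psiE.
  apply: cvgD; apply: cvgM; [exact: continuous_Ceps|exact: cvg_cst|exact: continuous_Seps|exact: cvg_cst].
have near_s : \forall s' \near s, I s' /\ `|psi (- t) s - psi (- t) s'| < e /\ `|psi t s - psi t s'| < e.
  have n1 : nbhs s I by exact: open_nbhs_nbhs.
  have /cvgrPdist_lt/(_ e e0) n2 := cs (- t).
  have /cvgrPdist_lt/(_ e e0) n3 := cs t.
  by apply: filterS3 n1 n2 n3 => s'.
have /nbhs_ballP[dl /= dl0 Hdl] := near_s.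
pose z0 : 'rV[R]_2 := \row_k (if k == 0 then B * s else y0).
(* A point z of this ball has first coordinate B s' with |s' - s| < dl, and second coordinate within
   e of y0, so the intermediate value theorem reaches it at the parameter s'. *)
pose rho := Num.min (dl * B) e.
have rho0 : 0 < rho by rewrite lt_min mulr_gt0.
apply: (@Z0 (ball z0 rho)); [exact: ball_open|by exists z0; exact: ballxx|].
move=> z [_ Hz].
have hz0 : `|B * s - z 0 0| < dl * B.
  have := Hz 0 0; rewrite /ball /= mxE eqxx => /lt_le_trans; apply.
  by rewrite ge_min lexx.
have hz1 : `|y0 - z 0 1| < e.
  have := Hz 0 1; rewrite /ball /= mxE /= => /lt_le_trans; apply.
  by rewrite ge_min lexx orbT.
pose s' := z 0 0 / B.
have zB : z 0 0 = B * s' by rewrite /s' mulrC divfK // gt_eqF.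
have : ball s dl s'.
  rewrite /ball /=; move: hz0; rewrite zB -mulrBr normrM (gtr0_norm B0) mulrC.
  by rewrite ltr_pM2r.
move=> /Hdl[Is' [q1 q2]].
move: q1 q2 hz1; rewrite !ltr_norml => /andP[q1 q1'] /andP[q2 q2'] /andP[q3 q3'].
have l1 : psi (- t) s' <= z 0 1 by lra.
have l2 : z 0 1 <= psi t s' by lra.
have tt : - t <= t by lra.
have [] := @IVT R (psi ^~ s') (- t) t (z 0 1) tt.
- apply: derivable_within_continuous => x; rewrite in_itv /= => xt.
  have [dd _] := dh _ (Ceps eps s') (Seps eps s') (inD x xt).
  by have [] := is_derive_line (diff_derivable (v := w) dd).
- by rewrite ge_min le_max l1 l2 orbT.
move=> x; rewrite in_itv /= => xt xe.
exact: (ZP (inD x xt) Is' zB (esym xe)).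
Qed.

End Rectangle.

(** * Surfaces stationary in a fixed direction *)

Section Umbilic.
Context {R : realType} (eps : R) (heps : eps = 1 \/ eps = -1).
Local Notation "<< u , v >>" := (ip eps u v).
Variables (D : set 'rV[R]_2) (g nu : 'rV[R]_2 -> 'rV[R]_4) (p : 'rV[R]_4).
Hypothesis oD : open D.
Hypothesis sg : smooth D g.
Hypothesis sn : smooth D nu.
Hypothesis gg : forall u, D u -> <<g u, g u>> = eps.
Hypothesis nn : forall u, D u -> <<nu u, nu u>> = 1.
Hypothesis ng : forall u, D u -> <<nu u, g u>> = 0.
Hypothesis nT : forall u v, D u -> <<nu u, 'D_v g u>> = 0.
Hypothesis injg : forall u v, D u -> 'D_v g u = 0 -> v = 0.
Hypothesis p0 : p != 0.
Hypothesis pg : forall u v, D u -> <<'D_v g u, p>> = 0.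
Hypothesis pn : forall u v, D u -> <<'D_v nu u, p>> = 0.

(* The constant vector [p] stays in the span of [g] and [nu]; differentiating
   p = eps <p, g> g + <p, nu> nu shows that the surface is umbilical. *)
Lemma derive_axis u v : D u ->
  (eps * <<p, g u>>) *: 'D_v g u + <<p, nu u>> *: 'D_v nu u = 0.
Proof.
move=> Du.
have pE w : D w -> p = (eps * <<p, g w>>) *: g w + <<p, nu w>> *: nu w.
  move=> Dw; have gn : <<g w, nu w>> = 0 by rewrite ipC ng.
  have P1 i : <<partial g i w, g w>> = 0 by exact: (derive_g_g oD sg gg).
  have P2 i : <<partial g i w, nu w>> = 0 by rewrite ipC; exact: nT.
  have fr (c : 'rV[R]_2) : \sum_i c 0 i *: partial g i w = 0 -> c = 0.
    by rewrite -(derive_partial c (differentiable_surface sg Dw)); exact: injg.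
  apply: (frame_expansion heps (gg Dw) (nn Dw) gn P1 P2 fr) => i.
  by rewrite ipC; exact: pg.
have dgu := differentiable_surface sg Du; have dnu' := differentiable_normal sn Du.
have dp : differentiable (cst p : 'rV[R]_2 -> 'rV[R]_4) u by exact: differentiable_cst.
have d1 : differentiable (fun w => <<p, g w>> : R^o) u := differentiable_ip eps dp dgu.
have d2 : differentiable (fun w => <<p, nu w>> : R^o) u := differentiable_ip eps dp dnu'.
have D1 : 'D_v (fun w => <<p, g w>> : R^o) u = 0.
  refine (etrans (derive_ip eps v dp dgu) _).
  by rewrite derive_cst ip0l add0r ipC pg.
have D2 : 'D_v (fun w => <<p, nu w>> : R^o) u = 0.
  refine (etrans (derive_ip eps v dp dnu') _).
  by rewrite derive_cst ip0l add0r ipC pn.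
have d1' : differentiable (fun w => eps * <<p, g w>> : R^o) u by exact: differentiableZ.
have D1' : 'D_v (fun w => eps * <<p, g w>> : R^o) u = 0.
  refine (etrans (deriveZ eps (diff_derivable (v := v) d1)) _).
  by rewrite D1 scaler0.
have e1 := derive_scale v d1' dgu; have e2 := derive_scale v d2 dnu'.
have s1 := differentiable_scale d1' dgu; have s2 := differentiable_scale d2 dnu'.
have : 'D_v (cst p : 'rV[R]_2 -> 'rV[R]_4) u = 'D_v
    ((fun w => (eps * <<p, g w>>) *: g w) + (fun w => <<p, nu w>> *: nu w)) u.
  by apply: near_eq_derive; apply: (open_eq_near oD Du) => w Dw; exact: pE.
rewrite derive_cst => e; apply/esym; refine (etrans e _).
refine (etrans (deriveD (diff_derivable (v := v) s1) (diff_derivable (v := v) s2)) _).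
refine (etrans (congr2 +%R e1 e2) _).
have aux (x y : R) (a b c d : 'rV[R]_4) :
    x = 0 -> y = 0 -> (x *: a + b) + (y *: c + d) = b + d.
  by move=> -> ->; rewrite !scale0r !add0r.
exact: aux D1' D2.
Qed.

(** If <p, nu> = 0, then either <p, g> = 0 as well and p is orthogonal to a whole frame, so p = 0,
    or [derive_axis] forces dg = 0. *)
Lemma axis_normal_neq0 u : D u -> <<p, nu u>> != 0.
Proof.
move=> Du; apply/eqP => b0.
have P1 i : <<partial g i u, g u>> = 0 by exact: (derive_g_g oD sg gg).
have P2 i : <<partial g i u, nu u>> = 0 by rewrite ipC; exact: nT.
have [pg0|pg0] := eqVneq <<p, g u>> 0.
  move/eqP: p0; apply; have gn : <<g u, nu u>> = 0 by rewrite ipC ng.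
  have fr (c : 'rV[R]_2) : \sum_i c 0 i *: partial g i u = 0 -> c = 0.
    by rewrite -(derive_partial c (differentiable_surface sg Du)); exact: injg.
  apply: (frame_perp heps (gg Du) (nn Du) gn P1 P2 fr) => // i.
  by rewrite ipC; exact: pg.
have := derive_axis (delta_mx 0 0) Du; rewrite b0 scale0r addr0 => /eqP.
rewrite scaler_eq0 mulf_eq0 (negPf (eps_neq0 heps)) (negPf pg0) /= => /eqP.
by move=> /(injg Du)/rowP/(_ 0)/eqP; rewrite !mxE oner_eq0.
Qed.

Lemma derive_normal_axis u v : D u ->
  'D_v nu u = - (eps * <<p, g u>> / <<p, nu u>>) *: 'D_v g u.
Proof.
move=> Du; have b0 := axis_normal_neq0 Du.
have /eqP := derive_axis v Du; rewrite addrC addr_eq0 => /eqP e.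
have -> : 'D_v nu u = <<p, nu u>>^-1 *: (<<p, nu u>> *: 'D_v nu u).
  by rewrite scalerA mulVf // scale1r.
by rewrite e scalerN scalerA mulrC scaleNr.
Qed.

Hypothesis flat : forall u v w, D u -> row_free (col_mx v w) ->
  sectional_curvature (gram eps g) u v w = 0.

(** The Weingarten matrix is a multiple l of the identity, so its determinant gives l^2 = - eps,
    impossible for eps = 1. *)
Lemma axis_eps u : D u -> eps = -1.
Proof.
move=> Du; case: heps => // e1; exfalso.
set l := - (eps * <<p, g u>> / <<p, nu u>>).
have na : partial nu 0 u = l *: partial g 0 u + 0 *: partial g 1 u.
  by rewrite scale0r addr0; exact: derive_normal_axis.
have nb : partial nu 1 u = 0 *: partial g 0 u + l *: partial g 1 u.
  by rewrite scale0r add0r; exact: derive_normal_axis.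
have W0 := wedge_frame_gt0 heps oD sg gg injg Du.
have h := flat_plane W0 na nb (flat_frame heps oD sg sn gg nn ng nT injg flat Du).
have : 0 <= l * l by rewrite -expr2 sqr_ge0.
have -> : l * l = - eps by rewrite -h mul0r subr0.
by rewrite e1 oppr_ge0 ler10.
Qed.

End Umbilic.

Section Nonrotational.
Context {R : realType} (eps : R) (heps : eps = 1 \/ eps = -1).
Context {M : topologicalType} (A : set (chart R M 2)) (g N : M -> 'rV[R]_4).
Variables (V : set M) (I : set R) (B : R).
Local Notation "<< u , v >>" := (ip eps u v).
Hypothesis fs : flat_surface eps A g N.
Hypothesis ad : admissible eps A g N V I.
Hypothesis B0 : 0 < B.

(** Supplies the second parameter, besides s = 0, that isolates <dN, p> = 0. The bound 1 in the
    minimum keeps s below pi. *)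
Lemma interval_Seps_neq0 : exists2 s, I s & Seps eps s != 0.
Proof.
have [_ oI _ I0 _] := ad.
have /nbhs_ballP[r /= r0 Hr] := open_nbhs_nbhs (conj oI I0).
pose s := Num.min r 1 / 2.
have m0 : 0 < Num.min r 1 by rewrite lt_min r0 ltr01.
have s0 : 0 < s by rewrite divr_gt0.
have sm : s < Num.min r 1 by rewrite ltr_pdivrMr // ltr_pMr // ltr1n.
exists s.
  apply: Hr; rewrite /ball /= sub0r normrN gtr0_norm //.
  by apply: (lt_le_trans sm); rewrite ge_min lexx.
rewrite /Seps; case: heps => e; rewrite e ?eqxx ?N1_neq1.
  apply: lt0r_neq0; apply: sin_gt0_pi; rewrite s0 /=.
  apply: (lt_le_trans sm); rewrite ge_min; apply/orP; right.
  by apply: le_trans (pi_ge2 R); rewrite ler1n.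
apply: mulf_neq0; last by rewrite invr_eq0 pnatr_eq0.
by apply/eqP => /sinh_eq0 h; move: s0; rewrite h ltxx.
Qed.

Lemma hypersurface_nonrotational : V !=set0 ->
  (eps = -1 -> ~ totally_umbilical eps A g N V) ->
  nonrotational eps (hypersurface eps g N B @` (V `*` I)).
Proof.
move=> [x0 Vx0] numb S' [P3 [P2 [J [alpha [[d3 _ _] [d2 _ dtP] [oJ _ sa _ _] ->]]]]] sub.
have [p p0 pP] := horizontal_axis d2 dtP.
(* Both coordinates are products with vectors of the axis, so [fixing_isometry_ip] makes them
   constant on each orbit: every point of the rotation hypersurface has the coordinates of its point
   on the profile curve. *)
pose gamma (t : R) : 'rV[R]_2 :=
  \row_k (if k == 0 then <<alpha t, dt>> else <<alpha t, toE5 p 0>>).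
have cgamma : Ck 1 J (gamma : R^o -> _).
  apply: (Ck_row oJ) => k; have [->|->] := ord2P k.
    under eq_fun do rewrite mxE eqxx.
    by apply: Ck_ip; [exact: oJ|exact: sa|exact: Ck_cst].
  under eq_fun do rewrite mxE /=.
  by apply: Ck_ip; [exact: oJ|exact: sa|exact: Ck_cst].
have img x s (z : 'rV[R]_2) : V x -> I s -> z 0 0 = B * s ->
    z 0 1 = <<parallel_surface eps g N s x, p>> -> (gamma @` J) z.
  move=> Vx Is z0 z1.
  have [_ [T [tau [isoT Jtau fE]]]] : [set q | Q3xR eps q /\ exists T tau,
     [/\ fixing_isometry eps P2 T, J tau & q = T (alpha tau)]] (hypersurface eps g N B (x, s)).
    by apply: sub; exists (x, s).
  exists tau => //; apply/rowP => k; rewrite mxE.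
  rewrite -(fixing_isometry_ip _ isoT dtP) -(fixing_isometry_ip _ isoT pP) -fE.
  rewrite /hypersurface /= -toE5E dtE !ip_toE5 ip0r mulr1 mulr0 add0r addr0.
  by have [->|->] := ord2P k; rewrite ?z0 ?z1.
have noint U : open U -> U !=set0 -> ~ U `<=` gamma @` J.
  exact: curve_image_no_interior.
have perp phi (Aphi : A phi) u v s :
    (chart_map phi @` (chart_dom phi `&` V)) u -> I s ->
    <<parallel_derive (g \o chart_inv phi) (N \o chart_inv phi) (Ceps eps s) (Seps eps s) u v, p>> = 0.
  have [_ oI _ _ _] := ad.
  apply: (height_stationary heps (chart_open fs ad Aphi) oI (chart_smooth_g V fs Aphi)
    (chart_smooth_n V fs Aphi) B0 _ noint) => w s' z Dw Is' z0 z1.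
  exact: (img (chart_inv phi w) s' z (chart_inv_in fs Aphi Dw) Is' z0 z1).
have pg phi (Aphi : A phi) u v : (chart_map phi @` (chart_dom phi `&` V)) u ->
    <<'D_v (g \o chart_inv phi) u, p>> = 0.
  have [_ _ _ I0 _] := ad.
  move=> Du; have := perp phi Aphi u v 0 Du I0.
  by rewrite /parallel_derive Ceps0 Seps0 scale1r scale0r addr0.
have pn phi (Aphi : A phi) u v : (chart_map phi @` (chart_dom phi `&` V)) u ->
    <<'D_v (N \o chart_inv phi) u, p>> = 0.
  move=> Du; have [s Is s0] := interval_Seps_neq0.
  have := perp phi Aphi u v s Du Is.
  rewrite /parallel_derive ipDl !ipZl (pg phi Aphi) // mulr0 add0r => /eqP.
  by rewrite mulf_eq0 (negPf s0) => /eqP.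
have inD (phi : chart R M 2) x : chart_dom phi x -> V x ->
    (chart_map phi @` (chart_dom phi `&` V)) (chart_map phi x) by exists x.
have em1 : eps = -1.
  have [[_ _ [_ cov _]] _ _ _ _ _ _ _] := fs.
  have [phi Aphi dx] := cov x0.
  exact: (axis_eps heps (chart_open fs ad Aphi) (chart_smooth_g V fs Aphi)
    (chart_smooth_n V fs Aphi) (@chart_gg _ _ _ _ _ _ V fs phi)
    (@chart_nn _ _ _ _ _ _ V fs phi) (@chart_ng _ _ _ _ _ _ V fs phi)
    (@chart_nT _ _ _ _ _ _ V fs phi Aphi) (@chart_injg _ _ _ _ _ _ V fs phi Aphi) p0
    (pg phi Aphi) (pn phi Aphi) (@chart_flat _ _ _ _ _ _ V fs phi Aphi) (inD phi x0 dx Vx0)).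
apply: (numb em1) => x lambda mu Vx.
(* The value depends on the point alone, neither on the chart nor on the eigenvector, which is
   umbilicity. *)
have pcE l : principal_curvature eps A g N x l -> l = eps * <<p, g x>> / <<p, N x>>.
  move=> [phi [Aphi dx /eigenvalueP[v ev v0]]].
  have Du := inD phi x dx Vx.
  have := (chart_eigenP heps fs ad Aphi v l Du).1 ev.
  rewrite (derive_normal_axis heps (chart_open fs ad Aphi) (chart_smooth_g V fs Aphi)
    (chart_smooth_n V fs Aphi) (@chart_gg _ _ _ _ _ _ V fs phi)
    (@chart_nn _ _ _ _ _ _ V fs phi) (@chart_ng _ _ _ _ _ _ V fs phi)
    (@chart_nT _ _ _ _ _ _ V fs phi Aphi) (@chart_injg _ _ _ _ _ _ V fs phi Aphi) p0
    (pg phi Aphi) (pn phi Aphi) v Du).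
  have [_ _ K _ _] := chart_is_chart fs Aphi.
  rewrite /= K // => /eqP; rewrite -subr_eq0 -scalerBl scaler_eq0 => /orP[|/eqP d0].
    by rewrite opprK addrC subr_eq0 => /eqP.
  by have := @chart_injg _ _ _ _ _ _ V fs phi Aphi _ v Du d0; move/eqP: v0.
by move=> /pcE -> /pcE ->.
Qed.

End Nonrotational.

(** * Flat tori and equidistant cylinders *)

(** The base consists of balls with rational centre and rational radius. *)
Lemma row_second_countable (R : realType) n : @second_countable 'rV[R]_n.
Proof.
pose b (cr : 'rV[rat]_n * rat) : set 'rV[R]_n := ball (map_mx (@ratr R) cr.1 : 'rV[R]_n) (ratr cr.2).
exists (range b).
  exact: sub_countable (card_image_le b setT) (@countableP _ _).
split=> [_ [cr _ <-]|x]; first exact: ball_open.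
move=> U /nbhs_ballP[e /= e0 eU].
have [r /itvP hr] := rat_in_itvoo (divr_gt0 e0 (ltr0n R 2)).
have r0 : 0 < ratr r :> R by rewrite hr.
have r2 : ratr r < e / 2 by rewrite hr.
have q k : {q : rat | `|x 0 k - ratr q| < ratr r}.
  apply: cid; have lt : x 0 k - ratr r < x 0 k by rewrite ltrBlDr ltrDl.
  have [q /itvP hq] := rat_in_itvoo lt; exists q.
  have h1 : x 0 k - ratr r < ratr q by rewrite hq.
  have h2 : ratr q < x 0 k by rewrite hq.
  by rewrite ltr_norml; apply/andP; split; lra.
pose c : 'rV[rat]_n := \row_k sval (q k).
have cx k : `|x 0 k - ratr (c 0 k)| < ratr r by rewrite mxE; exact: svalP (q k).
exists (b (c, r)); first split.
- by exists (c, r).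
- split=> // i k; rewrite ord1 mxE /ball /= distrC; exact: cx.
move=> y [_ Hy]; apply: eU; split=> // i k; rewrite ord1.
have hy : `|ratr (c 0 k) - y 0 k| < ratr r by have := Hy 0 k; rewrite mxE.
move: hy (cx k); rewrite /ball /= !ltr_norml => /andP[a1 a2] /andP[a3 a4].
by apply/andP; split; lra.
Qed.

Lemma constant_metric_flat {R : realType} {n : nat} (K : 'M[R]_n) u v w :
  sectional_curvature (fun=> K) u v w = 0.
Proof.
have c0 k i j : christoffel (fun=> K) k i j = fun=> 0.
  apply: funext => x; rewrite /christoffel /partial big1 ?mulr0 // => l _.
  by rewrite !derive_cst; ring.
have r0 i j k l : riemann (fun=> K) i j k l u = 0.
  rewrite /riemann !c0 /partial !derive_cst big1 ?subrr ?addr0 // => m _.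
  by rewrite !c0 !mul0r subrr.
rewrite /sectional_curvature big1 ?mul0r // => i _.
rewrite big1 // => j _; rewrite big1 // => k _; rewrite big1 // => l _.
by rewrite big1 // => m _; rewrite r0 mulr0 mul0r.
Qed.

Section CoordinateForm.
Context {R : realType} {n : nat} (i : 'I_n).
Definition coordinate (u : 'rV[R]_n) : R^o := u 0 i.
Fact coordinate_is_linear : linear coordinate.
Proof. by move=> a u v; rewrite /coordinate !mxE. Qed.
HB.instance Definition _ := GRing.isLinear.Build R 'rV[R]_n R^o _ coordinate coordinate_is_linear.
End CoordinateForm.

Section Circle.
Context {R : realType} (e : R) (he : e = 1 \/ e = -1) {n d : nat}.
Variables (i : 'I_n) (a b : 'rV[R]_d).

(** The sign [e] is separate from that of the ambient form: the torus uses [e] = eps for one factor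
    and [e] = 1 for the other. [circle'] is the derivative in the i-th coordinate. *)
Definition circle (u : 'rV[R]_n) := Ceps e (u 0 i) *: a + Seps e (u 0 i) *: b.
Definition circle' (u : 'rV[R]_n) := (- e * Seps e (u 0 i)) *: a + Ceps e (u 0 i) *: b.

Lemma Ck_circle k : Ck k setT circle.
Proof.
have cl : continuous (coordinate i : 'rV[R]_n -> R^o) by exact: linear_row_continuous.
have [h1 h2] := Ck_oscillator cl (is_derive_Ceps he) (is_derive_Seps he) k openT.
by apply: CkD; [exact: openT|exact: (CkZl a openT h1)|exact: (CkZl b openT h2)].
Qed.

Lemma derive_circle u v : 'D_v circle u = v 0 i *: circle' u.
Proof.
have cl : continuous (coordinate i : 'rV[R]_n -> R^o) by exact: linear_row_continuous.
have [d1 e1] := derive_comp_lin (l := coordinate i) cl v (is_derive_Ceps he (u 0 i)).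
have [d2 e2] := derive_comp_lin (l := coordinate i) cl v (is_derive_Seps he (u 0 i)).
have z1 : differentiable (fun u : 'rV[R]_n => (Ceps e \o coordinate i) u *: a) u.
  exact: differentiableZl.
have z2 : differentiable (fun u : 'rV[R]_n => (Seps e \o coordinate i) u *: b) u.
  exact: differentiableZl.
refine (etrans (deriveD (diff_derivable (v := v) z1) (diff_derivable (v := v) z2)) _).
refine (etrans (congr2 +%R (derive_Zl a v d1) (derive_Zl b v d2)) _).
have e1' : 'D_v (Ceps e \o coordinate i) u = - e * Seps e (u 0 i) * v 0 i := e1.
have e2' : 'D_v (Seps e \o coordinate i) u = Ceps e (u 0 i) * v 0 i := e2.
rewrite e1' e2' /circle'; move: (Ceps _ _) (Seps _ _) (v 0 i) => c s t.
by apply/rowP => k; rewrite !mxE; ring.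
Qed.

End Circle.

Lemma ip_lin2 {R : realType} (eps : R) d (p q p' q' : R) (a b a' b' : 'rV[R]_d) :
  ip eps (p *: a + q *: b) (p' *: a' + q' *: b') = p * p' * ip eps a a'
    + p * q' * ip eps a b' + q * p' * ip eps b a' + q * q' * ip eps b b'.
Proof. by rewrite !(ipDl, ipDr, ipZl, ipZr); ring. Qed.

(* The surface is g = C_eps(r) X + S_eps(r) Y with normal dg/dr, where X is an
   eps-circle in the (x_1, x_2)-plane and Y a circle in the (x_3, x_4)-plane.
   It is a Clifford torus for eps = 1 and an equidistant cylinder about a
   geodesic for eps = -1. *)
Section Torus.
Context {R : realType} (eps : R) (heps : eps = 1 \/ eps = -1).
Local Notation "<< u , v >>" := (ip eps u v).
Let E k : 'rV[R]_4 := delta_mx 0 k.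
Let X := circle (n := 2) eps 0 (E 0) (E 1).
Let X' := circle' (n := 2) eps 0 (E 0) (E 1).
Let Y := circle (n := 2) 1 1 (E 2%:R) (E 3%:R).
Let Y' := circle' (n := 2) 1 1 (E 2%:R) (E 3%:R).
(** For eps = 1 and 0 < r < pi / 2 the slice of U is (-r, pi / 2 - r), symmetric exactly for r = pi
    / 4. For eps = -1 it is (-r, +oo) for every r > 0. So (-r, r) is admissible in both cases. *)
Let r : R := pi / 4.
Let c := Ceps eps r.
Let s := Seps eps r.

Lemma ip_basis k l : <<E k, E l>> = (if k == l then if k == 0 then eps else 1 else 0).
Proof.
rewrite /ip (bigD1 k) //= !mxE !eqxx /= big1 => [|m mk].
  rewrite addr0 mul1r -(inj_eq val_inj k 0) /=.
  by case: (k == l); rewrite ?mulr1 ?mulr0.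
by rewrite !mxE eqxx /= (negPf mk) mul0r mulr0.
Qed.

Lemma ip_circle_X u : [/\ <<X u, X u>> = eps, <<X' u, X' u>> = 1 & <<X u, X' u>> = 0].
Proof.
rewrite /X /X' /circle /circle' !(ipDl, ipDr, ipZl, ipZr) !ip_basis /=.
have := CepsSeps heps (u 0 0); have := eps_sqr heps.
move: (Ceps eps _) (Seps eps _) => a b e2 ab; split; last by ring: e2.
- transitivity (eps * (a ^+ 2 + eps * b ^+ 2)); last by rewrite ab mulr1.
  ring: e2.
- transitivity (a ^+ 2 + eps * eps * eps * b ^+ 2); first by ring.
  by rewrite e2 mul1r.
Qed.

Lemma ip_circle_Y u : [/\ <<Y u, Y u>> = 1, <<Y' u, Y' u>> = 1 & <<Y u, Y' u>> = 0].
Proof.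
rewrite /Y /Y' /circle /circle' !(ipDl, ipDr, ipZl, ipZr) !ip_basis /=.
have := @CepsSeps R 1 (or_introl erefl) (u 0 1).
move: (Ceps 1 _) (Seps 1 _) => a b ab; split; last by ring.
- by rewrite -[RHS]ab; ring.
- by rewrite -[RHS]ab; ring.
Qed.

Lemma ip_circle_XY u : [/\ <<X u, Y u>> = 0, <<X' u, Y u>> = 0, <<X u, Y' u>> = 0
  & <<X' u, Y' u>> = 0].
Proof.
rewrite /X /X' /Y /Y' /circle /circle' !(ipDl, ipDr, ipZl, ipZr) !ip_basis /=.
by split; ring.
Qed.

(** The surface, its normal and their multiples all have this form, so the eigenvalue equation
    becomes a comparison of coefficients in [derive_torus_eq]. *)
Definition torus (p q : R) (u : 'rV[R]_2) : 'rV[R]_4 := p *: X u + q *: Y u.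

Lemma torus_smooth p q : smooth setT (torus p q).
Proof.
move=> k; apply: CkD; first exact: openT.
  apply: (CkZ (h := fun=> p)); [exact: openT|exact: Ck_cst|exact: Ck_circle].
apply: (CkZ (h := fun=> q)); [exact: openT|exact: Ck_cst|].
by apply: Ck_circle; left.
Qed.

Lemma derive_torus p q u v :
  'D_v (torus p q) u = (p * v 0 0) *: X' u + (q * v 0 1) *: Y' u.
Proof.
have dX : differentiable X u by apply: (Ck_circle heps 0 (E 0) (E 1) 1).1.
have dY : differentiable Y u.
  by apply: (Ck_circle (or_introl erefl) 1 (E 2%:R) (E 3%:R) 1).1.
have z1 : differentiable (p \*: X) u by exact: differentiableZ.
have z2 : differentiable (q \*: Y) u by exact: differentiableZ.
refine (etrans (deriveD (diff_derivable (v := v) z1) (diff_derivable (v := v) z2)) _).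
refine (etrans (congr2 +%R (deriveZ p (diff_derivable (v := v) dX))
  (deriveZ q (diff_derivable (v := v) dY))) _).
by rewrite (derive_circle heps) (derive_circle (or_introl erefl)) !scalerA.
Qed.

Lemma ip_torus p q p' q' u : <<torus p q u, torus p' q' u>> = eps * p * p' + q * q'.
Proof.
have [xx _ _] := ip_circle_X u; have [yy _ _] := ip_circle_Y u.
have [xy _ _ _] := ip_circle_XY u.
refine (etrans (ip_lin2 _ _ _ _ _ _ _ _ _) _).
rewrite xx yy [<<Y u, X u>>]ipC xy; ring.
Qed.

Lemma ip_derive_torus p q p' q' u v w :
  <<'D_v (torus p q) u, 'D_w (torus p' q') u>>
  = p * v 0 0 * (p' * w 0 0) + q * v 0 1 * (q' * w 0 1).
Proof.
rewrite !derive_torus.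
have [_ xx _] := ip_circle_X u; have [_ yy _] := ip_circle_Y u.
have [_ _ _ xy] := ip_circle_XY u.
refine (etrans (ip_lin2 _ _ _ _ _ _ _ _ _) _).
rewrite xx yy [<<Y' u, X' u>>]ipC xy; ring.
Qed.

Lemma ip_torus_derive p q p' q' u w : <<torus p q u, 'D_w (torus p' q') u>> = 0.
Proof.
rewrite derive_torus.
have [_ _ xx] := ip_circle_X u; have [_ _ yy] := ip_circle_Y u.
have [_ yx xy _] := ip_circle_XY u.
refine (etrans (ip_lin2 _ _ _ _ _ _ _ _ _) _).
rewrite xx yy [<<Y u, X' u>>]ipC xy yx; ring.
Qed.

Lemma derive_torus_eq p q p' q' u v : 'D_v (torus p q) u = 'D_v (torus p' q') u <->
  p * v 0 0 = p' * v 0 0 /\ q * v 0 1 = q' * v 0 1.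
Proof.
rewrite !derive_torus; split=> [e|[-> ->//]].
have [_ xx _] := ip_circle_X u; have [_ yy _] := ip_circle_Y u.
have [_ _ _ xy] := ip_circle_XY u.
have lin (w a b : 'rV[R]_4) (m n m' n' : R) : m *: a + n *: b = m' *: a + n' *: b ->
    m * <<w, a>> + n * <<w, b>> = m' * <<w, a>> + n' * <<w, b>>.
  by move=> /(congr1 (ip eps w)); rewrite !(ipDr, ipZr).
have := lin (X' u) _ _ _ _ _ _ e; have := lin (Y' u) _ _ _ _ _ _ e.
rewrite xx yy [<<Y' u, X' u>>]ipC xy.
by rewrite !mulr0 !mulr1 !addr0 !add0r.
Qed.

Lemma angle_gt0 : 0 < r. Proof. by rewrite divr_gt0 // pi_gt0. Qed.

Lemma Ceps_angle_gt0 : 0 < c.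
Proof.
rewrite /c /Ceps; case: ifP => _; last by rewrite divr_gt0 // addr_gt0 // expR_gt0.
have p0 := pi_gt0 R; apply: cos_gt0_pihalf; rewrite /r.
by apply/andP; split; lra.
Qed.

Lemma Seps_angle_gt0 : 0 < s.
Proof.
have p0 := pi_gt0 R; have r0 := angle_gt0.
rewrite /s /Seps; case: ifP => _.
  by apply: sin_gt0_pi; rewrite r0 /= /r; lra.
by rewrite divr_gt0 // subr_gt0 ltr_expR; lra.
Qed.

Let g := torus c s.
Let N := torus (- eps * s) c.
Let A : set (chart R 'rV[R]_2 2) := [set Chart setT id id].

Lemma id_smooth_atlas : smooth_atlas A.
Proof.
have im (D : set 'rV[R]_2) : id @` D = D by rewrite image_id.
split.
- move=> _ ->; split=> /=; [exact: openT|rewrite /chart_im /= im; exact: openT|by []| |].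
    by move=> x _; exact: cvg_id.
  by move=> x _; exact: cvg_id.
- by move=> x; exists (Chart setT id id).
move=> _ _ -> -> /= k; rewrite im setIT.
by apply: (@Ck_linear _ _ _ k setT idfun) => x; exact: cvg_id.
Qed.

Lemma torus_flat_surface : flat_surface eps A g N.
Proof.
have e2 := eps_sqr heps; have CS := CepsSeps heps r; have c0 := Ceps_angle_gt0; have s0 := Seps_angle_gt0.
split.
- by split; [exact: norm_hausdorff|exact: row_second_countable|exact: id_smooth_atlas].
- split=> [_ -> k|_ u -> _]; first exact: (sub_Ck (@subsetT _ _) (torus_smooth c s k)).
  apply: diff_inj; first exact: (torus_smooth c s 1).1.
  (* Zero is written as a derivative of [torus 0 0] so that [derive_torus_eq] applies. *)
  move=> v; rewrite -[0](_ : 'D_v (torus 0 0) u = 0); last first.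
    by rewrite derive_torus !mul0r !scale0r addr0.
  move=> /(derive_torus_eq _ _ _ _ _ _).1[]; rewrite !mul0r => /eqP + /eqP.
  rewrite !mulf_eq0 (gt_eqF c0) (gt_eqF s0) /= => /eqP v0 /eqP v1.
  by apply/rowP => k; rewrite mxE; have [->|->] := ord2P k.
- move=> u; split=> [|e].
    rewrite ip_torus; transitivity (eps * (c ^+ 2 + eps * s ^+ 2)); first by ring: e2.
    by rewrite CS mulr1.
  rewrite /g /torus /X /Y /circle !mxE /= !(mulr0n, mulr1n, mulr0, addr0, mulr1).
  apply: mulr_gt0; first exact: Ceps_angle_gt0.
  by rewrite /Ceps e N1_neq1 divr_gt0 // addr_gt0 // expR_gt0.
- move=> _ u v w -> _ _.
  (* In these coordinates the metric is c^2 du_0^2 + s^2 du_1^2 with constant c and s. *)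
  have -> : gram eps (g \o chart_inv (Chart setT id id))
      = fun=> gram eps g 0.
    have gE x i j : gram eps g x i j = c * (delta_mx 0 i : 'rV[R]_2) 0 0 *
        (c * (delta_mx 0 j : 'rV[R]_2) 0 0)
        + s * (delta_mx 0 i : 'rV[R]_2) 0 1 * (s * (delta_mx 0 j : 'rV[R]_2) 0 1).
      by rewrite [LHS]mxE; exact: ip_derive_torus.
    apply: funext => x; apply/matrixP => i j.
    exact: (etrans (gE x i j) (esym (gE 0 i j))).
  exact: constant_metric_flat.
- move=> _ -> k; exact: (sub_Ck (@subsetT _ _) (torus_smooth (- eps * s) c k)).
- move=> u; rewrite ip_torus; transitivity (c ^+ 2 + eps * eps * eps * s ^+ 2); first by ring.
  by rewrite e2 mul1r.
- by move=> u; rewrite ip_torus; ring: e2.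
- by move=> _ u v -> _; exact: ip_torus_derive.
Qed.

(** The coordinate directions are principal: dg has coefficients (c, s) and dN has coefficients
    (-eps s, c) on the same vectors X', Y'. *)
Lemma torus_curvatureP x lambda : principal_curvature eps A g N x lambda <->
  lambda * c = eps * s \/ lambda * s = - c.
Proof.
have c0 := Ceps_angle_gt0; have s0 := Seps_angle_gt0.
have gg u : setT u -> <<g u, g u>> = eps.
  by move=> _; exact: (flat_surface_in_Q3 torus_flat_surface u).1.
have nn u : setT u -> <<N u, N u>> = 1.
  by move=> _; exact: (flat_surface_normal_unit torus_flat_surface).
have ng u : setT u -> <<N u, g u>> = 0.
  by move=> _; exact: (flat_surface_normal_tangent_Q3 torus_flat_surface).
have nT u v : setT u -> <<N u, 'D_v g u>> = 0 by move=> _; exact: ip_torus_derive.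
have ij u v : setT u -> 'D_v g u = 0 -> v = 0.
  move=> _; apply: (immersion_chart (A := A) (phi := Chart setT id id)
    (flat_surface_immersion torus_flat_surface) erefl).
  by exists u.
have EP (v : 'rV[R]_2) : v *m shape_operator eps g N (Chart setT id id) x = lambda *: v <->
    - eps * s * v 0 0 = - lambda * c * v 0 0 /\ c * v 0 1 = - lambda * s * v 0 1.
  have W := @weingarten_eigenP R eps heps setT g N openT (torus_smooth c s)
    (torus_smooth (- eps * s) c) gg nn ng nT ij x v lambda I.
  apply: (iff_trans W).
  have -> : - lambda *: 'D_v g x = 'D_v (torus (- lambda * c) (- lambda * s)) x.
    by rewrite !derive_torus scalerDr !scalerA !mulrA.
  exact: derive_torus_eq.
split=> [[_ [-> _ /eigenvalueP[v /EP[e0 e1] v0]]]|h].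
  have [z0|z0] := eqVneq (v 0 0) 0.
    have [z1|z1] := eqVneq (v 0 1) 0.
      by case/eqP: v0; apply/rowP => k; rewrite mxE; have [->|->] := ord2P k.
    by right; have := mulIf z1 e1; lra.
  by left; have := mulIf z0 e0; lra.
exists (Chart setT id id); split=> //; apply/eigenvalueP.
case: h => h.
  exists (delta_mx 0 0); last by apply/eqP => /rowP/(_ 0)/eqP; rewrite !mxE oner_eq0.
  by apply/EP; rewrite !mxE /= !mulr0 !mulr1; split=> //; lra.
exists (delta_mx 0 1); last by apply/eqP => /rowP/(_ 1)/eqP; rewrite !mxE oner_eq0.
by apply/EP; rewrite !mxE /= !mulr0 !mulr1; split=> //; lra.
Qed.

Let J : set R := [set t | `|t| < r].

Lemma torus_admissible : admissible eps A g N setT J.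
Proof.
have c0 := Ceps_angle_gt0; have s0 := Seps_angle_gt0; have r0 := angle_gt0; have p0 := pi_gt0 R.
have JE : J = ball (0 : R) r.
  by apply/seteqP; split=> t; rewrite /J /ball /= sub0r normrN.
split.
- exact: openT.
- by rewrite JE; exact: ball_open.
- move=> x y; rewrite /J /= !ltr_norml => /andP[x1 x2] /andP[y1 y2] z /andP[z1 z2].
  by rewrite /= ltr_norml; apply/andP; split; lra.
- by rewrite /J /= normr0.
move=> [x t] [_ Jt] theta /= /torus_curvatureP.
have /andP[t1 t2] : - r < t < r by move: Jt; rewrite /J /= ltr_norml.
rewrite /cteps.
(* Where S vanishes, division by zero gives [cteps theta] the value 0, which is not a principal
   curvature since c and s are nonzero. *)
have [S0|S0] := eqVneq (Seps eps theta) 0.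
  rewrite S0 invr0 mulr0 !mul0r => -[/esym/eqP|/esym/eqP].
    by rewrite mulf_eq0 (negPf (eps_neq0 heps)) gt_eqF.
  by rewrite oppr_eq0 gt_eqF.
move=> h.
(* By the addition formulas these say C(theta + r) = 0 or S(theta + r) = 0. For eps = 1 and theta in
   (0, pi) this forces r <= theta <= pi - r; for eps = -1 it leaves only theta = - r. *)
have {}h : Ceps eps theta * c - eps * Seps eps theta * s = 0
    \/ Seps eps theta * c + Ceps eps theta * s = 0.
  case: h => h; [left|right].
    have -> : Ceps eps theta * c = Ceps eps theta / Seps eps theta * c * Seps eps theta.
      by field.
    by rewrite h; ring.
  have -> : Ceps eps theta * s = Ceps eps theta / Seps eps theta * s * Seps eps theta.
    by field.
  by rewrite h; ring.
case: heps => e.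
  move: h; rewrite /c /s /Ceps /Seps e eqxx mul1r -cosD -sinD => h /andP[th0 thpi].
  have lo : r <= theta.
    rewrite leNgt; apply/negP => lt.
    have hc : 0 < cos (theta + r) by apply: cos_gt0_pihalf; apply/andP; move: lt; rewrite /r; split; lra.
    have hs : 0 < sin (theta + r) by apply: sin_gt0_pi; apply/andP; move: lt; rewrite /r; split; lra.
    by case: h => h; [rewrite h ltxx in hc|rewrite h ltxx in hs].
  have hi : theta <= pi - r.
    rewrite leNgt; apply/negP => lt.
    have hc : 0 < cos (theta + r - pi) by apply: cos_gt0_pihalf; apply/andP; move: lt; rewrite /r; split; lra.
    have hs : 0 < sin (theta + r - pi) by apply: sin_gt0_pi; apply/andP; move: lt; rewrite /r; split; lra.
    have ee : theta + r = theta + r - pi + pi by rewrite subrK.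
    move: h; rewrite ee cosDpi sinDpi => -[/eqP|/eqP]; rewrite oppr_eq0.
      by rewrite gt_eqF.
    by rewrite gt_eqF.
  by apply/andP; split; lra.
rewrite e N1_neq1 => th0.
move: h; rewrite /c /s /Ceps /Seps e N1_neq1.
have k1 := expR_gt0 theta; have k2 := expR_gt0 (- theta).
have k3 := expR_gt0 r; have k4 := expR_gt0 (- r).
have -> : (expR theta + expR (- theta)) / 2 * ((expR r + expR (- r)) / 2)
  - -1 * ((expR theta - expR (- theta)) / 2) * ((expR r - expR (- r)) / 2)
  = (expR theta * expR r + expR (- theta) * expR (- r)) / 2 by field.
have -> : (expR theta - expR (- theta)) / 2 * ((expR r + expR (- r)) / 2)
  + (expR theta + expR (- theta)) / 2 * ((expR r - expR (- r)) / 2)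
  = (expR theta * expR r - expR (- theta) * expR (- r)) / 2 by field.
rewrite -!expRD -opprD => -[h|h].
  have : 0 < (expR (theta + r) + expR (- (theta + r))) / 2.
    by rewrite divr_gt0 // addr_gt0 // expR_gt0.
  by rewrite h ltxx.
have : expR (theta + r) - expR (- (theta + r)) = 0 by lra.
move=> /sinh_eq0 thr; split=> [th|_]; lra.
Qed.

(** Equality of - s / c and - c / s would give c^2 = s^2, against c^2 - s^2 = 1. *)
Lemma torus_not_umbilical : eps = -1 -> ~ totally_umbilical eps A g N setT.
Proof.
move=> e h; have c0 := Ceps_angle_gt0; have s0 := Seps_angle_gt0; have CS := CepsSeps heps r.
have := h 0 (eps * s / c) (- c / s) I.
have l1 : principal_curvature eps A g N 0 (eps * s / c).
  by apply/torus_curvatureP; left; field; rewrite gt_eqF.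
have l2 : principal_curvature eps A g N 0 (- c / s).
  by apply/torus_curvatureP; right; field; rewrite gt_eqF.
move=> /(_ l1 l2) eq.
have : eps * s * s = - c * c.
  have -> : eps * s * s = eps * s / c * (c * s) by field; rewrite gt_eqF.
  by rewrite eq; field; rewrite gt_eqF.
move: CS; rewrite -/c -/s e !expr2; lra.
Qed.

End Torus.

Lemma curvature_slope {R : realType} (eps c : R) : eps = 1 \/ eps = -1 ->
  (if eps == 1 then 0 < c < 1 else -1 < c < 0) ->
  exists2 B, 0 < B & c = eps / (1 + B ^+ 2).
Proof.
move=> heps hc.
have [c0 h0] : c != 0 /\ 0 < eps / c - 1.
  case: heps hc => ->; rewrite ?eqxx ?N1_neq1 => /andP[c1 c2].
    by rewrite gt_eqF // subr_gt0 ltr_pdivlMr // mul1r.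
  by rewrite lt_eqF // subr_gt0 ltr_ndivlMr // mul1r.
exists (Num.sqrt (eps / c - 1)); first by rewrite sqrtr_gt0.
rewrite sqr_sqrtr ?ltW // addrC subrK invf_div mulrC divfK //.
exact: eps_neq0 heps.
Qed.

Unset Implicit Arguments.

Theorem mainTheorem3 (R : realType) (eps : R) (heps : eps = 1 \/ eps = -1) :
  (forall (M : topologicalType) (A : set (chart R M 2))
     (g N : M -> 'rV[R]_4) (V : set M) (I : set R) (B : R),
     flat_surface eps A g N -> admissible eps A g N V I -> 0 < B ->
     let f := hypersurface eps g N B in
     let A3 := cylinder_atlas (restrict_atlas A V) I in
     let a := Num.sqrt (1 + B ^+ 2) in
     [/\ forall s, I s ->
           immersion (restrict_atlas A V) (parallel_surface eps g N s),
         immersion A3 f /\ (forall p, (V `*` I) p -> Q3xR eps (f p)),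
         exists eta : M * R -> 'rV[R]_5,
           [/\ smooth_map A3 eta,
               normal_along eps A3 f eta &
               forall p, (V `*` I) p ->
                 [/\ ip eps (eta p) (eta p) = 1,
                     ip eps (eta p) (toE5 (horizontal (f p)) 0) = 0 &
                     ip eps (eta p) dt = 1 / a]],
         constant_curvature eps A3 f (eps / a ^+ 2) /\
         eps / a ^+ 2 = eps / (1 + B ^+ 2) &
         V !=set0 -> (eps = -1 -> ~ totally_umbilical eps A g N V) ->
           nonrotational eps (f @` (V `*` I))])
  /\
  (forall c : R, (if eps == 1 then 0 < c < 1 else -1 < c < 0) ->
     exists B : R, [/\ 0 < B, c = eps / (1 + B ^+ 2) &
       exists (M : topologicalType) (A : set (chart R M 2))
         (g N : M -> 'rV[R]_4) (V : set M) (I : set R),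
         [/\ flat_surface eps A g N, admissible eps A g N V I, V !=set0,
             constant_curvature eps
               (cylinder_atlas (restrict_atlas A V) I)
               (hypersurface eps g N B) c &
             nonrotational eps (hypersurface eps g N B @` (V `*` I))]]).

Proof.
split=> [|c /(curvature_slope heps)[B B0 cE]]; last first.
  have fs := torus_flat_surface heps; have ad := torus_admissible heps.
  exists B; split=> //.
  have V0 : [set: 'rV[R]_2] !=set0 by exists 0.
  do 6 eexists; split; [exact: fs|exact: ad|exact: V0| |].
    by have := hypersurface_constant_curvature heps fs ad B0; rewrite slope_norm_sqr -cE.
  exact: (hypersurface_nonrotational heps fs ad B0 V0 (torus_not_umbilical heps)).
move=> M A g N V I B fs ad B0 f A3 a; split.
- by move=> s; exact: parallel_immersion.
- split; first exact: (hypersurface_immersion heps fs ad B0).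
  by move=> p Vp; exact: (hypersurface_Q3xR heps fs B Vp).
- exists (normal_field eps g N B); split.
  + exact: (normal_field_smooth heps fs ad B).
  + exact: (normal_field_normal heps fs ad B).
  + by move=> p _; exact: (normal_field_unit heps fs B p).
- split; first exact: (hypersurface_constant_curvature heps fs ad B0).
  by rewrite slope_norm_sqr.
- exact: (hypersurface_nonrotational heps fs ad B0).
Qed.
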